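(* Given $n\in\mathbb{N}$ and $m=m(n)\in\mathbb{N}$, $m\to\infty$ as $n\to\infty$, consider the $n\times n$ matrix $$\mathcal{A}_n=\sum_{\alpha=1}^m\xi_\alpha(\mathbf{x}_\alpha\mathbf{y}_\alpha^T+\mathbf{y}_\alpha\mathbf{x}_\alpha^T),$$ where: (i) $(\xi_\alpha)_\alpha$ are i.i.d. copies of a $0/1$ random variable $\xi=\xi_n$ with $\mathbf{P}(\xi_n=1)=p_n$, independent of $(\mathbf{x}_\alpha,\mathbf{y}_\alpha)_\alpha$; (ii) $\frac mn p_n\to c_1>0$ as $n\to\infty$; (iii) $(\mathbf{x}_\alpha)_\alpha,(\mathbf{y}_\alpha)_\alpha\subset\mathbb{R}^n$ are two sets of random vectors such that the pairs $(\mathbf{x}_\alpha,\mathbf{y}_\alpha)$, $\alpha\le m$, are mutually independent (for a given $\alpha$, $\mathbf{x}_\alpha$ and $\mathbf{y}_\alpha$ may be dependent), $\|\mathbf{x}_\alpha\|_2^2\le C_0$ and $\|\mathbf{y}_\alpha\|_2^2\le C_0$ for some $C_0>0$, and for all deterministic $n\times n$ matrices $D=D_n$ with $\|D\|_{op}=1$, $$\sup_{\mathbf{u},\mathbf{v}\in(\mathbf{x}_\alpha,\mathbf{y}_\alpha)_\alpha}\mathbf{Var}(D\mathbf{u},\mathbf{v})=o(1),\quad n\to\infty,$$ the supremum being over all $\mathbf{u},\mathbf{v}$ in the collection of vectors $\mathbf{x}_\alpha,\mathbf{y}_\alpha$, $\alpha\le m$; (iv) the matrices $Q^{x\alpha}:=\mathbf{E}\,\mathbf{x}_\alpha\mathbf{x}_\alpha^T$,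 $Q^{y\alpha}:=\mathbf{E}\,\mathbf{y}_\alpha\mathbf{y}_\alpha^T$ and $Q^{xy\alpha}:=\mathbf{E}\,\mathbf{x}_\alpha\mathbf{y}_\alpha^T$ have operator norms of order $O(n^{-1})$, and $$\sup_{Q_\alpha\in(Q^{x\alpha},Q^{y\alpha})_\alpha}|\operatorname{Tr}Q_\alpha-1|=o(1);$$ (v) for all $n\times n$ matrices $K_1,K_2$, $$\frac1m\sum_{\alpha=1}^m\operatorname{Tr}(Q^{x\alpha}K_1)\operatorname{Tr}(Q^{y\alpha}K_2)=\frac1n\operatorname{Tr}K_1\cdot\frac1n\operatorname{Tr}K_2;$$ (vi) the matrix $Q^{xy}:=\big(\frac1m\sum_{\alpha=1}^m|Q^{xy\alpha}_{ij}|\big)_{i,j}$ satisfies $\|Q^{xy}\|_{HS}=o(n^{-1/2})$. Then as $n\to\infty$ the empirical spectral distributions $N_{\mathcal{A}_n}$ converge in probability to a non-random probability measure $N_{\mathcal{A}}$ whose Stieltjes transform $f$ is uniquely determined by the equation $$zf^3+(1-2c_1)f^2-zf-1=0$$ in the class of Stieltjes transforms of non-negative measures.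
   Context: For a real symmetric $n\times n$ matrix $M$ with eigenvalues $(\lambda_i)_i$, its empirical spectral distribution is $N_M(\Delta)=|\{i:\lambda_i\in\Delta\}|/n$, $\Delta\subset\mathbb{R}$; convergence in probability of random measures is with respect to the weak topology. The Stieltjes transform of a non-negative measure $N$ is $\int\frac{N(d\lambda)}{\lambda-z}$, $\Im z\neq0$. $\|\cdot\|_{op}$ and $\|\cdot\|_{HS}$ are the operator and Hilbert-Schmidt norms, $\|\cdot\|_2$ the Euclidean norm and $(\cdot,\cdot)$ the Euclidean inner product. The bounds $O(n^{-1})$ in (iv) are uniform in $\alpha\le m$. *)

(* Defs.v *)
From HB Require Import structures.
From mathcomp Require Import all_boot all_order all_algebra.
From mathcomp Require Import complex.
From mathcomp Require Import all_classical all_reals all_analysis.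

Set Implicit Arguments.
Unset Strict Implicit.
Unset Printing Implicit Defensive.

Import Order.TTheory GRing.Theory Num.Theory.
Import numFieldNormedType.Exports.

Local Open Scope classical_set_scope.
Local Open Scope ring_scope.

(* The library's norm `|_| on matrices and vectors is the max-norm, hence the
   separate norms below. *)

Definition inner (R : realType) (n : nat) (u v : 'cV[R]_n) : R :=
  \sum_(i < n) u i 0 * v i 0.

Definition norm2 (R : realType) (n : nat) (u : 'cV[R]_n) : R :=
  Num.sqrt (inner u u).

Definition op_norm (R : realType) (n : nat) (A : 'M[R]_n) : R :=
  sup [set norm2 (A *m u) | u in [set u : 'cV[R]_n | norm2 u <= 1]].

Definition hs_norm (R : realType) (n : nat) (A : 'M[R]_n) : R :=
  Num.sqrt (\sum_(i < n) \sum_(j < n) A i j ^+ 2).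

Definition mutually_independent (R : realType) (d : measure_display)
    (T : measurableType d) (P : probability T R) (I : finType)
    (F : I -> set (set T)) : Prop :=
  forall (J : {set I}) (A : I -> set T), (forall i, i \in J -> F i (A i)) ->
    P (\bigcap_(i in [set` J]) A i) = (\prod_(i in J) P (A i))%E.

Definition independent2 (R : realType) (d : measure_display)
    (T : measurableType d) (P : probability T R) (F G : set (set T)) : Prop :=
  forall A B, F A -> G B -> P (A `&` B) = (P A * P B)%E.

Definition sigma_of (d d' : measure_display) (T : measurableType d)
    (T' : measurableType d') (I : Type) (X : I -> T -> T') : set (set T) :=
  <<s \bigcup_(i in [set: I]) preimage_set_system setT (X i) measurable >>.

(* Random vectors are given by their coordinates: their Borel sigma-algebra is
   the one generated by the coordinates. *)

Definition random_vector (R : realType) (d : measure_display)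
    (T : measurableType d) (n : nat) (u : T -> 'cV[R]_n) : Prop :=
  forall i, measurable_fun setT (fun w => u w i 0).

Definition pair_coord (R : realType) (d : measure_display)
    (T : measurableType d) (n : nat) (x y : T -> 'cV[R]_n)
    (k : 'I_n + 'I_n) : T -> R :=
  match k with
  | inl i => fun w => x w i 0
  | inr i => fun w => y w i 0
  end.

Definition mean_mx (R : realType) (d : measure_display)
    (T : measurableType d) (P : probability T R) (p q : nat)
    (M : T -> 'M[R]_(p, q)) : 'M[R]_(p, q) :=
  \matrix_(i, j) fine 'E_P[fun w => M w i j].

(* The eigenvalues of M listed with multiplicity, in an unspecified order
   (which does not affect esd).  The list exists when M is symmetric; the
   default [::] is then never used. *)
Definition eigenvalues (R : realType) (n : nat) (M : 'M[R]_n) : seq R :=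
  xget [::] [set s | char_poly M = \prod_(l <- s) ('X - l%:P)].

Definition esd (R : realType) (n : nat) (M : 'M[R]_n) :
    {measure set R -> \bar R} :=
  mscale (n%:R^-1)%:nng
    (msum (fun i => dirac (nth 0 (eigenvalues M) i))
          (size (eigenvalues M))).

(* Finite intersections of subbasic sets: the basic neighbourhoods of N in the
   weak topology when the phi i are continuous and bounded. *)
Definition weak_nbhd (R : realType)
    (N : {measure set R -> \bar R}) (k : nat)
    (phi : 'I_k -> R -> R) (e : R) :
    set {measure set R -> \bar R} :=
  [set M | forall i, `| (\int[M]_l phi i l) - (\int[N]_l phi i l) | < e].

Definition cvg_in_prob_weakly (R : realType) (d : nat -> measure_display)
    (T : forall n, measurableType (d n)) (P : forall n, probability (T n) R)
    (M : forall n, T n -> {measure set R -> \bar R})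
    (N : {measure set R -> \bar R}) : Prop :=
  forall (k : nat) (phi : 'I_k -> R -> R) (e : R),
    (forall i, continuous (phi i)) ->
    (forall i, exists C, forall l, `|phi i l| <= C) ->
    0 < e ->
    P n [set w | ~ weak_nbhd N phi e (M n w)] @[n --> \oo] --> 0%E.

Definition stieltjes_kernel (R : realType) (z : R[i]) (l : R) : R[i] :=
  (real_complex R l - z)^-1.

Definition stieltjes (R : realType)
    (N : {measure set R -> \bar R}) (z : R[i]) : R[i] :=
  Complex (\int[N]_l complex.Re (stieltjes_kernel z l))
          (\int[N]_l complex.Im (stieltjes_kernel z l)).

(* N may be infinite: this says that the integral defining its Stieltjes
   transform converges absolutely at every non-real z. *)
Definition has_stieltjes (R : realType)
    (N : {measure set R -> \bar R}) : Prop :=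
  forall z : R[i], complex.Im z != 0 ->
    N.-integrable setT (EFin \o (fun l => complex.Re (stieltjes_kernel z l))) /\
    N.-integrable setT (EFin \o (fun l => complex.Im (stieltjes_kernel z l))).

Definition solves_cubic (R : realType) (c : R) (f : R[i] -> R[i]) : Prop :=
  forall z : R[i], complex.Im z != 0 ->
    z * f z ^+ 3 + (1 - 2 * real_complex R c) * f z ^+ 2 - z * f z - 1 = 0.

(* Main.v *)
(* Let G = (A - z)^-1 and t_D = n^-1 Tr (D G) for deterministic D.  Expanding
   n^-1 Tr (D A G) over the summands of A, each summand enters through a
   rank-two perturbation of the resolvent of the others; the bilinear forms in
   x_a, y_a that result concentrate by (iii), and (iv)-(vi) turn their averages
   into traces.  So if t_D is L1-close to f n^-1 Tr D, uniformly over the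
   contractions D, then (n^-1 Tr D + z t_D)(1 - f^2) + 2 c f^2 n^-1 Tr D is close
   to 0.  For large Im z this is a contraction towards the small root f of the
   cubic, which gives t_D ~ f n^-1 Tr D; interpolating the resolvent at nodes
   far above z carries this to the whole upper half-plane, and D = 1 yields the
   cubic again.

   Linear statistics of the eigenvalues thus become deterministic for the
   Poisson kernels and their conjugates, hence, by Riemann sums, for arctangents,
   for u atan(u), for the limits |b - t| - |a - t| of these, for ramps, and
   finally for every bounded continuous function; the cubic gives tightness, so
   the limiting functional is a probability measure.

   The cubic says z = -1/f + c/(f - 1) + c/(f + 1), and by Cauchy-Schwarz this
   has at most one solution f with Im f > 0. *)

Require Import Defs.
From HB Require Import structures.
From mathcomp Require Import all_boot all_order all_algebra.
From mathcomp Require Import complex.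
From mathcomp Require Import all_classical all_reals all_analysis.
From mathcomp Require Import measurable_realfun.
From mathcomp Require Import ring lra.

Set Implicit Arguments.
Unset Strict Implicit.
Unset Printing Implicit Defensive.

Import Order.TTheory GRing.Theory Num.Theory.
Import numFieldNormedType.Exports.

Local Open Scope classical_set_scope.
Local Open Scope ring_scope.

(** * Complex moduli and operator bounds *)

Section ComplexModulus.
Context {R : realType}.
Implicit Types (z w : R[i]) (a b : R).

(** The equation for n^-1 Tr G alone does not close: u^T G u concentrates around Tr (Q G), where the
    moment matrix Q varies with the summand and is constrained only on average. As n Q has bounded
    norm, Tr (Q G) is again of the form t_D, and the unknown has to be the whole family of t_D over
    contractions D. Closeness is measured in L1 to a deterministic multiple of n^-1 Tr D, so that
    one contraction argument gives both the self-averaging of the traces and the value of the limit,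
    without a separate variance estimate for traces. The hypothesis on variances speaks of one
    sequence of matrices at a time; it becomes uniform in D by applying it to a sequence of matrices
    that violate the bound whenever some matrix does. The determinant (1 + x^T G y)^2 - (x^T G
    x)(y^T G y) of a rank-two perturbation may be small, hence the identities are kept polynomial.

    The eigenvalues come from a choice, with no measurability attached. Linear statistics are shown
    to be measurable along with their convergence: for resolvent kernels they are traces of
    resolvents, and the property passes to limits. *)

Definition cabs z : R := Normc.normc z.
Arguments cabs : simpl never.

Lemma cabsE z : cabs z = Num.sqrt (complex.Re z ^+ 2 + complex.Im z ^+ 2).
Proof. by case: z. Qed.

Lemma cabs_ge0 z : 0 <= cabs z. Proof. by rewrite cabsE sqrtr_ge0. Qed.

Lemma cabs_sqr z : cabs z ^+ 2 = complex.Re z ^+ 2 + complex.Im z ^+ 2.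
Proof. by rewrite cabsE sqr_sqrtr// addr_ge0// sqr_ge0. Qed.

Lemma cabs0 : cabs 0 = 0. Proof. exact: Normc.normc0. Qed.
Lemma cabs1 : cabs 1 = 1. Proof. exact: Normc.normc1. Qed.
Lemma cabsM z w : cabs (z * w) = cabs z * cabs w.
Proof. exact: Normc.normcM. Qed.
Lemma cabsV z : cabs z^-1 = (cabs z)^-1. Proof. exact: Normc.normcV. Qed.
Lemma cabsD z w : cabs (z + w) <= cabs z + cabs w.
Proof. exact: le_normcD. Qed.
Lemma cabsN z : cabs (- z) = cabs z. Proof. exact: normcN. Qed.
Lemma cabsB z w : cabs (z - w) <= cabs z + cabs w.
Proof. by rewrite -(cabsN w) cabsD. Qed.
Lemma cabs_eq0 z : (cabs z == 0) = (z == 0).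
Proof. by apply/eqP/eqP => [/Normc.eq0_normc|->]; rewrite ?cabs0. Qed.
Lemma cabs_gt0 z : (0 < cabs z) = (z != 0).
Proof. by rewrite lt_def cabs_ge0 andbT cabs_eq0. Qed.
Lemma cabsX z n : cabs (z ^+ n) = cabs z ^+ n.
Proof. by elim: n => [|n IH]; rewrite ?expr0 ?cabs1// !exprS cabsM IH. Qed.

Lemma cabs_real a : cabs (real_complex R a) = `|a|.
Proof. by rewrite cabsE /= expr0n addr0 sqrtr_sqr. Qed.

Lemma cabs_sum (I : Type) (s : seq I) (Q : pred I) (F : I -> R[i]) :
  cabs (\sum_(i <- s | Q i) F i) <= \sum_(i <- s | Q i) cabs (F i).
Proof.
elim/big_ind2 : _ => [|x1 x2 y1 y2 h1 h2|//]; first by rewrite cabs0.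
exact: le_trans (cabsD _ _) (lerD h1 h2).
Qed.

Lemma Re_le_cabs z : `|complex.Re z| <= cabs z.
Proof. by rewrite -sqrtr_sqr cabsE ler_wsqrtr// lerDl sqr_ge0. Qed.

Lemma Im_le_cabs z : `|complex.Im z| <= cabs z.
Proof. by rewrite -sqrtr_sqr cabsE ler_wsqrtr// lerDr sqr_ge0. Qed.

Lemma cabs_le_ReIm z : cabs z <= `|complex.Re z| + `|complex.Im z|.
Proof.
rewrite -(@ler_pXn2r _ 2)// ?nnegrE ?cabs_ge0 ?addr_ge0//.
rewrite cabs_sqr sqrrD !real_normK ?num_real//.
by rewrite -addrA lerD2l lerDr mulrn_wge0// mulr_ge0.
Qed.

Lemma cReM z w : complex.Re (z * w) =
  complex.Re z * complex.Re w - complex.Im z * complex.Im w.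
Proof. by case: z w => [a b] [c d]. Qed.
Lemma cImM z w : complex.Im (z * w) =
  complex.Re z * complex.Im w + complex.Im z * complex.Re w.
Proof. by case: z w => [a b] [c d]. Qed.
Lemma cReD z w : complex.Re (z + w) = complex.Re z + complex.Re w.
Proof. by case: z w => [a b] [c d]. Qed.
Lemma cImD z w : complex.Im (z + w) = complex.Im z + complex.Im w.
Proof. by case: z w => [a b] [c d]. Qed.
Lemma cReN z : complex.Re (- z) = - complex.Re z. Proof. by case: z. Qed.
Lemma cImN z : complex.Im (- z) = - complex.Im z. Proof. by case: z. Qed.

Lemma cRe_sum (I : Type) (s : seq I) (Q : pred I) (F : I -> R[i]) :
  complex.Re (\sum_(i <- s | Q i) F i) = \sum_(i <- s | Q i) complex.Re (F i).
Proof. by elim/big_rec2 : _ => [//|i y1 y2 _ <-]; rewrite cReD. Qed.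
Lemma cIm_sum (I : Type) (s : seq I) (Q : pred I) (F : I -> R[i]) :
  complex.Im (\sum_(i <- s | Q i) F i) = \sum_(i <- s | Q i) complex.Im (F i).
Proof. by elim/big_rec2 : _ => [//|i y1 y2 _ <-]; rewrite cImD. Qed.

Lemma complex_eq z w :
  complex.Re z = complex.Re w -> complex.Im z = complex.Im w -> z = w.
Proof. by case: z w => [a b] [c d] /= -> ->. Qed.

End ComplexModulus.
Arguments cabs : simpl never.

Section OperatorBounds.
Context {R : realType}.
Local Notation C := R[i].
Local Notation toC := (map_mx (real_complex R)).

Definition cnorm2 n (u : 'cV[C]_n) : R := \sum_(i < n) cabs (u i 0) ^+ 2.

(** An operator norm bound as a quadratic inequality: it composes without suprema or square
    roots. *)
Definition copb n (M : 'M[C]_n) (K : R) : Prop :=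
  forall u, cnorm2 (M *m u) <= K ^+ 2 * cnorm2 u.

Definition opb n (D : 'M[R]_n) (K : R) : Prop :=
  forall u, inner (D *m u) (D *m u) <= K ^+ 2 * inner u u.

Lemma innerC n (u v : 'cV[R]_n) : inner u v = inner v u.
Proof. by apply: eq_bigr => i _; rewrite mulrC. Qed.

Lemma innerDl n (u v w : 'cV[R]_n) : inner (u + v) w = inner u w + inner v w.
Proof. by rewrite /inner -big_split; apply: eq_bigr => i _; rewrite mxE mulrDl. Qed.

Lemma innerZl n a (u v : 'cV[R]_n) : inner (a *: u) v = a * inner u v.
Proof. by rewrite /inner mulr_sumr; apply: eq_bigr => i _; rewrite mxE mulrA. Qed.

Lemma innerDr n (u v w : 'cV[R]_n) : inner w (u + v) = inner w u + inner w v.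
Proof. by rewrite innerC innerDl !(innerC w). Qed.

Lemma innerZr n a (u v : 'cV[R]_n) : inner v (a *: u) = a * inner v u.
Proof. by rewrite innerC innerZl innerC. Qed.

Lemma inner_ge0 n (u : 'cV[R]_n) : 0 <= inner u u.
Proof. by apply: sumr_ge0 => i _; rewrite -expr2 sqr_ge0. Qed.

Lemma innerE n (u v : 'cV[R]_n) : inner u v = (u^T *m v) 0 0.
Proof. by rewrite mxE; apply: eq_bigr => i _; rewrite mxE. Qed.

Lemma inner_mulmx n (M : 'M[R]_n) (u v : 'cV[R]_n) :
  inner (M *m u) v = inner u (M^T *m v).
Proof. by rewrite !innerE trmx_mul mulmxA. Qed.

Lemma cauchy_schwarz (I : finType) (f g : I -> R) :
  (\sum_i f i * g i) ^+ 2 <= (\sum_i f i ^+ 2) * (\sum_i g i ^+ 2).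
Proof.
set a := \sum_i f i ^+ 2; set b := \sum_i g i ^+ 2; set c := \sum_i f i * g i.
have h (s t : R) : 0 <= s ^+ 2 * a + 2 * s * t * c + t ^+ 2 * b.
  have -> : s ^+ 2 * a + 2 * s * t * c + t ^+ 2 * b = \sum_i (s * f i + t * g i) ^+ 2.
    rewrite /a /b /c !mulr_sumr -!big_split/=.
    by apply: eq_bigr => i _; ring.
  by apply: sumr_ge0 => i _; rewrite sqr_ge0.
have a0 : 0 <= a by apply: sumr_ge0 => i _; rewrite sqr_ge0.
have b0 : 0 <= b by apply: sumr_ge0 => i _; rewrite sqr_ge0.
(* At (c, -a) the form equals a (a b - c^2). If a = 0, its value at (-(b + 1), c) is -(b + 2) c^2
   and forces c = 0. *)
have := h c (- a); have [a_eq0|an0] := eqVneq a 0.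
  move=> _; have := h (- (b + 1)) c; rewrite a_eq0.
  by nra.
have {an0} ap : 0 < a by rewrite lt_def an0 a0.
move=> h'; have : 0 <= a * (a * b - c ^+ 2) by nra.
by rewrite pmulr_rge0// subr_ge0.
Qed.

Lemma cnorm2_ge0 n (u : 'cV[C]_n) : 0 <= cnorm2 u.
Proof. by apply: sumr_ge0 => i _; rewrite sqr_ge0. Qed.

Lemma cnorm2_toC n (u : 'cV[R]_n) : cnorm2 (toC u) = inner u u.
Proof.
by apply: eq_bigr => i _; rewrite mxE cabs_real real_normK ?num_real// expr2.
Qed.

Lemma cnorm2_ReIm n (u : 'cV[C]_n) :
  cnorm2 u = inner (map_mx (@complex.Re R) u) (map_mx (@complex.Re R) u) +
             inner (map_mx (@complex.Im R) u) (map_mx (@complex.Im R) u).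
Proof.
rewrite /inner -big_split; apply: eq_bigr => i _.
by rewrite !mxE cabs_sqr !expr2.
Qed.

Lemma cnorm2_coord n (u : 'cV[C]_n) i : cabs (u i 0) ^+ 2 <= cnorm2 u.
Proof.
by rewrite /cnorm2 (bigD1 i)//= lerDl sumr_ge0// => j _; rewrite sqr_ge0.
Qed.

(** Bilinear, without conjugation: the resolvent of a real symmetric matrix is symmetric, not
    Hermitian. *)
Definition cdot n (u v : 'cV[C]_n) : C := \sum_(i < n) u i 0 * v i 0.

Lemma cdotE n (u v : 'cV[C]_n) : cdot u v = (u^T *m v) 0 0.
Proof. by rewrite mxE; apply: eq_bigr => i _; rewrite mxE. Qed.

Lemma cdot_cs n (u v : 'cV[C]_n) : cabs (cdot u v) ^+ 2 <= cnorm2 u * cnorm2 v.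
Proof.
have h := cauchy_schwarz (fun i => cabs (u i 0)) (fun i => cabs (v i 0)).
apply: le_trans h; rewrite ler_pXn2r// ?nnegrE ?cabs_ge0//; last first.
  by apply: sumr_ge0 => i _; rewrite mulr_ge0// cabs_ge0.
apply: le_trans (cabs_sum _ _ _) _; apply: ler_sum => i _.
by rewrite cabsM.
Qed.

Lemma cdot_le n (u v : 'cV[C]_n) a b : 0 <= a -> 0 <= b ->
  cnorm2 u <= a ^+ 2 -> cnorm2 v <= b ^+ 2 -> cabs (cdot u v) <= a * b.
Proof.
move=> a0 b0 ha hb.
rewrite -(@ler_pXn2r _ 2)// ?nnegrE ?cabs_ge0 ?mulr_ge0//.
by apply: le_trans (cdot_cs _ _) _; rewrite exprMn ler_pM// cnorm2_ge0.
Qed.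

Lemma copbM n (M N : 'M[C]_n) K L : copb M K -> copb N L -> copb (M *m N) (K * L).
Proof.
move=> hM hN u; rewrite -mulmxA; apply: le_trans (hM _) _.
by rewrite exprMn -(mulrA (K ^+ 2)) ler_wpM2l ?sqr_ge0.
Qed.

Lemma copb_le n (M : 'M[C]_n) K L : 0 <= K -> K <= L -> copb M K -> copb M L.
Proof.
move=> K0 KL hM u; apply: le_trans (hM u) _.
by rewrite ler_wpM2r ?cnorm2_ge0// ler_pXn2r// nnegrE// (le_trans K0).
Qed.

Lemma cnorm2Z n a (u : 'cV[C]_n) : cnorm2 (a *: u) = cabs a ^+ 2 * cnorm2 u.
Proof. by rewrite /cnorm2 mulr_sumr; apply: eq_bigr => i _; rewrite mxE cabsM exprMn. Qed.

Lemma copbZ n a (M : 'M[C]_n) K : copb M K -> copb (a *: M) (cabs a * K).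
Proof.
move=> hM u; rewrite -scalemxAl cnorm2Z exprMn -(mulrA (_ ^+ 2)) ler_wpM2l ?sqr_ge0//.
Qed.

Lemma Re_mulmx n (D : 'M[R]_n) (u : 'cV[C]_n) :
  map_mx (@complex.Re R) (toC D *m u) = D *m map_mx (@complex.Re R) u.
Proof.
apply/matrixP => i j; rewrite !mxE cRe_sum; apply: eq_bigr => k _.
by rewrite !mxE cReM /= mul0r subr0.
Qed.

Lemma Im_mulmx n (D : 'M[R]_n) (u : 'cV[C]_n) :
  map_mx (@complex.Im R) (toC D *m u) = D *m map_mx (@complex.Im R) u.
Proof.
apply/matrixP => i j; rewrite !mxE cIm_sum; apply: eq_bigr => k _.
by rewrite !mxE cImM /= mul0r addr0.
Qed.

Lemma toC_opb n (D : 'M[R]_n) K : opb D K -> copb (toC D) K.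
Proof.
move=> hD u; rewrite !cnorm2_ReIm mulrDr.
by rewrite Re_mulmx Im_mulmx; exact: lerD.
Qed.

Lemma copb_Re n (M : 'M[C]_n) K : copb M K -> opb (map_mx (@complex.Re R) M) K.
Proof.
move=> hM u; have := hM (toC u); rewrite cnorm2_toC; apply: le_trans.
rewrite cnorm2_ReIm.
have -> : map_mx (@complex.Re R) (M *m toC u) = map_mx (@complex.Re R) M *m u.
  apply/matrixP => i j; rewrite !mxE cRe_sum; apply: eq_bigr => k _.
  by rewrite !mxE cReM /= mulr0 subr0.
by rewrite lerDl inner_ge0.
Qed.

Lemma copb_Im n (M : 'M[C]_n) K : copb M K -> opb (map_mx (@complex.Im R) M) K.
Proof.
move=> hM u; have := hM (toC u); rewrite cnorm2_toC; apply: le_trans.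
rewrite cnorm2_ReIm.
have -> : map_mx (@complex.Im R) (M *m toC u) = map_mx (@complex.Im R) M *m u.
  apply/matrixP => i j; rewrite !mxE cIm_sum; apply: eq_bigr => k _.
  by rewrite !mxE cImM /= mulr0 add0r.
by rewrite lerDr inner_ge0.
Qed.

Lemma cnorm2_delta n (j : 'I_n) : cnorm2 (delta_mx j 0 : 'cV[C]_n) = 1.
Proof.
rewrite /cnorm2 (bigD1 j)//= mxE !eqxx cabs1 expr1n big1 ?addr0// => i ij.
by rewrite mxE (negbTE ij) cabs0 expr0n.
Qed.

Lemma copb_col n (M : 'M[C]_n) K j : copb M K ->
  \sum_(i < n) cabs (M i j) ^+ 2 <= K ^+ 2.
Proof.
move=> hM; have := hM (delta_mx j 0); rewrite cnorm2_delta mulr1.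
rewrite -colE; apply: le_trans.
by rewrite /cnorm2; apply: ler_sum => i _; rewrite mxE.
Qed.

Lemma copb_coord n (M : 'M[C]_n) K i j : 0 <= K -> copb M K -> cabs (M i j) <= K.
Proof.
move=> K0 hM; rewrite -(@ler_pXn2r _ 2)// ?nnegrE ?cabs_ge0//.
apply: le_trans (copb_col j hM); rewrite (bigD1 i)//= lerDl sumr_ge0// => k _.
by rewrite sqr_ge0.
Qed.

Lemma copb_hs n (M : 'M[C]_n) K : copb M K ->
  \sum_(i < n) \sum_(j < n) cabs (M i j) ^+ 2 <= n%:R * K ^+ 2.
Proof.
move=> hM; rewrite exchange_big/=.
apply: (@le_trans _ _ (\sum_(j < n) K ^+ 2)).
  by apply: ler_sum => j _; apply: copb_col.
by rewrite sumr_const card_ord mulr_natl.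
Qed.

Lemma copb_tr n (M : 'M[C]_n) K : 0 <= K -> copb M K -> cabs (\tr M) <= n%:R * K.
Proof.
move=> K0 hM; apply: le_trans (cabs_sum _ _ _) _.
apply: (@le_trans _ _ (\sum_(j < n) K)).
  by apply: ler_sum => j _; apply: copb_coord.
by rewrite sumr_const card_ord mulr_natl.
Qed.

Lemma opbM n (M N : 'M[R]_n) K L : opb M K -> opb N L -> opb (M *m N) (K * L).
Proof.
move=> hM hN u; rewrite -mulmxA; apply: le_trans (hM _) _.
by rewrite exprMn -(mulrA (K ^+ 2)) ler_wpM2l ?sqr_ge0.
Qed.

Lemma opbZ n a (M : 'M[R]_n) K : opb M K -> opb (a *: M) (a * K).
Proof.
move=> hM u; rewrite -scalemxAl innerZl innerZr mulrA -expr2 exprMn -(mulrA (_ ^+ 2)).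
by rewrite ler_wpM2l ?sqr_ge0.
Qed.

Lemma opb1 n : opb (1%:M : 'M[R]_n) 1.
Proof. by move=> u; rewrite mul1mx expr1n mul1r. Qed.

Lemma opb_le n (M : 'M[R]_n) K L : 0 <= K -> K <= L -> opb M K -> opb M L.
Proof.
move=> K0 KL hM u; apply: le_trans (hM u) _.
by rewrite ler_wpM2r ?inner_ge0// ler_pXn2r// nnegrE// (le_trans K0).
Qed.

Lemma tr_toC n (M : 'M[R]_n) : \tr (toC M) = real_complex R (\tr M).
Proof. by rewrite /mxtrace rmorph_sum; apply: eq_bigr => i _; rewrite mxE. Qed.

Lemma opb_tr n (M : 'M[R]_n) K : 0 <= K -> opb M K -> `|\tr M| <= n%:R * K.
Proof.
by move=> K0 /toC_opb/(copb_tr K0); rewrite tr_toC cabs_real.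
Qed.

End OperatorBounds.

(** * Resolvents and rank-two perturbations *)

Section Resolvent.
Context {R : realType}.
Local Notation C := R[i].
Local Notation toC := (map_mx (real_complex R)).

Definition resolvent n (A : 'M[R]_n) (z : C) : 'M[C]_n := invmx (toC A - z%:M).

Lemma unitmx_ker0 n (M : 'M[C]_n) :
  (forall u : 'cV[C]_n, M *m u = 0 -> u = 0) -> M \in unitmx.
Proof.
move=> h; rewrite -unitmx_tr -row_free_unit -kermx_eq0; apply/eqP.
apply/row_matrixP => i; rewrite row0.
have /h /(congr1 trmx) : M *m (row i (kermx M^T))^T = 0.
  apply: trmx_inj; rewrite trmx_mul trmxK -row_mul mulmx_ker row0.
  by rewrite trmx0.
by rewrite trmxK trmx0.
Qed.

(** With z = x + i y and B = A - x, the symmetry of B cancels the cross terms, so that |(B - i y)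
    u|^2 = |B u|^2 + y^2 |u|^2. Invertibility and the norm bound of the resolvent both follow. *)
Lemma sub_scalar_lower n (A : 'M[R]_n) (z : C) (u : 'cV[C]_n) : A^T = A ->
  complex.Im z ^+ 2 * cnorm2 u <= cnorm2 ((toC A - z%:M) *m u).
Proof.
move=> sA; set x := complex.Re z; set y := complex.Im z.
pose B : 'M[R]_n := A - x%:M.
pose u1 := map_mx (@complex.Re R) u; pose u2 := map_mx (@complex.Im R) u.
have sB : B^T = B by rewrite /B linearB/= sA tr_scalar_mx.
have eRe : map_mx (@complex.Re R) ((toC A - z%:M) *m u) = B *m u1 + y *: u2.
  rewrite mulmxBl mul_scalar_mx /B mulmxBl mul_scalar_mx -Re_mulmx.
  by apply/matrixP => i j; rewrite !mxE cReD cReN cReM -/x -/y; ring.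
have eIm : map_mx (@complex.Im R) ((toC A - z%:M) *m u) = B *m u2 + (- y) *: u1.
  rewrite mulmxBl mul_scalar_mx /B mulmxBl mul_scalar_mx -Im_mulmx.
  by apply/matrixP => i j; rewrite !mxE cImD cImN cImM -/x -/y; ring.
rewrite !cnorm2_ReIm eRe eIm -/u1 -/u2.
rewrite !innerDl !innerDr !innerZl !innerZr.
have e12 : inner (B *m u2) u1 = inner u2 (B *m u1) by rewrite inner_mulmx sB.
rewrite e12 (innerC u1 (B *m u2)) e12 (innerC (B *m u1) u2).
rewrite -subr_ge0; apply: le_trans (addr_ge0 (inner_ge0 (B *m u1)) (inner_ge0 (B *m u2))) _.
by rewrite le_eqVlt; apply/orP; left; apply/eqP; ring.
Qed.

Lemma resolvent_unit n (A : 'M[R]_n) (z : C) : A^T = A -> complex.Im z != 0 ->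
  toC A - z%:M \in unitmx.
Proof.
move=> sA z0; apply: unitmx_ker0 => u Mu0.
have := sub_scalar_lower z u sA; rewrite Mu0.
have -> : cnorm2 (0 : 'cV[C]_n) = 0.
  by rewrite /cnorm2 big1// => i _; rewrite mxE cabs0 expr0n.
rewrite pmulr_rle0 ?exprn_even_gt0// => h.
have {}h : cnorm2 u = 0 by apply/le_anti; rewrite h cnorm2_ge0.
apply/matrixP => i j; rewrite ord1 mxE; apply/eqP; rewrite -cabs_eq0.
by rewrite -sqrf_eq0 eq_le sqr_ge0 andbT -h cnorm2_coord.
Qed.

Lemma resolvent_copb n (A : 'M[R]_n) (z : C) : A^T = A -> complex.Im z != 0 ->
  copb (resolvent A z) `|complex.Im z|^-1.
Proof.
move=> sA z0 u; have := sub_scalar_lower z (resolvent A z *m u) sA.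
rewrite mulmxA mulmxV ?resolvent_unit// mul1mx.
by rewrite exprVn real_normK ?num_real// ler_pdivlMl ?exprn_even_gt0.
Qed.

Lemma invmx_sub n (M N : 'M[C]_n) : M \in unitmx -> N \in unitmx ->
  invmx M - invmx N = invmx M *m (N - M) *m invmx N.
Proof.
move=> uM uN; rewrite mulmxBr mulmxBl mulVmx// mul1mx.
by rewrite -mulmxA mulmxV// mulmx1.
Qed.

Lemma resolvent_sub n (A B : 'M[R]_n) (z : C) :
  A^T = A -> B^T = B -> complex.Im z != 0 ->
  resolvent A z - resolvent B z =
  resolvent A z *m toC (B - A) *m resolvent B z.
Proof.
move=> sA sB z0.
rewrite (invmx_sub (resolvent_unit sA z0) (resolvent_unit sB z0)).
have -> : toC B - z%:M - (toC A - z%:M) = toC (B - A); last by [].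
by rewrite map_mxB opprB addrA subrK.
Qed.

Lemma resolvent_identity n (A : 'M[R]_n) (z w : C) :
  A^T = A -> complex.Im z != 0 -> complex.Im w != 0 ->
  resolvent A z - resolvent A w = (z - w) *: (resolvent A z *m resolvent A w).
Proof.
move=> sA z0 w0.
rewrite (invmx_sub (resolvent_unit sA z0) (resolvent_unit sA w0)).
have -> : toC A - w%:M - (toC A - z%:M) = (z - w)%:M.
  by rewrite opprB addrC -addrA (addrA (- toC A)) addNr add0r raddfB.
by rewrite -mulmxA mul_scalar_mx -scalemxAr.
Qed.

Lemma resolvent_tr n (A : 'M[R]_n) (z : C) : A^T = A ->
  (resolvent A z)^T = resolvent A z.
Proof.
by move=> sA; rewrite /resolvent trmx_inv linearB/= map_trmx sA tr_scalar_mx.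
Qed.

Lemma resolvent_mul n (A : 'M[R]_n) (z : C) : A^T = A -> complex.Im z != 0 ->
  toC A *m resolvent A z = 1%:M + z *: resolvent A z.
Proof.
move=> sA z0; have : (toC A - z%:M) *m resolvent A z = 1%:M.
  by rewrite mulmxV ?resolvent_unit.
by rewrite mulmxBl mul_scalar_mx => /eqP; rewrite subr_eq => /eqP.
Qed.

(* [bil G u v] is the bilinear value [u^T G v] at real vectors. *)
Definition bil n (G : 'M[C]_n) (u v : 'cV[R]_n) : C := cdot (toC u) (G *m toC v).

Lemma bil_entries n (G : 'M[C]_n) (u v : 'cV[R]_n) :
  bil G u v = \sum_(i < n) \sum_(j < n) G i j * real_complex R (u i 0 * v j 0).
Proof.
apply: eq_bigr => i _; rewrite !mxE mulr_sumr; apply: eq_bigr => j _.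
by rewrite !mxE rmorphM/= mulrCA.
Qed.

Lemma bil_le n (G : 'M[C]_n) (u v : 'cV[R]_n) (K B : R) : 0 <= K -> 0 <= B ->
  copb G K -> inner u u <= B -> inner v v <= B -> cabs (bil G u v) <= K * B.
Proof.
move=> K0 B0 hG hu hv; rewrite -[B]sqr_sqrtr// expr2 mulrCA.
apply: cdot_le; rewrite ?mulr_ge0 ?sqrtr_ge0// ?cnorm2_toC ?sqr_sqrtr//.
apply: le_trans (hG _) _; rewrite cnorm2_toC exprMn sqr_sqrtr//.
exact: ler_wpM2l (sqr_ge0 _) _ _ hv.
Qed.

Lemma bilC n (G : 'M[C]_n) (u v : 'cV[R]_n) : G^T = G -> bil G u v = bil G v u.
Proof.
move=> sG; rewrite /bil !cdotE.
transitivity (((toC u)^T *m (G *m toC v))^T 0 0); first by rewrite [RHS]mxE.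
by rewrite !trmx_mul trmxK sG mulmxA.
Qed.

Lemma cdot_rank1 n (u x y : 'cV[R]_n) (G H : 'M[C]_n) (v : 'cV[C]_n) :
  cdot (toC u) (G *m toC (x *m y^T) *m H *m v) =
  cdot (toC u) (G *m toC x) * cdot (toC y) (H *m v).
Proof.
rewrite !cdotE map_mxM/= -map_trmx !mulmxA.
rewrite -(mulmxA _ (toC y)^T H) -(mulmxA _ ((toC y)^T *m H) v).
by rewrite mxE big_ord1.
Qed.

Section RankTwo.
Variables (n : nat) (A : 'M[R]_n) (x y : 'cV[R]_n) (z : C).
Hypothesis (sA : A^T = A) (z0 : complex.Im z != 0).

Let A' := A + (x *m y^T + y *m x^T).
Let G := resolvent A z.
Let G' := resolvent A' z.

Lemma rank2_sym : A'^T = A'.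
Proof.
by rewrite /A' !linearD/= sA !trmx_mul !trmxK [y *m _ + _]addrC.
Qed.

(** The second resolvent identity G - G' = G (A' - A) G', read on one bilinear form. *)
Lemma rank2_cdot (u : 'cV[R]_n) (v : 'cV[C]_n) :
  cdot (toC u) (G *m v) = cdot (toC u) (G' *m v) +
    (bil G u x * cdot (toC y) (G' *m v) + bil G u y * cdot (toC x) (G' *m v)).
Proof.
have := resolvent_sub sA rank2_sym z0; rewrite -/G -/G'.
move=> /eqP; rewrite subr_eq => /eqP eG.
have -> : cdot (toC u) (G *m v) =
   cdot (toC u) ((G *m toC (A' - A) *m G') *m v) + cdot (toC u) (G' *m v).
  by rewrite !cdotE {1}eG mulmxDl mulmxDr mxE.
rewrite addrC; congr (_ + _).
rewrite /A' addrAC subrr add0r raddfD/= mulmxDr !mulmxDl.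
rewrite -!cdot_rank1 !cdotE mulmxDr mxE//.
Qed.

(* Solving the 2x2 system for [x^T G' v] and [y^T G' v] avoids any division. *)
Lemma rank2_solve (D : 'M[R]_n) :
  let al := bil G x x in let be := bil G y y in let ga := bil G x y in
  let GD := G *m toC D in
  (bil (G' *m toC D) y x + bil (G' *m toC D) x y) *
    ((1 + ga) ^+ 2 - al * be) =
  (1 + ga) * (bil GD y x + bil GD x y) - be * bil GD x x - al * bil GD y y.
Proof.
move=> al be ga GD.
have sG : G^T = G by exact: resolvent_tr.
have E v w : bil GD v w = bil (G' *m toC D) v w +
  (bil G v x * bil (G' *m toC D) y w + bil G v y * bil (G' *m toC D) x w).
  by rewrite /bil -!mulmxA; exact: rank2_cdot.
rewrite (E y x) (E x y) (E x x) (E y y) -/al -/be -/ga.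
rewrite (bilC y x sG) -/ga.
move: (bil _ _ _) (bil _ _ _) (bil _ _ _) (bil _ _ _) => a b c d.
by ring.
Qed.

(** The difference of the resolvents has rank two, so its trace against [Q] consists of two bilinear
    forms and carries no factor n. With [k] of order 1/n the change is negligible. *)
Lemma rank2_tr_le (Q : 'M[R]_n) k B : 0 <= k -> 0 <= B -> opb Q k ->
  inner x x <= B -> inner y y <= B ->
  cabs (\tr (G *m toC Q) - \tr (G' *m toC Q)) <=
    2 * (k * B / complex.Im z ^+ 2).
Proof.
move=> k0 B0 hQ hx hy.
have hG := resolvent_copb sA z0; have hG' := resolvent_copb rank2_sym z0.
rewrite -raddfB/= -mulmxBl resolvent_sub ?rank2_sym// -/G -/G'.
have -> : A' - A = x *m y^T + y *m x^T by rewrite /A' addrAC subrr add0r.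
have e (u v : 'cV[R]_n) : \tr (G *m toC (u *m v^T) *m G' *m toC Q) =
    bil (G' *m toC Q *m G) v u.
  rewrite map_mxM/= -map_trmx -!mulmxA mxtrace_mulC -!mulmxA mxtrace_mulC.
  rewrite /bil cdotE -!mulmxA.
  by rewrite /mxtrace big_ord1.
rewrite raddfD/= mulmxDr !mulmxDl raddfD/= !e.
apply: le_trans (cabsD _ _) _; rewrite mulr_natl mulr2n.
have hGQG : copb (G' *m toC Q *m G) (k / complex.Im z ^+ 2).
  have -> : k / complex.Im z ^+ 2 = `|complex.Im z|^-1 * k * `|complex.Im z|^-1.
    have <- : `|complex.Im z| ^+ 2 = complex.Im z ^+ 2 by rewrite real_normK ?num_real.
    by rewrite expr2 invfM mulrA (mulrC k).
  by apply: copbM => //; apply: copbM => //; exact: toC_opb.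
have ge0 : 0 <= k / complex.Im z ^+ 2 by rewrite divr_ge0// sqr_ge0.
by rewrite mulrAC; apply: lerD; apply: bil_le.
Qed.

End RankTwo.

Lemma tr_rank1 n (D : 'M[R]_n) (G : 'M[C]_n) (x y : 'cV[R]_n) :
  \tr (toC D *m (toC (x *m y^T) *m G)) = bil (G *m toC D) y x.
Proof.
rewrite map_mxM/= -map_trmx !mulmxA mxtrace_mulC !mulmxA mxtrace_mulC.
by rewrite /bil cdotE !mulmxA /mxtrace big_ord1.
Qed.

End Resolvent.

(** * Spectral theorem and the trace of the resolvent *)

Section Spectrum.
Context {R : realType}.
Local Notation C := R[i].
Local Notation toC := (map_mx (real_complex R)).

Lemma char_poly_conj n (P B : 'M[C]_n) : P \in unitmx ->
  char_poly (invmx P *m B *m P) = char_poly B.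
Proof.
move=> uP; rewrite /char_poly.
have e : char_poly_mx (invmx P *m B *m P) =
    map_mx (@polyC C) (invmx P) *m char_poly_mx B *m map_mx (@polyC C) P.
  rewrite /char_poly_mx mulmxBr mulmxBl !map_mxM/=; congr (_ - _).
  by rewrite -mulmxA mul_scalar_mx -scalemxAr -map_mxM mulVmx// map_mx1 scalemx1.
rewrite e !det_mulmx mulrAC -det_mulmx -map_mxM mulVmx// map_mx1 det1 mul1r//.
Qed.

(** The spectral theorem is applied to the Hermitian matrix [toC A], whose spectrum is then
    recognized as real. *)
Lemma sym_diagonalization n (A : 'M[R]_n) : A^T = A ->
  exists (P : 'M[C]_n) (l : 'I_n -> R), P \in unitmx /\
    toC A = invmx P *m diag_mx (\row_i real_complex R (l i)) *m P.
Proof.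
move=> sA.
have hA : toC A \is hermsymmx.
  apply: realsym_hermsym.
    by apply/is_hermitianmxP; rewrite /= expr0 scale1r map_mx_id// map_trmx sA.
  by apply/mxOverP => i j; rewrite mxE complex_real.
have /orthomx_spectralP e := hermitian_normalmx hA.
exists (spectralmx (toC A)), (fun i => complex.Re (spectral_diag (toC A) 0 i)).
split; first exact: spectral_unit.
suff <- : spectral_diag (toC A) =
  \row_i real_complex R (complex.Re (spectral_diag (toC A) 0 i)) by exact: e.
apply/matrixP => i j; rewrite ord1 mxE.
have /mxOverP/(_ 0 j) := hermitian_spectral_diag_real hA.
by move=> /complex_realP[k ->].
Qed.

Lemma char_poly_sym n (A : 'M[R]_n) (l : 'I_n -> R) (P : 'M[C]_n) :
  P \in unitmx ->
  toC A = invmx P *m diag_mx (\row_i real_complex R (l i)) *m P ->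
  char_poly A = \prod_(x <- [seq l i | i <- enum 'I_n]) ('X - x%:P).
Proof.
move=> uP eA; apply: (map_poly_inj (real_complex R)).
rewrite map_char_poly eA char_poly_conj// char_poly_trig ?diag_mx_is_trig//.
rewrite big_map big_enum/= rmorph_prod; apply: eq_bigr => i _.
by rewrite !mxE eqxx mulr1n rmorphB/= map_polyX map_polyC.
Qed.

(** Diagonalization supplies a list with the defining property, so the choice in [eigenvalues] does
    not fall back on its default. *)
Lemma eigenvaluesP n (A : 'M[R]_n) : A^T = A ->
  char_poly A = \prod_(l <- eigenvalues A) ('X - l%:P).
Proof.
move=> sA; have [P [l [uP eA]]] := sym_diagonalization sA.
rewrite /eigenvalues; case: xgetP => [s -> //|/(_ [seq l i | i <- enum 'I_n])].
by rewrite /= (char_poly_sym uP eA).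
Qed.

Lemma size_eigenvalues n (A : 'M[R]_n) : A^T = A -> size (eigenvalues A) = n.
Proof.
move=> sA; have := size_char_poly A; rewrite (eigenvaluesP sA).
by rewrite -(big_map id xpredT (fun x => 'X - x%:P)) map_id size_prod_XsubC => -[].
Qed.

Lemma tr_resolvent n (A : 'M[R]_n) (z : C) : A^T = A -> complex.Im z != 0 ->
  \tr (resolvent A z) = \sum_(l <- eigenvalues A) stieltjes_kernel z l.
Proof.
move=> sA z0; have [P [l [uP eA]]] := sym_diagonalization sA.
(* Two factorizations of the characteristic polynomial into linear factors agree up to order. *)
have pe : perm_eq (eigenvalues A) [seq l i | i <- enum 'I_n].
  by apply: prod_XsubC_eq; rewrite -eigenvaluesP// (char_poly_sym uP eA).
rewrite (perm_big _ pe) big_map big_enum/=.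
pose B := diag_mx (\row_i stieltjes_kernel z (l i)).
have lz i : real_complex R (l i) - z != 0.
  rewrite subr_eq0; apply: contraNneq z0 => <-; by rewrite eqxx.
have e : resolvent A z = invmx P *m B *m P.
  have h : (toC A - z%:M) *m (invmx P *m B *m P) = 1%:M.
    have -> : toC A - z%:M = invmx P *m diag_mx (\row_i (real_complex R (l i) - z)) *m P.
      have -> : diag_mx (\row_i (real_complex R (l i) - z)) =
                diag_mx (\row_i real_complex R (l i)) - z%:M.
        apply/matrixP => i j; rewrite !mxE; case: eqVneq => [->|_].
          by rewrite !mulr1n.
        by rewrite !mulr0n subr0.
      rewrite mulmxBr mulmxBl -eA; congr (_ - _).
      by rewrite mul_mx_scalar -scalemxAl mulVmx// scalemx1.
    rewrite -!mulmxA (mulmxA P (invmx P)) mulmxV// mul1mx (mulmxA (diag_mx _)).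
    rewrite mulmx_diag.
    have -> : diag_mx (\row_j ((\row_i (real_complex R (l i) - z)) 0 j *
                (\row_i stieltjes_kernel z (l i)) 0 j)) = 1%:M.
      apply/matrixP => i j; rewrite !mxE; case: eqVneq => [->|_]//.
      by rewrite !mulr1n /stieltjes_kernel divff.
    by rewrite mul1mx mulVmx.
  have := congr1 (mulmx (resolvent A z)) h.
  have e0 : resolvent A z *m (toC A - z%:M) = 1%:M := mulVmx (resolvent_unit sA z0).
  by rewrite mulmxA e0 mul1mx mulmx1.
rewrite e mxtrace_mulC mulmxA mulmxV// mul1mx.
by apply: eq_bigr => i _; rewrite !mxE eqxx mulr1n.
Qed.

End Spectrum.

(** * Bounded random variables and independence *)

Section BoundedRV.
Context {R : realType} {d : measure_display} {T : measurableType d}.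
Variable P : probability T R.
Implicit Types f g : T -> R.

(** Bounded everywhere and not just almost everywhere: such functions form an algebra on which the
    expectation is linear with no integrability left to check. *)
Definition bmf f := measurable_fun setT f /\ exists K, forall w, `|f w| <= K.

Definition Ex f : R := \int[P]_w f w.

Lemma bmf_cst (c : R) : bmf (fun=> c).
Proof. by split; [exact: measurable_cst|exists `|c|]. Qed.

Lemma bmfD f g : bmf f -> bmf g -> bmf (fun w => f w + g w).
Proof.
move=> [mf [K hK]] [mg [L hL]]; split; first exact: measurable_funD.
by exists (K + L) => w; exact: le_trans (ler_normD _ _) (lerD _ _).
Qed.

Lemma bmfN f : bmf f -> bmf (fun w => - f w).
Proof.
move=> [mf [K hK]]; split; last by exists K => w; rewrite normrN.
by apply: measurableT_comp.
Qed.

Lemma bmfB f g : bmf f -> bmf g -> bmf (fun w => f w - g w).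
Proof. by move=> hf hg; apply: bmfD => //; exact: bmfN. Qed.

Lemma bmfM f g : bmf f -> bmf g -> bmf (fun w => f w * g w).
Proof.
move=> [mf [K hK]] [mg [L hL]]; split; first exact: measurable_funM.
by exists (K * L) => w; rewrite normrM ler_pM.
Qed.

Lemma bmfX f n : bmf f -> bmf (fun w => f w ^+ n).
Proof.
move=> hf; elim: n => [|n IH].
  by rewrite (_ : (fun _ => _) = fun=> 1)//; exact: bmf_cst.
rewrite (_ : (fun _ => _) = fun w => f w * f w ^+ n); first exact: bmfM.
by apply/funext => w; rewrite exprS.
Qed.

Lemma bmf_sum (I : Type) (s : seq I) (Q : pred I) (F : I -> T -> R) :
  (forall i, bmf (F i)) -> bmf (fun w => \sum_(i <- s | Q i) F i w).
Proof.
move=> hF; elim: s => [|i s IH].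
  by under eq_fun do rewrite big_nil; exact: bmf_cst.
under eq_fun do rewrite big_cons; case: (Q i) => //; exact: bmfD.
Qed.

Lemma bmf_norm f : bmf f -> bmf (fun w => `|f w|).
Proof.
move=> [mf [K hK]]; split; last by exists K => w; rewrite normr_id.
exact: measurableT_comp.
Qed.

Lemma bmf_sqrt f : bmf f -> (forall w, 0 <= f w) ->
  bmf (fun w => Num.sqrt (f w)).
Proof.
move=> [mf [K hK]] f0; split.
  apply: measurableT_comp mf; apply: continuous_measurable_fun.
  exact: sqrt_continuous.
by exists (Num.sqrt K) => w; rewrite ger0_norm ?sqrtr_ge0// ler_wsqrtr// -(ger0_norm (f0 w)).
Qed.

Lemma bmf_le f (K : R) : measurable_fun setT f -> (forall w, `|f w| <= K) -> bmf f.
Proof. by move=> mf hK; split => //; exists K. Qed.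

Lemma bmf_int f : bmf f -> P.-integrable setT (EFin \o f).
Proof.
move=> [mf [K hK]]; apply: measurable_bounded_integrable => //.
  by rewrite -ge0_fin_numE ?fin_num_measure.
exists K; split; first exact: num_real.
by move=> M KM w _; apply: le_trans (hK w) (ltW KM).
Qed.

Lemma Ex_cst (c : R) : Ex (fun=> c) = c.
Proof. by rewrite /Ex Rintegral_cst// [X in fine X](probability_setT P) mulr1. Qed.

Lemma ExD f g : bmf f -> bmf g -> Ex (fun w => f w + g w) = Ex f + Ex g.
Proof. by move=> hf hg; rewrite /Ex RintegralD//; exact: bmf_int. Qed.

Lemma ExB f g : bmf f -> bmf g -> Ex (fun w => f w - g w) = Ex f - Ex g.
Proof. by move=> hf hg; rewrite /Ex RintegralB//; exact: bmf_int. Qed.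

Lemma ExZ (c : R) f : bmf f -> Ex (fun w => c * f w) = c * Ex f.
Proof. by move=> hf; rewrite /Ex RintegralZl//; exact: bmf_int. Qed.

Lemma Ex_sum (I : Type) (s : seq I) (Q : pred I) (F : I -> T -> R) :
  (forall i, bmf (F i)) ->
  Ex (fun w => \sum_(i <- s | Q i) F i w) = \sum_(i <- s | Q i) Ex (F i).
Proof.
move=> hF; elim: s => [|i s IH].
  by under eq_fun do rewrite big_nil; rewrite Ex_cst big_nil.
under eq_fun do rewrite big_cons; rewrite big_cons; case: (Q i) => //.
by rewrite ExD ?IH//; exact: bmf_sum.
Qed.

Lemma Ex_le f g : bmf f -> bmf g -> (forall w, f w <= g w) -> Ex f <= Ex g.
Proof. by move=> hf hg fg; apply: le_Rintegral => //; exact: bmf_int. Qed.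

Lemma Ex_ge0 f : (forall w, 0 <= f w) -> 0 <= Ex f.
Proof. by move=> f0; exact: Rintegral_ge0. Qed.

Lemma Ex_norm f : bmf f -> `|Ex f| <= Ex (fun w => `|f w|).
Proof. by move=> hf; apply: le_normr_Rintegral => //; exact: bmf_int. Qed.

(** Pointwise |f| <= f^2 / (2 v) + v / 2, and the mean of the right side is at most v. *)
Lemma Ex_sqr_le f (v : R) : bmf f -> 0 < v -> Ex (fun w => f w ^+ 2) <= v ^+ 2 ->
  Ex (fun w => `|f w|) <= v.
Proof.
move=> hf v0 h.
have : Ex (fun w => `|f w|) <= Ex (fun w => (2 * v)^-1 * f w ^+ 2 + v / 2).
  apply: Ex_le => [||w]; first exact: bmf_norm.
    apply: bmfD; last exact: bmf_cst.
    by apply: bmfM; [exact: bmf_cst|exact: bmfX].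
  rewrite -(ler_pM2l (_ : 0 < 2 * v)) ?mulr_gt0// mulrDr mulrA divff ?gt_eqF ?mulr_gt0//.
  rewrite mul1r -(real_normK (num_real (f w))).
  have -> : 2 * v * (v / 2) = v ^+ 2 by field.
  by have := sqr_ge0 (`|f w| - v); nra.
move=> /le_trans; apply; rewrite ExD ?Ex_cst; last 2 first.
- by apply: bmfM; [exact: bmf_cst|exact: bmfX].
- exact: bmf_cst.
rewrite ExZ; last exact: bmfX.
have -> : v = (2 * v)^-1 * v ^+ 2 + v / 2 by field; rewrite gt_eqF.
have -> : (2 * v)^-1 * v ^+ 2 + v / 2 = v by field; rewrite gt_eqF.
rewrite -lerBrDr ler_pdivrMl ?mulr_gt0//.
have -> : 2 * v * (v - v / 2) = v ^+ 2 by field.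
exact: h.
Qed.

Lemma Ex_ae f g : measurable_fun setT f -> measurable_fun setT g ->
  {ae P, forall w, f w = g w} -> Ex f = Ex g.
Proof.
move=> mf mg fg; rewrite /Ex /Rintegral; congr fine; apply: ae_eq_integral => //.
- exact/measurable_EFinP.
- exact/measurable_EFinP.
- by apply: filterS fg => w /= -> _.
Qed.

Lemma Ex_eq f g : f =1 g -> Ex f = Ex g.
Proof. by move=> /funext ->. Qed.

Definition cbmf (F : T -> R[i]) :=
  bmf (fun w => complex.Re (F w)) /\ bmf (fun w => complex.Im (F w)).

Lemma cbmf_cst c : cbmf (fun=> c).
Proof. by split; exact: bmf_cst. Qed.

Lemma cbmfD F G : cbmf F -> cbmf G -> cbmf (fun w => F w + G w).
Proof.
by move=> [f1 f2] [g1 g2]; split; [under eq_fun do rewrite cReD|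
  under eq_fun do rewrite cImD]; exact: bmfD.
Qed.

Lemma cbmfN F : cbmf F -> cbmf (fun w => - F w).
Proof.
by move=> [f1 f2]; split; [under eq_fun do rewrite cReN|
  under eq_fun do rewrite cImN]; exact: bmfN.
Qed.

Lemma cbmfB F G : cbmf F -> cbmf G -> cbmf (fun w => F w - G w).
Proof. by move=> hF hG; apply: cbmfD => //; exact: cbmfN. Qed.

Lemma cbmfM F G : cbmf F -> cbmf G -> cbmf (fun w => F w * G w).
Proof.
move=> [f1 f2] [g1 g2]; split.
  by under eq_fun do rewrite cReM; apply: bmfB; exact: bmfM.
by under eq_fun do rewrite cImM; apply: bmfD; exact: bmfM.
Qed.

Lemma bmf_cabs F : cbmf F -> bmf (fun w => cabs (F w)).
Proof.
move=> [f1 f2]; under eq_fun do rewrite cabsE.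
apply: bmf_sqrt; first by apply: bmfD; exact: bmfX.
by move=> w; rewrite addr_ge0// sqr_ge0.
Qed.

End BoundedRV.

(** * Independence of one sigma-algebra from all the others, and of the variables measurable for
    them *)

Section Independence.
Context {R : realType} {d : measure_display} {T : measurableType d}.
Variable P : probability T R.

(** Dynkin's argument: the finite intersections [G] that avoid the index [i] form a pi-system
    generating the right-hand sigma-algebra, and the sets independent of a fixed [E] form a
    lambda-system. Since every [F j] contains the full set, the sets of [G] can be indexed by all
    [j]. *)
Lemma independent_others (I : finType) (F : I -> set (set T)) :
  (forall i, F i `<=` measurable) -> (forall i, setI_closed (F i)) ->
  (forall i, F i setT) -> mutually_independent P F ->
  forall i, independent2 P (F i) <<s \bigcup_(j in [set j | j != i]) F j >>.
Proof.
move=> Fm FI FT indep i E B FE.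
pose G : set (set T) := [set B | exists (J : {set I}) (A : I -> set T),
  [/\ i \notin J, forall j, F j (A j) & B = \bigcap_(j in [set` J]) A j]].
have GI : setI_closed G.
  move=> _ _ [J [A [iJ hA ->]]] [J' [A' [iJ' hA' ->]]].
  exists (J :|: J')%SET, (fun j => (if j \in J then A j else setT) `&`
    (if j \in J' then A' j else setT)); split.
  - by rewrite finset.in_setU negb_or iJ.
  - by move=> j; apply: FI; case: ifP.
  - apply/seteqP; split => w /=.
      move=> [h h'] j /= _; split; case: ifPn => // jJ; [exact: h|exact: h'].
    move=> h; split => j /= jJ; have := h j.
      by rewrite /= finset.in_setU jJ/= => /(_ isT)[].
    by rewrite /= finset.in_setU jJ orbT/= => /(_ isT)[].
have GF : \bigcup_(j in [set j | j != i]) F j `<=` G.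
  move=> A [j /= ji FA]; exists [set j]%SET, (fun k => if k == j then A else setT).
  split.
  - by rewrite finset.in_set1 eq_sym.
  - by move=> k; case: eqP => // ->.
  - apply/seteqP; split => w /=.
      by move=> Aw k /=; rewrite finset.in_set1 => /eqP ->; rewrite eqxx.
    by move=> /(_ j); rewrite /= finset.in_set1 eqxx; exact.
have mE : measurable E by exact: Fm FE.
have Gm : G `<=` measurable.
  move=> _ [J [A [_ hA ->]]]; apply: fin_bigcap_measurable.
    exact: finite_finset.
  by move=> j _; exact: Fm.
have PEfin A : measurable A -> P A \is a fin_num by move=> mA; exact: fin_num_measure.
pose H : set (set T) := [set B | measurable B /\ P (E `&` B) = (P E * P B)%E].
suff /(_ B) : <<s G >> `<=` H.
  by move=> h sB; have [] : H B by apply: h; move: sB; apply: sub_sigma_algebra2.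
apply: lambda_system_subset => //.
apply/dynkin_lambda_system; split.
- by split => //; rewrite setIT probability_setT mule1.
- move=> A [mA hA]; split; first exact: measurableC.
  have -> : P (E `&` ~` A) = (P E - P (E `&` A))%E.
    by rewrite -setDE; apply: measureD => //; rewrite -ge0_fin_numE ?PEfin.
  by rewrite hA probability_setC// muleBr ?PEfin// ?mule1// fin_num_adde_defl// PEfin.
- move=> A tA hA.
  have mA n : measurable (A n) by have [] := hA n.
  split; first exact: bigcupT_measurable.
  have -> : P (E `&` \bigcup_k A k) = (\sum_(i <oo) P (E `&` A i))%E.
    rewrite setI_bigcupr; apply: measure_semi_bigcup.
    - by move=> n; exact: measurableI.
    - apply/trivIsetP => i0 j _ _ ij; move/trivIsetP : tA => /(_ i0 j Logic.I Logic.I ij);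
      by rewrite setIACA setIid => ->; rewrite setI0.
    - by apply: bigcupT_measurable => n; exact: measurableI.
  have -> : P (\bigcup_k A k) = (\sum_(i <oo) P (A i))%E.
    by apply: measure_semi_bigcup => //; exact: bigcupT_measurable.
  rewrite -(fineK (PEfin _ mE)) -nneseriesZl//.
  by apply: eq_eseriesr => n _; have [_ ->] := hA n; rewrite fineK// PEfin.
- move=> _ [J [A [iJ hA ->]]]; split.
    by apply: Gm; exists J, A.
  have := indep (i |: J)%SET (fun j => if j == i then E else A j) _.
  rewrite big_setU1//= eqxx => h.
  have -> : E `&` \bigcap_(j in [set` J]) A j =
      \bigcap_(j in [set` (i |: J)%SET]) (if j == i then E else A j).
    apply/seteqP; split => w /=.
      move=> [Ew h'] j /=; rewrite finset.in_setU1; case: eqVneq => //= _; exact: h'.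
    move=> h'; split; first by have := h' i; rewrite /= setU11 eqxx; exact.
    move=> j /= jJ; have := h' j; rewrite /= setU1r//; case: eqVneq => [ji|_]; last exact.
    by rewrite ji in jJ; rewrite jJ in iJ.
  rewrite h; last by move=> j _; case: eqVneq => // ->.
  congr (_ * _)%E; rewrite (indep J A)//.
  by apply: eq_bigr => j jJ; case: eqVneq => // ji; rewrite -ji jJ in iJ.
Qed.

(* The joint law of [U] and [V] is the product of their laws. *)
Lemma Ex_indep (F G : set (set T)) (U V : T -> R) : independent2 P F G ->
  (forall B, measurable B -> F (U @^-1` B)) ->
  (forall B, measurable B -> G (V @^-1` B)) ->
  bmf U -> bmf V -> Ex P (fun w => U w * V w) = Ex P U * Ex P V.
Proof.
move=> indep FU GV bU bV; have [mU [K hK]] := bU; have [mV [L hL]] := bV.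
pose U' : {mfun T >-> R} := HB.pack U (isMeasurableFun.Build _ _ _ _ U mU).
pose V' : {mfun T >-> R} := HB.pack V (isMeasurableFun.Build _ _ _ _ V mV).
have mW : measurable_fun setT (fun w => (U w, V w)).
  exact: measurable_fun_pair.
pose W : {mfun T >-> (R * R)%type} :=
  HB.pack (fun w => (U w, V w)) (isMeasurableFun.Build _ _ _ _ _ mW).
pose m1 : probability R R := distribution P U'.
pose m2 : probability R R := distribution P V'.
have prodE : forall X, measurable X -> (m1 \x m2)%E X = distribution P W X.
  apply: product_measure_unique => A B mA mB.
  by rewrite -indep; [congr (P _)|exact: FU|exact: GV].
pose f (p : R * R) : \bar R := (p.1 * p.2)%:E.
have mf : measurable_fun setT f.
  by apply/measurable_EFinP; apply: measurable_funM.
have iUV : P.-integrable setT (f \o W) by apply: bmf_int; exact: bmfM.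
have iW : (distribution P W).-integrable setT f.
  by apply: integrable_pushforward.
have iprod : (m1 \x m2)%E.-integrable setT f.
  apply/integrableP; split => //; have /integrableP[_ h] := iW.
  by rewrite (eq_measure_integral (distribution P W))// => A mA _; exact: prodE.
have intE : (\int[P]_w (U w * V w)%:E = \int[m1 \x m2]_p f p)%E.
  rewrite (eq_measure_integral (distribution P W)); last by move=> A mA _; exact: prodE.
  by rewrite (integral_distribution (X := W)).
have iV : P.-integrable setT (EFin \o V) := bmf_int P bV.
have iU : P.-integrable setT (EFin \o U) := bmf_int P bU.
have eV : (\int[m2]_y y%:E = \int[P]_w (V w)%:E)%E.
  by rewrite (integral_distribution (X := V'))//; exact/measurable_EFinP.
have eU : (\int[m1]_y y%:E = \int[P]_w (U w)%:E)%E.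
  by rewrite (integral_distribution (X := U'))//; exact/measurable_EFinP.
have im2 : m2.-integrable setT (fun y : R => y%:E).
  by apply: integrable_pushforward => //; exact/measurable_EFinP.
have im1 : m1.-integrable setT (fun y : R => y%:E).
  by apply: integrable_pushforward => //; exact/measurable_EFinP.
have fV : (\int[P]_w (V w)%:E)%E \is a fin_num by exact: integrable_fin_num.
have fU : (\int[P]_w (U w)%:E)%E \is a fin_num by exact: integrable_fin_num.
rewrite /Ex /Rintegral -fineM// intE -integral12_prod_meas1//.
congr fine; rewrite -eU -eV /fubini_F.
under eq_integral => x _.
  rewrite /f /=; under eq_integral do rewrite EFinM.
  rewrite integralZl// eV; over.
rewrite -eV -(fineK (_ : (\int[m2]_y y%:E)%E \is a fin_num)) ?eV//.
by rewrite integralZr.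
Qed.

End Independence.

(** * Measurability of complex variables and of resolvents *)

Section ComplexMeasurable.
Context {R : realType} {d : measure_display} {T : measurableType d}.

Definition cmeas (F : T -> R[i]) :=
  measurable_fun setT (fun w => complex.Re (F w)) /\
  measurable_fun setT (fun w => complex.Im (F w)).

Lemma cmeas_cst c : cmeas (fun=> c).
Proof. by split; exact: measurable_cst. Qed.

Lemma cmeasD F G : cmeas F -> cmeas G -> cmeas (fun w => F w + G w).
Proof.
by move=> [f1 f2] [g1 g2]; split; [under eq_fun do rewrite cReD|
  under eq_fun do rewrite cImD]; exact: measurable_funD.
Qed.

Lemma cmeasM F G : cmeas F -> cmeas G -> cmeas (fun w => F w * G w).
Proof.
move=> [f1 f2] [g1 g2]; split.
  by under eq_fun do rewrite cReM; apply: measurable_funB; exact: measurable_funM.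
by under eq_fun do rewrite cImM; apply: measurable_funD; exact: measurable_funM.
Qed.

Lemma cmeas_sum (I : Type) (s : seq I) (Q : pred I) (F : I -> T -> R[i]) :
  (forall i, cmeas (F i)) -> cmeas (fun w => \sum_(i <- s | Q i) F i w).
Proof.
move=> hF; elim: s => [|i s IH].
  by under eq_fun do rewrite big_nil; exact: cmeas_cst.
by under eq_fun do rewrite big_cons; case: (Q i) => //; exact: cmeasD.
Qed.

Lemma cmeas_prod (I : Type) (s : seq I) (Q : pred I) (F : I -> T -> R[i]) :
  (forall i, cmeas (F i)) -> cmeas (fun w => \prod_(i <- s | Q i) F i w).
Proof.
move=> hF; elim: s => [|i s IH].
  by under eq_fun do rewrite big_nil; exact: cmeas_cst.
by under eq_fun do rewrite big_cons; case: (Q i) => //; exact: cmeasM.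
Qed.

(** For positive f, 1 / f = exp (- ln f), a composition of measurable functions. *)
Lemma measurable_inv (f : T -> R) : measurable_fun setT f -> (forall w, 0 < f w) ->
  measurable_fun setT (fun w => (f w)^-1).
Proof.
move=> mf f0; rewrite (_ : (fun w => _) = fun w => expR (- ln (f w))).
  apply: measurableT_comp => //; apply: measurable_funN.
  by apply: measurableT_comp.
by apply/funext => w; rewrite expRN lnK// posrE.
Qed.

Lemma cmeasV F : cmeas F -> (forall w, F w != 0) -> cmeas (fun w => (F w)^-1).
Proof.
move=> [f1 f2] F0.
have m2 : measurable_fun setT
    (fun w => (complex.Re (F w) ^+ 2 + complex.Im (F w) ^+ 2)^-1).
  apply: measurable_inv.
    by apply: measurable_funD; exact: measurable_funX.
  by move=> w; rewrite -cabs_sqr exprn_gt0// cabs_gt0.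
split.
  rewrite (_ : (fun w => _) = fun w => complex.Re (F w) *
    (complex.Re (F w) ^+ 2 + complex.Im (F w) ^+ 2)^-1); first exact: measurable_funM.
  by apply/funext => w; case: (F w).
rewrite (_ : (fun w => _) = fun w => - complex.Im (F w) *
  (complex.Re (F w) ^+ 2 + complex.Im (F w) ^+ 2)^-1).
  by apply: measurable_funM => //; exact: measurable_funN.
by apply/funext => w; case: (F w) => a b /=; rewrite mulNr.
Qed.

Lemma cmeas_det n (M : T -> 'M[R[i]]_n) : (forall i j, cmeas (fun w => M w i j)) ->
  cmeas (fun w => \det (M w)).
Proof.
move=> hM; rewrite /determinant; apply: cmeas_sum => s.
by apply: cmeasM; [exact: cmeas_cst|apply: cmeas_prod => i].
Qed.

(** By Cramer's rule the entries of the inverse are quotients of polynomials in the entries of the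
    matrix. *)
Lemma cmeas_invmx n (M : T -> 'M[R[i]]_n) : (forall i j, cmeas (fun w => M w i j)) ->
  (forall w, M w \in unitmx) -> forall i j, cmeas (fun w => invmx (M w) i j).
Proof.
move=> hM uM i j.
have -> : (fun w => invmx (M w) i j) = fun w => (\det (M w))^-1 * cofactor (M w) j i.
  by apply/funext => w; rewrite /invmx uM !mxE.
apply: cmeasM.
  apply: cmeasV; first exact: cmeas_det.
  by move=> w; have := uM w; rewrite unitmxE unitfE.
apply: cmeasM; first exact: cmeas_cst.
by apply: cmeas_det => k l; under eq_fun do rewrite !mxE; exact: hM.
Qed.

Lemma cmeas_resolvent n (A : T -> 'M[R]_n) (z : R[i]) :
  (forall w, (A w)^T = A w) -> complex.Im z != 0 ->
  (forall i j, measurable_fun setT (fun w => A w i j)) ->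
  forall i j, cmeas (fun w => resolvent (A w) z i j).
Proof.
move=> sA z0 mA; apply: cmeas_invmx => [i j|w]; last exact: resolvent_unit.
under eq_fun do rewrite !mxE; apply: cmeasD; last exact: cmeas_cst.
by split => //=; exact: measurable_cst.
Qed.

Lemma cbmf_cmeas (F : T -> R[i]) (K : R) : cmeas F ->
  (forall w, cabs (F w) <= K) -> cbmf F.
Proof.
move=> [f1 f2] hK; split; apply: (bmf_le (K := K)) => // w.
  exact: le_trans (Re_le_cabs _) (hK w).
exact: le_trans (Im_le_cabs _) (hK w).
Qed.

End ComplexMeasurable.

(** Measurability relative to the sigma-algebra generated by [G] instead of the ambient one;
    products of expectations are split on this basis. *)
Notation gmeas G f := (measurable_fun (setT : set (g_sigma_algebraType G)) f).

(** * Bilinear forms of a random matrix in vectors independent of it *)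

Section QuadraticForm.
Context {R : realType} {d : measure_display} {T : measurableType d}.
Variable P : probability T R.

Lemma Ex_gindep (F G : set (set T)) (U V : T -> R) :
  independent2 P <<s F>> <<s G>> -> gmeas F U -> gmeas G V ->
  bmf U -> bmf V -> Ex P (fun w => U w * V w) = Ex P U * Ex P V.
Proof.
move=> indep mU mV; apply: (Ex_indep indep) => B mB.
  by have := mU measurableT B mB; rewrite setTI.
by have := mV measurableT B mB; rewrite setTI.
Qed.

Lemma inner_entries n (D : 'M[R]_n) (u v : 'cV[R]_n) :
  inner (D *m u) v = \sum_(s : 'I_n * 'I_n) D s.1 s.2 * (v s.1 0 * u s.2 0).
Proof.
rewrite -(pair_bigA _ (fun i j => D i j * (v i 0 * u j 0)))/=.
apply: eq_bigr => i _; rewrite mxE mulr_suml; apply: eq_bigr => j _.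
by rewrite -mulrA (mulrC (u j 0)).
Qed.

(* [u] and [v] are averaged first, at a frozen value of the independent [W]. *)
Lemma quad_form_var (F G : set (set T)) n (W : T -> 'M[R]_n)
    (u v : T -> 'cV[R]_n) (K V : R) :
  independent2 P <<s F>> <<s G>> ->
  (forall i, gmeas F (fun w => u w i 0)) -> (forall i, gmeas F (fun w => v w i 0)) ->
  (forall i j, gmeas G (fun w => W w i j)) ->
  (forall i, bmf (fun w => u w i 0)) -> (forall i, bmf (fun w => v w i 0)) ->
  (forall i j, bmf (fun w => W w i j)) ->
  (forall D, opb D 1 -> Ex P (fun w => (inner (D *m u w) (v w) -
     Ex P (fun w => inner (D *m u w) (v w))) ^+ 2) <= V) ->
  0 < K -> (forall w, opb (W w) K) ->
  Ex P (fun w => (inner (W w *m u w) (v w) -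
     \sum_(s : 'I_n * 'I_n) W w s.1 s.2 * Ex P (fun w => v w s.1 0 * u w s.2 0)) ^+ 2)
  <= K ^+ 2 * V.
Proof.
move=> indep gu gv gW bu bv bW hV K0 hW.
pose q (s : 'I_n * 'I_n) := Ex P (fun w => v w s.1 0 * u w s.2 0).
pose X (s : 'I_n * 'I_n) w := v w s.1 0 * u w s.2 0 - q s.
have bvu (s : 'I_n * 'I_n) : bmf (fun w => v w s.1 0 * u w s.2 0) by exact: bmfM.
have bX s : bmf (X s) by apply: bmfB; [exact: bvu|exact: bmf_cst].
have gX s : gmeas F (X s).
  by apply: measurable_funB; [exact: measurable_funM|exact: measurable_cst].
pose C s t := Ex P (fun w => X s w * X t w).
have sqr_sum (a b : 'I_n * 'I_n -> R) :
    (\sum_s a s * b s) ^+ 2 = \sum_s \sum_t (a s * a t) * (b s * b t).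
  rewrite expr2 mulr_suml; apply: eq_bigr => s _; rewrite mulr_sumr.
  by apply: eq_bigr => t _; ring.
(* The quadratic form with the covariances [C] as coefficients is bounded at each fixed matrix. The
   bound is the same for all of them, so it survives the substitution of the random [W w]. *)
have quadD (D : 'M[R]_n) : opb D K ->
    \sum_s \sum_t (D s.1 s.2 * D t.1 t.2) * C s t <= K ^+ 2 * V.
  move=> hD; have hD1 : opb (K^-1 *: D) 1.
    by have := opbZ K^-1 hD; rewrite mulVf// gt_eqF.
  have := hV _ hD1; rewrite -(ler_pM2l (exprn_gt0 2 K0)); apply: le_trans.
  rewrite -ExZ; last first.
    apply: bmfX; apply: bmfB; last exact: bmf_cst.
    under eq_fun do rewrite inner_entries; apply: bmf_sum => s.
    by apply: bmfM; [exact: bmf_cst|exact: bvu].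
  have eE : Ex P (fun w => inner (K^-1 *: D *m u w) (v w)) =
     \sum_s (K^-1 *: D) s.1 s.2 * q s.
    under eq_fun do rewrite inner_entries.
    rewrite Ex_sum => [|s]; last by apply: bmfM; [exact: bmf_cst|exact: bvu].
    by apply: eq_bigr => s _; rewrite ExZ.
  rewrite eE.
  have -> : (fun w => K ^+ 2 * (inner (K^-1 *: D *m u w) (v w) -
      \sum_s (K^-1 *: D) s.1 s.2 * q s) ^+ 2) =
     fun w => \sum_s \sum_t (D s.1 s.2 * D t.1 t.2) * (X s w * X t w).
    apply/funext => w; rewrite -sqr_sum -exprMn inner_entries -sumrB; congr (_ ^+ 2).
    rewrite mulr_sumr; apply: eq_bigr => s _; rewrite mxE /X.
    by field; rewrite gt_eqF.
  rewrite Ex_sum => [|s]; last first.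
    by apply: bmf_sum => t; apply: bmfM; [exact: bmf_cst|exact: bmfM].
  apply: ler_sum => s _; rewrite Ex_sum => [|t]; last first.
    by apply: bmfM; [exact: bmf_cst|exact: bmfM].
  by apply: ler_sum => t _; rewrite ExZ//; exact: bmfM.
have -> : (fun w => (inner (W w *m u w) (v w) - \sum_s W w s.1 s.2 * Ex P (fun w => v w s.1 0 * u w s.2 0)) ^+ 2)
   = fun w => \sum_s \sum_t (X s w * X t w) * (W w s.1 s.2 * W w t.1 t.2).
  apply/funext => w; rewrite inner_entries -sumrB.
  rewrite -(sqr_sum (fun s => X s w) (fun s => W w s.1 s.2)); congr (_ ^+ 2).
  by apply: eq_bigr => s _; rewrite /X -mulrBr mulrC.
have bWW s t : bmf (fun w => W w s.1 s.2 * W w t.1 t.2) by exact: bmfM.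
(* Independence separates the products of the [X s] from those of the entries of [W] and replaces
   the former by their means [C s t]. *)
have -> : Ex P (fun w => \sum_s \sum_t (X s w * X t w) * (W w s.1 s.2 * W w t.1 t.2))
   = Ex P (fun w => \sum_s \sum_t (W w s.1 s.2 * W w t.1 t.2) * C s t).
  rewrite !Ex_sum => [|s|s]; last 2 first.
  - by apply: bmf_sum => t; apply: bmfM => //; exact: bmf_cst.
  - by apply: bmf_sum => t; apply: bmfM => //; exact: bmfM.
  apply: eq_bigr => s _; rewrite !Ex_sum => [|t|t]; last 2 first.
  - by apply: bmfM => //; exact: bmf_cst.
  - by apply: bmfM => //; exact: bmfM.
  apply: eq_bigr => t _.
  rewrite (Ex_gindep indep)//; [|exact: measurable_funM|exact: measurable_funM|exact: bmfM].
  under [RHS]Ex_eq do rewrite mulrC.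
  by rewrite ExZ.
rewrite -[leRHS](Ex_cst P); apply: Ex_le => [||w]; [|exact: bmf_cst|exact: quadD].
by apply: bmf_sum => s; apply: bmf_sum => t; apply: bmfM => //; exact: bmf_cst.
Qed.

End QuadraticForm.

Section BilinearMeasurable.
Context {R : realType} {d : measure_display} {T : measurableType d}.
Local Notation toC := (map_mx (real_complex R)).

Lemma cmeas_mulmx n (G : T -> 'M[R[i]]_n) (D : 'M[R[i]]_n) :
  (forall i j, cmeas (fun w => G w i j)) ->
  forall i j, cmeas (fun w => (G w *m D) i j).
Proof.
move=> hG i j; under eq_fun do rewrite mxE; apply: cmeas_sum => k.
by apply: cmeasM => //; exact: cmeas_cst.
Qed.

Lemma cmeas_bil n (G : T -> 'M[R[i]]_n) (u v : T -> 'cV[R]_n) :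
  (forall i j, cmeas (fun w => G w i j)) ->
  (forall i, measurable_fun setT (fun w => u w i 0)) ->
  (forall i, measurable_fun setT (fun w => v w i 0)) ->
  cmeas (fun w => bil (G w) (u w) (v w)).
Proof.
move=> hG hu hv; under eq_fun do rewrite bil_entries.
apply: cmeas_sum => i; apply: cmeas_sum => j; apply: cmeasM => //.
by split => /=; [exact: measurable_funM|exact: measurable_cst].
Qed.

Lemma cmeas_tr n (G : T -> 'M[R[i]]_n) : (forall i j, cmeas (fun w => G w i j)) ->
  cmeas (fun w => \tr (G w)).
Proof. by move=> hG; apply: cmeas_sum. Qed.

Lemma measurable_cabs (F : T -> R[i]) : cmeas F ->
  measurable_fun setT (fun w => cabs (F w)).
Proof.
move=> [f1 f2]; under eq_fun do rewrite cabsE.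
apply: (@measurableT_comp _ _ _ _ _ _ (@Num.sqrt R)).
  by apply: continuous_measurable_fun; exact: sqrt_continuous.
by apply: measurable_funD; exact: measurable_funX.
Qed.

End BilinearMeasurable.

Section RealBilinear.
Context {R : realType}.
Local Notation toC := (map_mx (real_complex R)).

Lemma Re_bil n (G : 'M[R[i]]_n) (u v : 'cV[R]_n) :
  complex.Re (bil G v u) = inner (map_mx (@complex.Re R) G *m u) v.
Proof.
rewrite bil_entries cRe_sum; apply: eq_bigr => i _; rewrite cRe_sum mxE mulr_suml.
by apply: eq_bigr => j _; rewrite mxE cReM /= mulr0 subr0; ring.
Qed.

Lemma Im_bil n (G : 'M[R[i]]_n) (u v : 'cV[R]_n) :
  complex.Im (bil G v u) = inner (map_mx (@complex.Im R) G *m u) v.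
Proof.
rewrite bil_entries cIm_sum; apply: eq_bigr => i _; rewrite cIm_sum mxE mulr_suml.
by apply: eq_bigr => j _; rewrite mxE cImM /= mulr0 add0r; ring.
Qed.

(** For v = D^T u, |v|^4 = (D v, u)^2 <= K^2 |v|^2 |u|^2; then divide by |v|^2. *)
Lemma opb_tr_mx n (D : 'M[R]_n) (K : R) : 0 <= K -> opb D K -> opb D^T K.
Proof.
move=> K0 hD u; set v := D^T *m u.
have e : inner v v = inner (D *m v) u by rewrite inner_mulmx.
have cs : inner (D *m v) u ^+ 2 <= inner (D *m v) (D *m v) * inner u u.
  exact: cauchy_schwarz (fun i => (D *m v) i 0) (fun i => u i 0).
have hv := hD v; have v0 := inner_ge0 v; have u0 := inner_ge0 u.
have h : inner v v ^+ 2 <= inner v v * (K ^+ 2 * inner u u).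
  rewrite {1}e; apply: le_trans cs _; rewrite mulrCA mulrA.
  exact: ler_wpM2r.
have [v00|vn0] := eqVneq (inner v v) 0.
  by rewrite v00 mulr_ge0 ?sqr_ge0.
by move: h; rewrite expr2 ler_pM2l// lt_def vn0.
Qed.

End RealBilinear.

(** * The loop equation *)

(** The expression is the error bound for one summand of the loop equation. The diagonal errors [a],
    [b], [mu], [nu] are small for each summand, while the mixed ones, [g] and [k], are small only
    after summation; hence they are kept here and treated in [sum_lin_bound]. *)
Lemma lin_bound (R : realType) (B F1 a b mu nu g k s : R) : 0 <= B -> 0 <= F1 ->
  a <= s -> b <= s -> mu <= s -> nu <= s ->
  2 * B * (B * b + F1 * a + (2 + B) * g) + (1 + B) * k + (B * b + F1 * mu) +
    (B * a + F1 * nu) <=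
  2 * B * (B * s + F1 * s + (2 + B) * g) + (1 + B) * k + (B * s + F1 * s) +
    (B * s + F1 * s).
Proof.
move=> B0 F0 ha hb hm hn; have B2 : 0 <= 2 * B by rewrite mulr_ge0.
apply: lerD; last by apply: lerD; apply: ler_wpM2l.
apply: lerD; last by apply: lerD; apply: ler_wpM2l.
rewrite lerD2r; apply: ler_wpM2l => //; rewrite lerD2r.
by apply: lerD; apply: ler_wpM2l.
Qed.

Lemma Ex_lin_bound (R : realType) (d : measure_display) (T : measurableType d)
    (P : probability T R) (B F1 : R) (X1 X2 X3 X4 X5 X6 X7 X : T -> R) :
  bmf X1 -> bmf X2 -> bmf X3 -> bmf X4 -> bmf X5 -> bmf X6 -> bmf X7 -> bmf X ->
  (forall w, X w <= 2 * B * (B * X1 w + F1 * X2 w + (2 + B) * X3 w) +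
     (1 + B) * (X4 w + X5 w) + (B * X1 w + F1 * X6 w) + (B * X2 w + F1 * X7 w)) ->
  Ex P X <= 2 * B * (B * Ex P X1 + F1 * Ex P X2 + (2 + B) * Ex P X3) +
     (1 + B) * (Ex P X4 + Ex P X5) + (B * Ex P X1 + F1 * Ex P X6) +
     (B * Ex P X2 + F1 * Ex P X7).
Proof.
move=> b1 b2 b3 b4 b5 b6 b7 bX hX.
have bZ (c : R) (Y : T -> R) : bmf Y -> bmf (fun w => c * Y w).
  by move=> bY; apply: bmfM => //; exact: bmf_cst.
have bL (c1 c2 : R) (Y1 Y2 : T -> R) : bmf Y1 -> bmf Y2 ->
    bmf (fun w => c1 * Y1 w + c2 * Y2 w).
  by move=> h1 h2; apply: bmfD; exact: bZ.
have EL (c1 c2 : R) (Y1 Y2 : T -> R) : bmf Y1 -> bmf Y2 ->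
    Ex P (fun w => c1 * Y1 w + c2 * Y2 w) = c1 * Ex P Y1 + c2 * Ex P Y2.
  by move=> h1 h2; rewrite ExD ?ExZ//; exact: bZ.
pose Y1 w := B * X1 w + F1 * X2 w; pose Y2 w := B * X1 w + F1 * X6 w.
pose Y3 w := B * X2 w + F1 * X7 w; pose Y4 w := 1 * X4 w + 1 * X5 w.
pose Z1 w := 1 * Y1 w + (2 + B) * X3 w; pose Z2 w := 2 * B * Z1 w + (1 + B) * Y4 w.
pose Z3 w := 1 * Z2 w + 1 * Y2 w.
have := @Ex_le _ _ _ P X (fun w => 1 * Z3 w + 1 * Y3 w) bX.
have y1 : bmf Y1 by exact: bL. have y2 : bmf Y2 by exact: bL.
have y3 : bmf Y3 by exact: bL. have y4 : bmf Y4 by exact: bL.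
have z1 : bmf Z1 by exact: bL. have z2 : bmf Z2 by exact: bL.
have z3 : bmf Z3 by exact: bL.
rewrite !EL// !mul1r; apply; first exact: bL.
by move=> w; apply: le_trans (hX w) _; rewrite /Z3 /Z2 /Z1 /Y4 /Y1 /Y2 /Y3 !mul1r.
Qed.

Lemma sum_lin_bound (R : realType) (m : nat) (B F1 s u : R) (g k1 k2 : 'I_m -> R) :
  0 <= B -> \sum_(a < m) g a <= m%:R * u ->
  \sum_(a < m) k1 a <= m%:R * u -> \sum_(a < m) k2 a <= m%:R * u ->
  \sum_(a < m) (2 * B * (B * s + F1 * s + (2 + B) * g a) + (1 + B) * (k1 a + k2 a) +
    (B * s + F1 * s) + (B * s + F1 * s)) <=
  m%:R * (2 * B * (B * s + F1 * s + (2 + B) * u) + (1 + B) * (u + u) +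
    (B * s + F1 * s) + (B * s + F1 * s)).
Proof.
move=> B0 hg h1 h2; set c := B * s + F1 * s.
have mc (c' : R) : m%:R * c' = \sum_(a < m) c' by rewrite sumr_const card_ord mulr_natl.
have -> : \sum_(a < m) (2 * B * (c + (2 + B) * g a) + (1 + B) * (k1 a + k2 a) + c + c) =
  m%:R * (2 * B * c + c + c) +
  2 * B * (2 + B) * \sum_(a < m) g a + (1 + B) * (\sum_(a < m) k1 a + \sum_(a < m) k2 a).
  rewrite mc -[X in _ + (1 + B) * X]big_split/= !mulr_sumr -!big_split/=.
  by apply: eq_bigr => a _; ring.
have -> : m%:R * (2 * B * (c + (2 + B) * u) + (1 + B) * (u + u) + c + c) =
   m%:R * (2 * B * c + c + c) +
   2 * B * (2 + B) * (m%:R * u) + (1 + B) * (m%:R * u + m%:R * u) by ring.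
apply: lerD; first rewrite lerD2l.
  by apply: ler_wpM2l => //; rewrite !mulr_ge0// addr_ge0.
by apply: ler_wpM2l; [rewrite addr_ge0|exact: lerD].
Qed.

Section LoopEquation.
Context {R : realType} {d : measure_display} {T : measurableType d}.
Variable P : probability T R.
Local Notation toC := (map_mx (real_complex R)).
Variables (n m : nat) (xi : 'I_m -> T -> bool) (x y : 'I_m -> T -> 'cV[R]_n).

(* [arm true] is the family of the x's and [arm false] that of the y's. *)
Definition arm (s : bool) (a : 'I_m) (w : T) : 'cV[R]_n := if s then x a w else y a w.

Definition second_moment (s t : bool) (a : 'I_m) : 'M[R]_n :=
  \matrix_(i, j) Ex P (fun w => arm s a w i 0 * arm t a w j 0).

(** One sigma-algebra for each Bernoulli variable and one for each pair, so that the two vectors of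
    a pair may depend on each other. *)
Definition coord_system (i : 'I_m + 'I_m) : set (set T) :=
  match i with
  | inl a => sigma_of (fun _ : unit => xi a)
  | inr a => sigma_of (pair_coord (x a) (y a))
  end.

Definition other_systems (i : 'I_m + 'I_m) : set (set T) :=
  \bigcup_(j in [set j | j != i]) coord_system j.

Definition sum_mx (w : T) : 'M[R]_n :=
  \sum_(a < m) (xi a w)%:R *: (x a w *m (y a w)^T + y a w *m (x a w)^T).

Definition sum_mx_but (a : 'I_m) (w : T) : 'M[R]_n :=
  \sum_(b < m | b != a) (xi b w)%:R *: (x b w *m (y b w)^T + y b w *m (x b w)^T).

(** The sum with the a-th Bernoulli variable forced to 1: it does not involve [xi a], yet agrees
    with [sum_mx] wherever [xi a] is true. *)
Definition sum_mx_with (a : 'I_m) (w : T) : 'M[R]_n :=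
  sum_mx_but a w + (x a w *m (y a w)^T + y a w *m (x a w)^T).

Definition tr_dev (z f : R[i]) (D : 'M[R]_n) (w : T) : R[i] :=
  n%:R^-1 * \tr (resolvent (sum_mx w) z *m toC D) -
  f * real_complex R (n%:R^-1 * \tr D).

(** The assumptions at one fixed n: a single number [e] measures all vanishing errors, and [C0],
    [k], [c] are the constants. The link 1/n <= e^2 between [e] and n absorbs both the rank-two
    perturbations and the fluctuations of the Bernoulli variables. *)
Record loop_hyps (C0 k c e p : R) : Prop := LoopHyps {
  loop_n : (0 < n)%N;
  loop_m : (0 < m)%N;
  loop_e : 0 < e <= 1;
  loop_ne : n%:R^-1 <= e ^+ 2;
  loop_c : 0 <= c;
  loop_k : 1 <= k;
  loop_C0 : 0 <= C0;
  loop_xi : forall a, measurable_fun setT (xi a);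
  loop_meas : forall s a, random_vector (arm s a);
  loop_bound : forall s a w, inner (arm s a w) (arm s a w) <= C0;
  loop_indep : mutually_independent P coord_system;
  loop_law : forall a, P [set w | xi a w = true] = p%:E;
  loop_var : forall D, opb D 1 -> forall s t a,
    Ex P (fun w => (inner (D *m arm s a w) (arm t a w) -
      Ex P (fun w => inner (D *m arm s a w) (arm t a w))) ^+ 2) <= e ^+ 2;
  loop_opb : forall s t a, opb (second_moment s t a) (k / n%:R);
  loop_tr : forall s a, `|\tr (second_moment s s a) - 1| <= e;
  loop_avg : forall K1 K2 : 'M[R]_n,
    m%:R^-1 * (\sum_(a < m) \tr (second_moment true true a *m K1) *
      \tr (second_moment false false a *m K2)) =
    (n%:R^-1 * \tr K1) * (n%:R^-1 * \tr K2);
  loop_cross : \sum_(s : 'I_n * 'I_n)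
    (m%:R^-1 * \sum_(a < m) `|second_moment true false a s.1 s.2|) ^+ 2 <=
    e ^+ 2 / n%:R;
  loop_mp : `|m%:R / n%:R * p - c| <= e }.

Section Proofs.
Variables (C0 k c e p : R).
Hypothesis hyps : loop_hyps C0 k c e p.
Variable z : R[i].
Hypothesis z0 : 0 < complex.Im z.

Let eta := complex.Im z.
Let zn0 : complex.Im z != 0. Proof. by rewrite gt_eqF. Qed.
Let normz : `|complex.Im z| = eta. Proof. by rewrite gtr0_norm. Qed.
Let n0 : 0 < n%:R :> R. Proof. by rewrite ltr0n; exact: (loop_n hyps). Qed.
Let m0 : 0 < m%:R :> R. Proof. by rewrite ltr0n; exact: (loop_m hyps). Qed.
Let e0 : 0 < e. Proof. by have /andP[] := loop_e hyps. Qed.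
Let e1 : e <= 1. Proof. by have /andP[] := loop_e hyps. Qed.
Let k0 : 0 < k. Proof. by have := loop_k hyps; lra. Qed.

Lemma rank2_symmetric (u v : 'cV[R]_n) : (u *m v^T + v *m u^T)^T = u *m v^T + v *m u^T.
Proof. by rewrite linearD/= !trmx_mul !trmxK addrC. Qed.

Lemma sum_mx_sym w : (sum_mx w)^T = sum_mx w.
Proof.
rewrite /sum_mx linear_sum/=; apply: eq_bigr => a _.
by rewrite linearZ/= rank2_symmetric.
Qed.

Lemma sum_mx_but_sym a w : (sum_mx_but a w)^T = sum_mx_but a w.
Proof.
rewrite /sum_mx_but linear_sum/=; apply: eq_bigr => b _.
by rewrite linearZ/= rank2_symmetric.
Qed.

Lemma sum_mx_with_sym a w : (sum_mx_with a w)^T = sum_mx_with a w.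
Proof. exact: rank2_sym (sum_mx_but_sym a w). Qed.

Lemma sum_mxE a w : sum_mx w = if xi a w then sum_mx_with a w else sum_mx_but a w.
Proof.
rewrite /sum_mx (bigD1 a)//= -/(sum_mx_but a w) addrC.
by case: (xi a w); rewrite ?scale1r// scale0r addr0.
Qed.

Lemma copb_res (A : 'M[R]_n) : A^T = A -> copb (resolvent A z) eta^-1.
Proof. by move=> sA; rewrite -normz; exact: resolvent_copb. Qed.

Lemma copb_resD (A D : 'M[R]_n) : A^T = A -> opb D 1 ->
  copb (resolvent A z *m toC D) eta^-1.
Proof.
by move=> sA hD; rewrite -[eta^-1]mulr1; apply: copbM (copb_res sA) (toC_opb hD).
Qed.

Lemma coord_sub i : coord_system i `<=` measurable.
Proof.
case: i => a; apply: smallest_sub; try exact: sigma_algebra_measurable.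
  by move=> _ [_ _ [B mB <-]]; exact: (loop_xi hyps).
move=> _ [[j|j] _ [B mB <-]]; first exact: (loop_meas hyps true).
exact: (loop_meas hyps false).
Qed.

Lemma coord_indep i : independent2 P (coord_system i) <<s other_systems i>>.
Proof.
apply: independent_others; [exact: coord_sub| | |exact: (loop_indep hyps)].
  case=> a A B; rewrite /=.
    exact: (@measurableI _ (g_sigma_algebraType _)).
  exact: (@measurableI _ (g_sigma_algebraType _)).
case=> a; exact: (@measurableT _ (g_sigma_algebraType _)).
Qed.

(** The generators behind [coord_system], exposed because [gmeas] and [Ex_gindep] are stated in
    terms of generators. *)
Definition gens (i : 'I_m + 'I_m) : set (set T) :=
  match i with
  | inl a => \bigcup_(u in [set: unit]) preimage_set_system setT (xi a) measurable
  | inr a => \bigcup_(j in [set: 'I_n + 'I_n])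
               preimage_set_system setT (pair_coord (x a) (y a) j) measurable
  end.

Lemma coord_gens i : coord_system i = <<s gens i>>.
Proof. by case: i. Qed.

Lemma gens_arm s a j : gmeas (gens (inr a)) (fun w => arm s a w j 0).
Proof.
move=> _ B mB; apply: sub_sigma_algebra; rewrite /gens.
by case: s => /=; [exists (inl j)|exists (inr j)] => //; exists B.
Qed.

Lemma gens_xi a : gmeas (gens (inl a)) (fun w => (xi a w)%:R : R).
Proof.
move=> _ B mB; apply: sub_sigma_algebra; exists tt => //=.
by exists ((fun b : bool => b%:R : R) @^-1` B).
Qed.

Lemma gmeas_other i j (f : T -> R) : j != i -> gmeas (gens j) f ->
  gmeas (other_systems i) f.
Proof.
move=> ji mf mT B mB; apply: sub_sigma_algebra; exists j => //.
by rewrite coord_gens; exact: mf.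
Qed.

Lemma gmeas_meas i (f : T -> R) : gmeas (other_systems i) f -> measurable_fun setT f.
Proof.
move=> mf _ B mB; have := mf measurableT B mB.
apply: smallest_sub; first exact: sigma_algebra_measurable.
by move=> A [j _]; exact: coord_sub.
Qed.

Lemma gmeas_rank1 (G : set (set T)) (u v : T -> 'cV[R]_n) :
  (forall i, gmeas G (fun w => u w i 0)) -> (forall i, gmeas G (fun w => v w i 0)) ->
  forall i j, gmeas G (fun w => (u w *m (v w)^T) i j).
Proof.
move=> hu hv i j; under eq_fun do rewrite mxE big_ord1 mxE.
exact: measurable_funM.
Qed.

Lemma gmeas_rank2 (G : set (set T)) a :
  (forall s i, gmeas G (fun w => arm s a w i 0)) ->
  forall i j, gmeas G (fun w => (x a w *m (y a w)^T + y a w *m (x a w)^T) i j).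
Proof.
move=> h i j; under eq_fun do rewrite mxE.
by apply: measurable_funD; apply: gmeas_rank1 => l; [exact: (h true)|
  exact: (h false)|exact: (h false)|exact: (h true)].
Qed.

Lemma gmeas_sum_but (G : set (set T)) a :
  (forall b, b != a -> gmeas G (fun w => (xi b w)%:R : R)) ->
  (forall b, b != a -> forall s i, gmeas G (fun w => arm s b w i 0)) ->
  forall i j, gmeas G (fun w => sum_mx_but a w i j).
Proof.
move=> hxi harm i j; rewrite (_ : (fun w => _) = fun w => \sum_(b < m)
    (if b != a then (xi b w)%:R * (x b w *m (y b w)^T + y b w *m (x b w)^T) i j else 0)).
  apply: measurable_sum => b; case: (boolP (b != a)) => [ba|_]; last exact: measurable_cst.
  apply: measurable_funM; first exact: hxi.
  by apply: gmeas_rank2; exact: harm.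
apply/funext => w; rewrite /sum_mx_but summxE big_mkcond; apply: eq_bigr => b _.
by case: ifP => // _; rewrite mxE.
Qed.

(** The first of two decouplings: without its a-th summand the matrix does not see the a-th pair. In
    [gmeas_with_inl] the summand is forced and the matrix does not see [xi a]. *)
Lemma gmeas_but_inr a i j : gmeas (other_systems (inr a)) (fun w => sum_mx_but a w i j).
Proof.
apply: gmeas_sum_but => b ba.
  by apply: (@gmeas_other _ (inl b)) => //; exact: gens_xi.
by move=> s l; apply: (@gmeas_other _ (inr b)) => //; exact: gens_arm.
Qed.

Lemma gmeas_with_inl a i j : gmeas (other_systems (inl a)) (fun w => sum_mx_with a w i j).
Proof.
under eq_fun do rewrite /sum_mx_with mxE.
apply: measurable_funD.
  apply: gmeas_sum_but => b ba; first by apply: (@gmeas_other _ (inl b)) => //; exact: gens_xi.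
  by move=> s l; apply: (@gmeas_other _ (inr b)) => //; exact: gens_arm.
by apply: gmeas_rank2 => s l; apply: (@gmeas_other _ (inr a)) => //; exact: gens_arm.
Qed.


Lemma arm_bmf s a i : bmf (fun w => arm s a w i 0).
Proof.
apply: (bmf_le (K := Num.sqrt C0)); first exact: (loop_meas hyps s a i).
move=> w; rewrite -sqrtr_sqr ler_wsqrtr//; apply: le_trans (loop_bound hyps s a w).
by rewrite /inner (bigD1 i)//= -expr2 lerDl sumr_ge0// => j _; rewrite -expr2 sqr_ge0.
Qed.

Let B := C0 / eta.
Let eta0 : 0 < eta := z0.
Let B0 : 0 <= B. Proof. by rewrite divr_ge0 ?(loop_C0 hyps)// ltW. Qed.

Lemma bil_resD_le (A D : 'M[R]_n) s t a w : A^T = A -> opb D 1 ->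
  cabs (bil (resolvent A z *m toC D) (arm s a w) (arm t a w)) <= B.
Proof.
move=> sA hD; rewrite /B mulrC; apply: bil_le (copb_resD sA hD) _ _.
- by rewrite invr_ge0 ltW.
- exact: (loop_C0 hyps).
- exact: (loop_bound hyps).
- exact: (loop_bound hyps).
Qed.

Lemma res_meas (A : T -> 'M[R]_n) : (forall w, (A w)^T = A w) ->
  (forall i j, measurable_fun setT (fun w => A w i j)) ->
  forall i j, cmeas (fun w => resolvent (A w) z i j).
Proof. by move=> sA mA; exact: cmeas_resolvent. Qed.

Lemma sum_mx_but_meas a i j : measurable_fun setT (fun w => sum_mx_but a w i j).
Proof. by apply: (@gmeas_meas (inr a)); exact: gmeas_but_inr. Qed.

Lemma sum_mx_with_meas a i j : measurable_fun setT (fun w => sum_mx_with a w i j).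
Proof. by apply: (@gmeas_meas (inl a)); exact: gmeas_with_inl. Qed.

Lemma xi_meas a : measurable_fun setT (fun w => (xi a w)%:R : R).
Proof.
move=> _ A mA; apply: (coord_sub (i := inl a)).
by rewrite coord_gens; exact: gens_xi.
Qed.

Lemma sum_mx_meas i j : measurable_fun setT (fun w => sum_mx w i j).
Proof.
under eq_fun do rewrite /sum_mx summxE; apply: measurable_sum => b.
under eq_fun do rewrite mxE; apply: measurable_funM; first exact: xi_meas.
under eq_fun do rewrite !mxE !big_ord1 !mxE.
by apply: measurable_funD; apply: measurable_funM;
  [exact: (loop_meas hyps true)|exact: (loop_meas hyps false)
  |exact: (loop_meas hyps false)|exact: (loop_meas hyps true)].
Qed.

Lemma resD_cbmf (A : T -> 'M[R]_n) (D : 'M[R[i]]_n) K : 0 <= K ->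
  (forall w, (A w)^T = A w) ->
  (forall i j, measurable_fun setT (fun w => A w i j)) -> copb D K ->
  cbmf (fun w => \tr (resolvent (A w) z *m D)).
Proof.
move=> K0 sA mA hD; apply: (cbmf_cmeas (K := n%:R * (eta^-1 * K))).
  by apply: cmeas_tr; apply: cmeas_mulmx; exact: res_meas.
move=> w; apply: copb_tr; first by rewrite mulr_ge0// invr_ge0 ltW.
by apply: copbM => //; exact: copb_res.
Qed.

Lemma bil_cbmf (A : T -> 'M[R]_n) (D : 'M[R]_n) s t a :
  (forall w, (A w)^T = A w) ->
  (forall i j, measurable_fun setT (fun w => A w i j)) -> opb D 1 ->
  cbmf (fun w => bil (resolvent (A w) z *m toC D) (arm s a w) (arm t a w)).
Proof.
move=> sA mA hD; apply: (cbmf_cmeas (K := B)); last by move=> w; exact: bil_resD_le.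
apply: cmeas_bil; [|exact: (loop_meas hyps)|exact: (loop_meas hyps)].
by apply: cmeas_mulmx; exact: res_meas.
Qed.

Lemma second_momentE s t a (W : 'M[R]_n) :
  \sum_(u : 'I_n * 'I_n) W u.1 u.2 * Ex P (fun w => arm t a w u.1 0 * arm s a w u.2 0)
  = \tr (W *m second_moment s t a).
Proof.
rewrite -(pair_bigA _ (fun i j => W i j * Ex P (fun w => arm t a w i 0 * arm s a w j 0)))/=.
apply: eq_bigr => i _; rewrite mxE; apply: eq_bigr => j _; rewrite mxE.
by congr (_ * _); apply: Ex_eq => w; rewrite mulrC.
Qed.

Let quad_real (W : T -> 'M[R]_n) s t a :
  (forall i j, gmeas (other_systems (inr a)) (fun w => W w i j)) ->
  (forall i j, bmf (fun w => W w i j)) ->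
  (forall w, opb (W w) eta^-1) ->
  Ex P (fun w => `|inner (W w *m arm s a w) (arm t a w) -
     \tr (W w *m second_moment s t a)|) <= eta^-1 * e.
Proof.
move=> gW bW hW.
have h : Ex P (fun w => (inner (W w *m arm s a w) (arm t a w) -
     \tr (W w *m second_moment s t a)) ^+ 2) <= eta^-1 ^+ 2 * e ^+ 2.
  under eq_fun do rewrite -second_momentE.
  apply: (quad_form_var (F := gens (inr a)) (G := other_systems (inr a))) => //.
  - by rewrite -coord_gens; exact: coord_indep.
  - by move=> i; exact: gens_arm.
  - by move=> i; exact: gens_arm.
  - by move=> i; exact: arm_bmf.
  - by move=> i; exact: arm_bmf.
  - by move=> D hD; exact: (loop_var hyps hD).
  - by rewrite invr_gt0.
apply: Ex_sqr_le; last by rewrite exprMn.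
  apply: bmfB; last first.
    by apply: bmf_sum => i; under eq_fun do rewrite mxE;
      apply: bmf_sum => j; apply: bmfM => //; exact: bmf_cst.
  under eq_fun do rewrite inner_entries.
  apply: bmf_sum => i; apply: bmfM => //; apply: bmfM; exact: arm_bmf.
by rewrite mulr_gt0// invr_gt0.
Qed.

(** The variance hypothesis concerns real matrices, so real and imaginary parts of the resolvent are
    treated separately; hence the factor 2. *)
Let quad_but (D : 'M[R]_n) s t a : opb D 1 ->
  Ex P (fun w => cabs (bil (resolvent (sum_mx_but a w) z *m toC D) (arm t a w) (arm s a w) -
     \tr (resolvent (sum_mx_but a w) z *m toC D *m toC (second_moment s t a)))) <=
  2 * (eta^-1 * e).
Proof.
move=> hD.
pose GD w := resolvent (sum_mx_but a w) z *m toC D.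
pose W1 w := map_mx (@complex.Re R) (GD w); pose W2 w := map_mx (@complex.Im R) (GD w).
have cGD w : copb (GD w) eta^-1 by apply: copb_resD => //; exact: sum_mx_but_sym.
have gGD : forall i j, @cmeas R _ (g_sigma_algebraType (other_systems (inr a)))
    (fun w => GD w i j).
  apply: cmeas_mulmx; apply: cmeas_resolvent => //; first exact: sum_mx_but_sym.
  exact: gmeas_but_inr.
have bGD i j : cbmf (fun w => GD w i j).
  apply: (cbmf_cmeas (K := eta^-1)); last first.
    by move=> w; apply: copb_coord => //; rewrite invr_ge0 ltW.
  apply: cmeas_mulmx; apply: res_meas; first exact: sum_mx_but_sym.
  exact: sum_mx_but_meas.
have h1 : Ex P (fun w => `|inner (W1 w *m arm s a w) (arm t a w) -
     \tr (W1 w *m second_moment s t a)|) <= eta^-1 * e.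
  apply: quad_real => [i j|i j|w]; last exact: copb_Re.
    by under eq_fun do rewrite mxE; exact: (gGD i j).1.
  by under eq_fun do rewrite mxE; exact: (bGD i j).1.
have h2 : Ex P (fun w => `|inner (W2 w *m arm s a w) (arm t a w) -
     \tr (W2 w *m second_moment s t a)|) <= eta^-1 * e.
  apply: quad_real => [i j|i j|w]; last exact: copb_Im.
    by under eq_fun do rewrite mxE; exact: (gGD i j).2.
  by under eq_fun do rewrite mxE; exact: (bGD i j).2.
have bW (W : T -> 'M[R]_n) : (forall i j, bmf (fun w => W w i j)) ->
   bmf (fun w => `|inner (W w *m arm s a w) (arm t a w) - \tr (W w *m second_moment s t a)|).
  move=> bW; apply: bmf_norm; apply: bmfB; last first.
    by apply: bmf_sum => i; under eq_fun do rewrite mxE;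
      apply: bmf_sum => j; apply: bmfM => //; exact: bmf_cst.
  under eq_fun do rewrite inner_entries.
  apply: bmf_sum => i; apply: bmfM => //; apply: bmfM; exact: arm_bmf.
have bW1 : forall i j, bmf (fun w => W1 w i j).
  by move=> i j; under eq_fun do rewrite mxE; exact: (bGD i j).1.
have bW2 : forall i j, bmf (fun w => W2 w i j).
  by move=> i j; under eq_fun do rewrite mxE; exact: (bGD i j).2.
rewrite mulr_natl mulr2n; apply: le_trans (lerD h1 h2).
rewrite -ExD; [|exact: bW|exact: bW].
have trE (M : 'M[R[i]]_n) (Q : 'M[R]_n) :
    (complex.Re (\tr (M *m toC Q)) = \tr (map_mx (@complex.Re R) M *m Q)) *
    (complex.Im (\tr (M *m toC Q)) = \tr (map_mx (@complex.Im R) M *m Q)).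
  split; rewrite /mxtrace.
    rewrite cRe_sum; apply: eq_bigr => i _; rewrite !mxE cRe_sum.
    by apply: eq_bigr => j _; rewrite !mxE cReM /= mulr0 subr0.
  rewrite cIm_sum; apply: eq_bigr => i _; rewrite !mxE cIm_sum.
  by apply: eq_bigr => j _; rewrite !mxE cImM /= mulr0 add0r.
apply: Ex_le => [||w].
- apply: bmf_cabs; apply: cbmfB.
    apply: bil_cbmf => //; first exact: sum_mx_but_sym.
    exact: sum_mx_but_meas.
  under eq_fun do rewrite -mulmxA.
  apply: (resD_cbmf (K := 1 * (k / n%:R))).
  + by rewrite mul1r divr_ge0// ltW.
  + exact: sum_mx_but_sym.
  + exact: sum_mx_but_meas.
  + by apply: copbM; apply: toC_opb => //; exact: (loop_opb hyps).
- by apply: bmfD; exact: bW.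
- apply: le_trans (cabs_le_ReIm _) _.
  by rewrite cReD cImD cReN cImN Re_bil Im_bil !trE.
Qed.

(* Removing the a-th summand is a rank-two perturbation, invisible to
   [second_moment], whose operator norm is O(1/n). *)
Let quad_full (D : 'M[R]_n) s t a : opb D 1 ->
  Ex P (fun w => cabs (bil (resolvent (sum_mx_but a w) z *m toC D) (arm t a w) (arm s a w) -
     \tr (resolvent (sum_mx w) z *m toC D *m toC (second_moment s t a)))) <=
  (2 / eta + 2 * k * C0 / eta ^+ 2) * e.
Proof.
move=> hD; set Q := second_moment s t a.
have hDQ : opb (D *m Q) (1 * (k / n%:R)) by apply: opbM => //; exact: (loop_opb hyps).
have kn0 : 0 <= 1 * (k / n%:R) by rewrite mul1r divr_ge0// ltW.
have h w : cabs (\tr (resolvent (sum_mx_but a w) z *m toC D *m toC Q) -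
     \tr (resolvent (sum_mx w) z *m toC D *m toC Q)) <= 2 * k * C0 / eta ^+ 2 * e.
  rewrite -!mulmxA -map_mxM (sum_mxE a); case: ifP => _; last first.
    rewrite subrr cabs0 !mulr_ge0 ?invr_ge0 ?exprn_ge0 ?(loop_C0 hyps)// ltW//.
  have hr := rank2_tr_le (sum_mx_but_sym a w) zn0 kn0 (loop_C0 hyps) hDQ
    (loop_bound hyps true a w) (loop_bound hyps false a w).
  apply: le_trans hr _.
  have -> : 2 * (1 * (k / n%:R) * C0 / eta ^+ 2) = 2 * k * C0 / eta ^+ 2 * n%:R^-1.
    by ring.
  apply: ler_wpM2l.
    by rewrite !mulr_ge0 ?invr_ge0 ?exprn_ge0 ?(loop_C0 hyps)// ltW.
  (* 1/n <= e^2 <= e, the latter because e <= 1. *)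
  apply: le_trans (loop_ne hyps) _; rewrite expr2 ler_piMr// ltW//.
have bQ (A : T -> 'M[R]_n) : (forall w, (A w)^T = A w) ->
    (forall i j, measurable_fun setT (fun w => A w i j)) ->
    cbmf (fun w => \tr (resolvent (A w) z *m toC D *m toC Q)).
  move=> sA mA; under eq_fun do rewrite -mulmxA.
  apply: (resD_cbmf kn0) => //.
  by apply: copbM; apply: toC_opb => //; exact: (loop_opb hyps).
have sb := sum_mx_but_sym a; have mb := sum_mx_but_meas a.
rewrite mulrDl -(Ex_cst P (2 * k * C0 / eta ^+ 2 * e)).
have := quad_but s t a hD; rewrite mulrA -/Q => hq.
apply: le_trans (lerD hq (lexx _)); rewrite -ExD; last 2 first.
- by apply: bmf_cabs; apply: cbmfB; [apply: bil_cbmf|apply: bQ].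
- exact: bmf_cst.
apply: Ex_le => [||w].
- by apply: bmf_cabs; apply: cbmfB; [apply: bil_cbmf|apply: bQ];
    first [exact: sum_mx_sym|exact: sum_mx_meas|by []].
- apply: bmfD; last exact: bmf_cst.
  by apply: bmf_cabs; apply: cbmfB; [apply: bil_cbmf|apply: bQ].
- apply: le_trans (lerD (lexx _) (h w)); apply: le_trans (cabsD _ _).
  by rewrite addrA subrK.
Qed.


Let K := 2 / eta + 2 * k * C0 / eta ^+ 2.
Let K0 : 0 <= K.
Proof.
have := loop_C0 hyps => ?.
by rewrite addr_ge0// !mulr_ge0 ?invr_ge0 ?exprn_ge0// ltW.
Qed.

Lemma second_momentC s t a : second_moment s t a = (second_moment t s a)^T.
Proof. by apply/matrixP => i j; rewrite !mxE; apply: Ex_eq => w; rewrite mulrC. Qed.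

(** The sum over [a] is at most the sum over entries of |M_ji| times the summed moduli of the cross
    moments. Cauchy-Schwarz pairs the Hilbert-Schmidt norm of M, at most sqrt n L, with that of
    [loop_cross], at most e / sqrt n, and the powers of n cancel. *)
Let cross_tr (M : 'M[R[i]]_n) s L : 0 <= L ->
  \sum_(u : 'I_n * 'I_n) cabs (M u.1 u.2) ^+ 2 <= n%:R * L ^+ 2 ->
  \sum_(a < m) cabs (\tr (M *m toC (second_moment s (~~ s) a))) <= m%:R * (L * e).
Proof.
(* Exchanging the two families transposes the cross moments, hence amounts to transposing [M]. *)
wlog : M s / s.
  case: s => [h|h L0 hM]; first exact: (h M true isT).
  have := h M^T true isT L0.
  rewrite -(pair_bigA _ (fun i j => cabs (M^T i j) ^+ 2))/= exchange_big/=.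
  under eq_bigr do under eq_bigr do rewrite mxE.
  rewrite pair_bigA => /(_ hM); apply: le_trans.
  rewrite le_eqVlt; apply/orP; left; apply/eqP; apply: eq_bigr => a _.
  rewrite (second_momentC false) -map_trmx -[in RHS]mxtrace_tr.
  by rewrite [in RHS]trmx_mul trmxK [in RHS]mxtrace_mulC.
move=> ->; rewrite /negb => L0 hM.
pose q (u : 'I_n * 'I_n) := m%:R^-1 * \sum_(a < m) `|second_moment true false a u.1 u.2|.
have sw : \sum_(u : 'I_n * 'I_n) cabs (M u.2 u.1) ^+ 2 <= n%:R * L ^+ 2.
  apply: le_trans hM.
  rewrite -(pair_bigA _ (fun i j => cabs (M j i) ^+ 2))/= exchange_big/=.
  by rewrite pair_bigA.
apply: (@le_trans _ _ (m%:R * \sum_(u : 'I_n * 'I_n) cabs (M u.2 u.1) * q u)).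
  rewrite mulr_sumr.
  apply: (@le_trans _ _ (\sum_(a < m) \sum_(u : 'I_n * 'I_n)
      cabs (M u.2 u.1) * `|second_moment true false a u.1 u.2|)).
    apply: ler_sum => a _; rewrite /mxtrace.
    rewrite -(pair_bigA _ (fun i j => cabs (M j i) * `|second_moment true false a i j|))/=.
    rewrite exchange_big/=; apply: le_trans (cabs_sum _ _ _) _.
    apply: ler_sum => i _; rewrite mxE; apply: le_trans (cabs_sum _ _ _) _.
    by apply: ler_sum => j _; rewrite cabsM !mxE cabs_real.
  rewrite exchange_big/=; apply: ler_sum => u _; rewrite -mulr_sumr /q mulrCA.
  by rewrite mulVKf// gt_eqF.
apply: ler_wpM2l; first exact: ltW.
rewrite -(@ler_pXn2r _ 2)// ?nnegrE; last 2 first.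
- by apply: sumr_ge0 => u _; rewrite !mulr_ge0 ?cabs_ge0 ?invr_ge0 ?sumr_ge0// ltW.
- by rewrite mulr_ge0// ltW.
apply: le_trans (cauchy_schwarz (fun u => cabs (M u.2 u.1)) q) _.
apply: le_trans (ler_pM _ _ sw (loop_cross hyps)) _.
- by apply: sumr_ge0 => u _; exact: sqr_ge0.
- by apply: sumr_ge0 => u _; exact: sqr_ge0.
rewrite le_eqVlt; apply/orP; left; apply/eqP; rewrite exprMn.
by field; rewrite gt_eqF.
Qed.

(** [quad_full] turns each mixed form into a trace against its cross moment; [cross_tr], applied at
    each [w], makes the average of these traces small. No single mixed form is claimed to be
    small. *)
Let cross_sum (D : 'M[R]_n) s : opb D 1 ->
  \sum_(a < m) Ex P (fun w => cabs (bil (resolvent (sum_mx_but a w) z *m toC D)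
      (arm (~~ s) a w) (arm s a w))) <= m%:R * ((K + eta^-1) * e).
Proof.
move=> hD; pose Q a := second_moment s (~~ s) a.
pose G w := resolvent (sum_mx w) z *m toC D.
have cG w : copb (G w) eta^-1 by apply: copb_resD => //; exact: sum_mx_sym.
have bQ a : bmf (fun w => cabs (\tr (G w *m toC (Q a)))).
  apply: bmf_cabs; under eq_fun do rewrite -mulmxA.
  apply: (resD_cbmf (K := 1 * (k / n%:R))).
  + by rewrite mul1r divr_ge0// ltW.
  + exact: sum_mx_sym.
  + exact: sum_mx_meas.
  + by apply: copbM; apply: toC_opb => //; exact: (loop_opb hyps).
have bB a : cbmf (fun w => bil (resolvent (sum_mx_but a w) z *m toC D)
      (arm (~~ s) a w) (arm s a w)).
  by apply: bil_cbmf => //; [exact: sum_mx_but_sym|exact: sum_mx_but_meas].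
have h a : Ex P (fun w => cabs (bil (resolvent (sum_mx_but a w) z *m toC D)
      (arm (~~ s) a w) (arm s a w))) <=
   K * e + Ex P (fun w => cabs (\tr (G w *m toC (Q a)))).
  apply: le_trans (lerD (quad_full s (~~ s) a hD) (lexx _)).
  have cQ : cbmf (fun w => \tr (G w *m toC (Q a))).
    under eq_fun do rewrite -mulmxA.
    apply: (resD_cbmf (K := 1 * (k / n%:R))).
    + by rewrite mul1r divr_ge0// ltW.
    + exact: sum_mx_sym.
    + exact: sum_mx_meas.
    + by apply: copbM; apply: toC_opb => //; exact: (loop_opb hyps).
  rewrite -ExD//; last by apply: bmf_cabs; exact: cbmfB.
  apply: Ex_le => [||w]; first exact: bmf_cabs.
    by apply: bmfD => //; apply: bmf_cabs; exact: cbmfB.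
  by apply: le_trans (cabsD _ _); rewrite subrK.
apply: le_trans (ler_sum _ (fun a _ => h a)) _.
rewrite big_split/= sumr_const card_ord -[X in X + _ <= _]mulr_natl (mulrDl K) [leRHS]mulrDr lerD2l.
rewrite -Ex_sum// -[leRHS](Ex_cst P); apply: Ex_le => [||w].
- exact: bmf_sum.
- exact: bmf_cst.
- apply: cross_tr; first by rewrite invr_ge0 ltW.
  rewrite -(pair_bigA _ (fun i j => cabs (G w i j) ^+ 2))/=.
  exact: copb_hs.
Qed.

Section Deviation.
Variables (f : R[i]) (delta F1 : R).
Hypotheses (hf : cabs f <= F1)
  (hdelta : forall D, opb D 1 -> Ex P (fun w => cabs (tr_dev z f D w)) <= delta).

Let F10 : 0 <= F1. Proof. exact: le_trans (cabs_ge0 f) hf. Qed.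

Let tr_dev_cbmf D L : 0 <= L -> opb D L -> cbmf (tr_dev z f D).
Proof.
move=> L0 hD; apply: cbmfB; last exact: cbmf_cst.
apply: cbmfM; first exact: cbmf_cst.
by apply: (resD_cbmf L0) => //; [exact: sum_mx_sym|exact: sum_mx_meas|exact: toC_opb].
Qed.

Let tr_devZ a D w : tr_dev z f (a *: D) w = real_complex R a * tr_dev z f D w.
Proof. by rewrite /tr_dev map_mxZ -scalemxAr !mxtraceZ !rmorphM/=; ring. Qed.

Let dev_scaled D : opb D k -> Ex P (fun w => cabs (tr_dev z f D w)) <= k * delta.
Proof.
move=> hD; have hD1 : opb (k^-1 *: D) 1.
  by have := opbZ k^-1 hD; rewrite mulVf// gt_eqF.
rewrite (_ : (fun w => _) = fun w => k * cabs (tr_dev z f (k^-1 *: D) w)).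
  rewrite ExZ; last by apply: bmf_cabs; exact: tr_dev_cbmf hD1.
  by rewrite ler_pM2l//; exact: hdelta.
apply/funext => w; rewrite -[X in X * _](gtr0_norm k0) -cabs_real -cabsM -tr_devZ.
by rewrite scalerA divff ?scale1r// gt_eqF.
Qed.

(** The trace left by [quad_full] is the normalized trace against n D Q, a matrix of norm at most
    [k]; by linearity its deviation is at most [k * delta]. *)
Let diag_dev D s a : opb D 1 ->
  Ex P (fun w => cabs (bil (resolvent (sum_mx_but a w) z *m toC D) (arm s a w) (arm s a w) -
     f * real_complex R (\tr (D *m second_moment s s a)))) <= K * e + k * delta.
Proof.
move=> hD; set Q := second_moment s s a.
have hD' : opb (n%:R *: (D *m Q)) k.
  have : opb (D *m Q) (1 * (k / n%:R)) by apply: opbM => //; exact: (loop_opb hyps).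
  by move=> /(opbZ n%:R); rewrite mul1r mulrCA divff ?gt_eqF// mulr1.
have eD w : tr_dev z f (n%:R *: (D *m Q)) w =
    \tr (resolvent (sum_mx w) z *m toC D *m toC Q) - f * real_complex R (\tr (D *m Q)).
  have nC : n%:R != 0 :> R[i] by rewrite pnatr_eq0 -lt0n (loop_n hyps).
  rewrite /tr_dev map_mxZ -scalemxAr !mxtraceZ map_mxM mulmxA rmorph_nat mulrA.
  by rewrite mulVf// mul1r (mulrA n%:R^-1) mulVf ?mul1r// gt_eqF.
apply: le_trans (lerD (quad_full s s a hD) (dev_scaled hD')).
have b1 : cbmf (fun w => bil (resolvent (sum_mx_but a w) z *m toC D) (arm s a w) (arm s a w)).
  by apply: bil_cbmf => //; [exact: sum_mx_but_sym|exact: sum_mx_but_meas].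
have b2 : cbmf (fun w => \tr (resolvent (sum_mx w) z *m toC D *m toC Q)).
  under eq_fun do rewrite -mulmxA.
  apply: (resD_cbmf (K := 1 * (k / n%:R))).
  + by rewrite mul1r divr_ge0// ltW.
  + exact: sum_mx_sym.
  + exact: sum_mx_meas.
  + by apply: copbM; apply: toC_opb => //; exact: (loop_opb hyps).
have b3 := tr_dev_cbmf (ltW k0) hD'.
rewrite -ExD; [|by apply: bmf_cabs; exact: cbmfB|exact: bmf_cabs].
apply: Ex_le => [||w].
- by apply: bmf_cabs; apply: cbmfB => //; exact: cbmf_cst.
- by apply: bmfD; apply: bmf_cabs => //; exact: cbmfB.
- by rewrite eD; apply: le_trans (cabsD _ _); rewrite addrA subrK.
Qed.

Let S1 := (K + F1) * e + k * delta.
Let S2 := (K + eta^-1) * e.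

(** The case D = 1 of [diag_dev], where replacing Tr Q by 1 costs a further [F1 * e]. *)
Let diag_dev1 s a :
  Ex P (fun w => cabs (bil (resolvent (sum_mx_but a w) z *m toC 1%:M) (arm s a w) (arm s a w) - f))
  <= S1.
Proof.
have := diag_dev s a (@opb1 R n) => h.
rewrite /S1 mulrDl -addrA [F1 * e + _]addrC addrA -(Ex_cst P (F1 * e)).
apply: le_trans (lerD h (lexx _)).
have b1 : cbmf (fun w => bil (resolvent (sum_mx_but a w) z *m toC 1%:M) (arm s a w) (arm s a w)).
  by apply: bil_cbmf => //; [exact: sum_mx_but_sym|exact: sum_mx_but_meas|exact: opb1].
have b2 : bmf (fun w => cabs (bil (resolvent (sum_mx_but a w) z *m toC 1%:M)
    (arm s a w) (arm s a w) - f * real_complex R (\tr (1%:M *m second_moment s s a)))).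
  by apply: bmf_cabs; apply: cbmfB => //; exact: cbmf_cst.
rewrite -ExD; [|exact: b2|exact: bmf_cst].
apply: Ex_le => [||w].
- by apply: bmf_cabs; apply: cbmfB => //; exact: cbmf_cst.
- by apply: bmfD => //; exact: bmf_cst.
rewrite mul1mx; set q := \tr _; set b := bil _ _ _.
have -> : b - f = (b - f * real_complex R q) + f * real_complex R (q - 1).
  by rewrite rmorphB/= rmorph1; ring.
apply: le_trans (cabsD _ _) _; rewrite lerD2l cabsM cabs_real.
by apply: ler_pM => //; [exact: cabs_ge0|exact: (loop_tr hyps)].
Qed.

Let diag_dev2 D s a : opb D 1 ->
  Ex P (fun w => cabs (bil (resolvent (sum_mx_but a w) z *m toC D) (arm s a w) (arm s a w) -
     f * real_complex R (\tr (D *m second_moment s s a)))) <= S1.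
Proof.
move=> hD; apply: le_trans (diag_dev s a hD) _.
by rewrite /S1 lerD2r ler_wpM2r ?lerDl// ltW.
Qed.


Section Direction.
Variable D : 'M[R]_n.
Hypothesis hD : opb D 1.

(** [h a] is what the a-th summand contributes to Tr (D A G) when present. With both diagonal forms
    replaced by f and the mixed ones by 0, [rank2_solve] reads h (1 - f^2) = - f^2 q; the error in
    this relation is [r a]. *)
Let h a w := bil (resolvent (sum_mx_with a w) z *m toC D) (arm false a w) (arm true a w) +
             bil (resolvent (sum_mx_with a w) z *m toC D) (arm true a w) (arm false a w).
Let q a := \tr (D *m second_moment true true a) + \tr (D *m second_moment false false a).
Let r a w := h a w * (1 - f ^+ 2) + f ^+ 2 * real_complex R (q a).
Let loc D' s t a w := bil (resolvent (sum_mx_but a w) z *m toC D') (arm s a w) (arm t a w).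
Let q1 s a := real_complex R (\tr (D *m second_moment s s a)).

(** By [rank2_solve], [r] is a sum of products in each of which one factor is a deviation or a mixed
    form, the others being bounded by [B], [2 * B] or [F1]. *)
Let r_le a w : cabs (r a w) <=
  2 * B * (B * cabs (loc 1%:M false false a w - f) + F1 * cabs (loc 1%:M true true a w - f) +
    (2 + B) * cabs (loc 1%:M true false a w)) +
  (1 + B) * (cabs (loc D false true a w) + cabs (loc D true false a w)) +
  (B * cabs (loc 1%:M false false a w - f) + F1 * cabs (loc D true true a w - f * q1 true a)) +
  (B * cabs (loc 1%:M true true a w - f) + F1 * cabs (loc D false false a w - f * q1 false a)).
Proof.
have := rank2_solve (arm true a w) (arm false a w) (sum_mx_but_sym a w) zn0 D.
have locB D' s t : opb D' 1 -> cabs (loc D' s t a w) <= B.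
  by move=> hD'; apply: bil_resD_le => //; exact: sum_mx_but_sym.
have e1' s t : bil (resolvent (sum_mx_but a w) z) (arm s a w) (arm t a w) =
    loc 1%:M s t a w by rewrite /loc map_mx1 mulmx1.
cbv zeta; rewrite !e1' => e2.
(* With al, be the diagonal forms and ga the mixed one: al be - f^2 = al (be - f) + f (al - f) and
   (1 + ga)^2 - 1 = ga (2 + ga). The products with the forms in D are split likewise. *)
have -> : r a w = h a w * (loc 1%:M true true a w * (loc 1%:M false false a w - f) +
    f * (loc 1%:M true true a w - f) -
    loc 1%:M true false a w * (2 + loc 1%:M true false a w)) +
  (1 + loc 1%:M true false a w) * (loc D false true a w + loc D true false a w) -
  ((loc 1%:M false false a w - f) * loc D true true a w +
     f * (loc D true true a w - f * q1 true a)) -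
  ((loc 1%:M true true a w - f) * loc D false false a w +
     f * (loc D false false a w - f * q1 false a)).
  have e3 : h a w * ((1 + loc 1%:M true false a w) ^+ 2 -
      loc 1%:M true true a w * loc 1%:M false false a w) =
    (1 + loc 1%:M true false a w) * (loc D false true a w + loc D true false a w) -
    loc 1%:M false false a w * loc D true true a w -
    loc 1%:M true true a w * loc D false false a w by exact: e2.
  rewrite /r /q rmorphD/= -/(q1 true a) -/(q1 false a).
  move: e3; set al := loc 1%:M true true a w; set be := loc 1%:M false false a w.
  set ga := loc 1%:M true false a w; set ka := loc D false true a w.
  set kb := loc D true false a w; set mu := loc D true true a w.
  set nu := loc D false false a w; set hh := h a w => e3.
  apply/eqP; rewrite -subr_eq0; apply/eqP.
  transitivity (hh * ((1 + ga) ^+ 2 - al * be) -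
    ((1 + ga) * (ka + kb) - be * mu - al * nu)); first by ring.
  by apply/eqP; rewrite subr_eq0; apply/eqP; exact: e3.
have hh : cabs (h a w) <= 2 * B.
  rewrite /h mulr_natl mulr2n; apply: le_trans (cabsD _ _) _.
  by apply: lerD; apply: bil_resD_le => //; exact: sum_mx_with_sym.
have cM (u v : R[i]) U V : cabs u <= U -> cabs v <= V -> cabs (u * v) <= U * V.
  by move=> hu hv; rewrite cabsM ler_pM// cabs_ge0.
have cD (u v : R[i]) U V : cabs u <= U -> cabs v <= V -> cabs (u + v) <= U + V.
  by move=> hu hv; exact: le_trans (cabsD _ _) (lerD hu hv).
have cB (u v : R[i]) U V : cabs u <= U -> cabs v <= V -> cabs (u - v) <= U + V.
  by move=> hu hv; exact: le_trans (cabsB _ _) (lerD hu hv).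
have hB1 s t : cabs (loc 1%:M s t a w) <= B by apply: locB; exact: opb1.
have hBD s t : cabs (loc D s t a w) <= B by exact: locB.
have c2 : cabs (2 : R[i]) <= 2.
  rewrite (_ : (2 : R[i]) = 1 + 1)//; apply: le_trans (cabsD _ _) _.
  by rewrite cabs1.
have c1 : cabs (1 : R[i]) <= 1 by rewrite cabs1.
apply: (cB); last first.
  by apply: (cD); [rewrite mulrC|]; apply: (cM).
apply: (cB); last first.
  by apply: (cD); [rewrite mulrC|]; apply: (cM).
apply: (cD); last first.
  by apply: (cM); [apply: (cD)|apply: (cD)].
apply: (cM) => //; apply: (cB); first by apply: (cD); apply: (cM).
by rewrite mulrC; apply: (cM) => //; apply: (cD).
Qed.

Let loc_cbmf D' s t a : opb D' 1 -> cbmf (loc D' s t a).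
Proof.
by move=> hD'; apply: bil_cbmf => //; [exact: sum_mx_but_sym|exact: sum_mx_but_meas].
Qed.

Let r_cbmf a : cbmf (r a).
Proof.
apply: cbmfD; last exact: cbmf_cst.
apply: cbmfM; last exact: cbmf_cst.
by apply: cbmfD; apply: bil_cbmf => //;
  first [exact: sum_mx_with_sym|exact: sum_mx_with_meas].
Qed.

(** [r a] is built on [sum_mx_with a] and is therefore independent of [xi a]: the mean of [xi a]
    times |r a| is p times the mean of |r a|, a gain of the small factor p. *)
Let r_gmeas a : gmeas (other_systems (inl a)) (fun w => cabs (r a w)).
Proof.
apply: measurable_cabs.
have garm s i : gmeas (other_systems (inl a)) (fun w => arm s a w i 0).
  by apply: (@gmeas_other _ (inr a)) => //; exact: gens_arm.
have gres : forall i j, @cmeas R _ (g_sigma_algebraType (other_systems (inl a)))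
    (fun w => (resolvent (sum_mx_with a w) z *m toC D) i j).
  apply: cmeas_mulmx; apply: cmeas_resolvent => //; first exact: sum_mx_with_sym.
  exact: gmeas_with_inl.
apply: cmeasD; last exact: cmeas_cst.
apply: cmeasM; last exact: cmeas_cst.
by apply: cmeasD; apply: cmeas_bil.
Qed.

Let S := 2 * B * (B * S1 + F1 * S1 + (2 + B) * S2) + (1 + B) * (S2 + S2) +
  (B * S1 + F1 * S1) + (B * S1 + F1 * S1).

Let sum_r : \sum_(a < m) Ex P (fun w => cabs (r a w)) <= m%:R * S.
Proof.
pose g a := Ex P (fun w => cabs (loc 1%:M true false a w)).
pose ka a := Ex P (fun w => cabs (loc D false true a w)).
pose kb a := Ex P (fun w => cabs (loc D true false a w)).
have o1 := @opb1 R n.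
have bl D' s t a : opb D' 1 -> bmf (fun w => cabs (loc D' s t a w)).
  by move=> hD'; apply: bmf_cabs; exact: loc_cbmf.
have bl1 D' s t a (k' : R[i]) : opb D' 1 -> bmf (fun w => cabs (loc D' s t a w - k')).
  by move=> hD'; apply: bmf_cabs; apply: cbmfB; [exact: loc_cbmf|exact: cbmf_cst].
have h1 a : Ex P (fun w => cabs (r a w)) <=
  2 * B * (B * S1 + F1 * S1 + (2 + B) * g a) + (1 + B) * (ka a + kb a) +
  (B * S1 + F1 * S1) + (B * S1 + F1 * S1).
  have ha := diag_dev1 true a; have hb := diag_dev1 false a.
  have hm := diag_dev2 true a hD; have hn := diag_dev2 false a hD.
  apply: (@le_trans _ _ (2 * B * (B * Ex P (fun w => cabs (loc 1%:M false false a w - f)) +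
    F1 * Ex P (fun w => cabs (loc 1%:M true true a w - f)) + (2 + B) * g a) +
    (1 + B) * (ka a + kb a) +
    (B * Ex P (fun w => cabs (loc 1%:M false false a w - f)) +
     F1 * Ex P (fun w => cabs (loc D true true a w - f * q1 true a))) +
    (B * Ex P (fun w => cabs (loc 1%:M true true a w - f)) +
     F1 * Ex P (fun w => cabs (loc D false false a w - f * q1 false a))))); last first.
    exact: (lin_bound _ _ B0 F10 ha hb hm hn).
  apply: Ex_lin_bound; [exact: bl1|exact: bl1|exact: bl|exact: bl|exact: bl|
    exact: bl1|exact: bl1|exact: bmf_cabs|exact: r_le].
apply: le_trans (ler_sum _ (fun a _ => h1 a)) _.
have hg : \sum_(a < m) g a <= m%:R * S2 by exact: (cross_sum false o1).
have hka : \sum_(a < m) ka a <= m%:R * S2 by exact: (cross_sum true hD).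
have hkb : \sum_(a < m) kb a <= m%:R * S2 by exact: (cross_sum false hD).
exact: (@sum_lin_bound R m B F1 S1 S2 g ka kb B0 hg hka hkb).
Qed.


Let Exi a : Ex P (fun w => (xi a w)%:R : R) = p.
Proof.
have -> : (fun w => (xi a w)%:R : R) = \1_[set w | xi a w = true].
  apply/funext => w; rewrite indicE; congr (nat_of_bool _)%:R.
  by apply/idP/idP; rewrite inE.
rewrite /Ex /Rintegral; under eq_integral do rewrite -[X in X%:E]/(\1_[set w | xi a w = true] _).
rewrite integral_indic//; last first.
  have mt : measurable [set true] by [].
  by have := loop_xi hyps a measurableT mt; rewrite setTI.
by rewrite setIT [X in fine X](loop_law hyps a).
Qed.

Let xi_bmf a : bmf (fun w => (xi a w)%:R : R).
Proof.
apply: (bmf_le (K := 1)); first exact: xi_meas.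
by move=> w; case: (xi a w); rewrite /= ?normr1// normr0.
Qed.

Let p0 : 0 <= p.
Proof.
have a : 'I_m := Ordinal (loop_m hyps).
by rewrite -(Exi a); apply: Ex_ge0 => w; case: (xi a w).
Qed.

Let mp_le : m%:R * p <= n%:R * (c + 1).
Proof.
have := loop_mp hyps; rewrite ler_norml => /andP[_].
rewrite lerBlDl => hl; have {}hl := le_trans hl (lerD (lexx c) e1).
by rewrite [leRHS]mulrC -ler_pdivrMr// mulrAC.
Qed.

Let xi_gmeas a : gmeas (gens (inl a)) (fun w => (xi a w)%:R - p : R).
Proof. by apply: measurable_funB; [exact: gens_xi|exact: measurable_cst]. Qed.

Let xi_cov a b : Ex P (fun w => ((xi a w)%:R - p) * ((xi b w)%:R - p)) <= p *+ (a == b).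
Proof.
have bx c' : bmf (fun w => (xi c' w)%:R - p : R) by apply: bmfB => //; exact: bmf_cst.
have Ex0 c' : Ex P (fun w => (xi c' w)%:R - p) = 0.
  by rewrite ExB ?Exi ?Ex_cst ?subrr//; exact: bmf_cst.
have [<-|ab] := eqVneq a b; last first.
  rewrite mulr0n (Ex_gindep (F := gens (inl a)) (G := other_systems (inl a)))//.
  - by rewrite Ex0 mul0r.
  - by rewrite -coord_gens; exact: coord_indep.
  - by apply: (@gmeas_other _ (inl b)) => //; apply: contra ab => /eqP[->].
rewrite mulr1n (_ : (fun w => _) = fun w => (1 - 2 * p) * (xi a w)%:R + p ^+ 2); last first.
  by apply/funext => w; case: (xi a w) => /=; ring.
rewrite ExD; [|by apply: bmfM => //; exact: bmf_cst|exact: bmf_cst].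
rewrite ExZ// Exi Ex_cst (_ : (1 - 2 * p) * p + p ^+ 2 = p - p ^+ 2); last by ring.
by rewrite gerBl sqr_ge0.
Qed.

Let q_le a : `|q a| <= 2 * k.
Proof.
have hs s : `|\tr (D *m second_moment s s a)| <= k.
  have := opb_tr _ (opbM hD (loop_opb hyps s s a)).
  by rewrite mul1r mulrCA divff ?gt_eqF// mulr1; apply; rewrite divr_ge0// ltW.
by rewrite mulr_natl mulr2n; apply: le_trans (ler_normD _ _) (lerD (hs _) (hs _)).
Qed.

(** Distinct centred Bernoulli variables are uncorrelated, so the second moment is at most n^-2 m p
    (2 k)^2 <= (2 k)^2 (c + 1) / n, and 1/n <= e^2. *)
Let xi_fluct : Ex P (fun w => `|n%:R^-1 * \sum_(a < m) ((xi a w)%:R - p) * q a|) <=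
  2 * k * (c + 1) * e.
Proof.
have c0 := loop_c hyps.
have c10 : 0 < c + 1 by lra.
have bx c' : bmf (fun w => (xi c' w)%:R - p : R) by apply: bmfB => //; exact: bmf_cst.
apply: Ex_sqr_le.
- apply: bmfM; first exact: bmf_cst.
  by apply: bmf_sum => a; apply: bmfM => //; exact: bmf_cst.
- by rewrite !mulr_gt0.
have -> : (fun w => (n%:R^-1 * \sum_(a < m) ((xi a w)%:R - p) * q a) ^+ 2) =
  fun w => \sum_(a < m) \sum_(b < m) (n%:R^-1 ^+ 2 * q a * q b) *
     (((xi a w)%:R - p) * ((xi b w)%:R - p)).
  apply/funext => w; rewrite exprMn [X in _ * X]expr2 mulr_suml mulr_sumr; apply: eq_bigr => a _.
  by rewrite mulr_sumr mulr_sumr; apply: eq_bigr => b _; ring.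
have bxx a b : bmf (fun w => ((xi a w)%:R - p) * ((xi b w)%:R - p)) by exact: bmfM.
have bxq a b : bmf (fun w => (n%:R^-1 ^+ 2 * q a * q b) * (((xi a w)%:R - p) * ((xi b w)%:R - p))).
  by apply: bmfM => //; exact: bmf_cst.
rewrite Ex_sum => [|a]; last exact: bmf_sum.
apply: (@le_trans _ _ (\sum_(a < m) n%:R^-1 ^+ 2 * (2 * k) ^+ 2 * p)).
  apply: ler_sum => a _; rewrite Ex_sum//.
  have E0 b : b != a -> Ex P (fun w => ((xi a w)%:R - p) * ((xi b w)%:R - p)) = 0.
    move=> ba.
    rewrite (Ex_gindep (F := gens (inl a)) (G := other_systems (inl a)))//.
    - by rewrite ExB ?Exi ?Ex_cst ?subrr ?mul0r//; exact: bmf_cst.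
    - by rewrite -coord_gens; exact: coord_indep.
    - by apply: (@gmeas_other _ (inl b)) => //; apply: contra ba => /eqP[->].
  rewrite (bigD1 a)//= big1 ?addr0 => [|b ba]; last by rewrite ExZ// E0// mulr0.
  rewrite ExZ//; have := xi_cov a a; rewrite eqxx mulr1n.
  set E := Ex P _ => hcov.
  have E_ge0 : 0 <= E by apply: Ex_ge0 => w; rewrite -expr2 sqr_ge0.
  have -> : n%:R^-1 ^+ 2 * q a * q a * E = n%:R^-1 ^+ 2 * (q a ^+ 2 * E) by ring.
  rewrite -mulrA; apply: ler_wpM2l; first exact: sqr_ge0.
  apply: ler_pM => //; first exact: sqr_ge0.
  rewrite -(real_normK (num_real (q a))) ler_pXn2r ?nnegrE//.
  by rewrite mulr_ge0// ltW.
rewrite sumr_const card_ord -[leLHS]mulr_natl.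
have -> : m%:R * (n%:R^-1 ^+ 2 * (2 * k) ^+ 2 * p) =
   (2 * k) ^+ 2 * (n%:R^-1 ^+ 2 * (m%:R * p)) by ring.
have -> : (2 * k * (c + 1) * e) ^+ 2 = (2 * k) ^+ 2 * (e ^+ 2 * (c + 1) ^+ 2) by ring.
apply: ler_wpM2l; first exact: sqr_ge0.
apply: (@le_trans _ _ (n%:R^-1 ^+ 2 * (n%:R * (c + 1)))).
  by apply: ler_wpM2l => //; exact: sqr_ge0.
have -> : n%:R^-1 ^+ 2 * (n%:R * (c + 1)) = n%:R^-1 * (c + 1) by field; rewrite gt_eqF.
apply: ler_pM; [by rewrite invr_ge0 ltW|exact: ltW|exact: (loop_ne hyps)|].
by rewrite expr2; apply: ler_peMr; [exact: ltW|rewrite lerDr].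
Qed.

Let trD_le : `|n%:R^-1 * \tr D| <= 1.
Proof.
rewrite normrM gtr0_norm ?invr_gt0// ler_pdivrMl// mulr1.
by apply: le_trans (opb_tr _ hD) _; rewrite ?mulr1.
Qed.

(** [loop_avg] is used twice, each time with one of its matrices equal to the identity. The weights
    Tr Q which then appear are replaced by 1 at the cost [k * e], and m p / n by c. *)
Let q_avg : `|n%:R^-1 * (\sum_(a < m) p * q a) - 2 * c * (n%:R^-1 * \tr D)| <=
  (2 * k * (c + 1) + 2) * e.
Proof.
set tD := n%:R^-1 * \tr D.
have nn : n%:R != 0 :> R by rewrite gt_eqF.
have mn : m%:R != 0 :> R by rewrite gt_eqF.
have tr1 : n%:R^-1 * \tr (1%:M : 'M[R]_n) = 1 by rewrite mxtrace1 mulVf.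
have hav (g t : 'I_m -> R) : (forall a, `|t a| <= k) -> (forall a, `|g a - 1| <= e) ->
    m%:R^-1 * (\sum_(a < m) t a * g a) = tD ->
    `|m%:R^-1 * (\sum_(a < m) t a) - tD| <= k * e.
  move=> ht hg <-; rewrite -mulrBr -sumrB normrM gtr0_norm ?invr_gt0//.
  rewrite ler_pdivrMl//; apply: le_trans (ler_norm_sum _ _ _) _.
  rewrite mulr_natl -[X in _ *+ X](card_ord m) -sumr_const; apply: ler_sum => a _.
  rewrite -{1}(mulr1 (t a)) -mulrBr normrM distrC.
  by apply: ler_pM.
have ht s a : `|\tr (D *m second_moment s s a)| <= k.
  have := opb_tr _ (opbM hD (loop_opb hyps s s a)).
  by rewrite mul1r mulrCA divff ?gt_eqF// mulr1; apply; rewrite divr_ge0// ltW.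
have h1 := hav _ _ (ht true) (loop_tr hyps false) _.
have h2 := hav _ _ (ht false) (loop_tr hyps true) _.
have {}h1 : `|m%:R^-1 * (\sum_(a < m) \tr (D *m second_moment true true a)) - tD| <= k * e.
  apply: h1; have := loop_avg hyps D 1%:M; rewrite tr1 mulr1 -/tD => <-.
  by congr (_ * _); apply: eq_bigr => a _; rewrite mulmx1 mxtrace_mulC.
have {}h2 : `|m%:R^-1 * (\sum_(a < m) \tr (D *m second_moment false false a)) - tD| <= k * e.
  apply: h2; have := loop_avg hyps 1%:M D; rewrite tr1 mul1r -/tD => <-.
  by congr (_ * _); apply: eq_bigr => a _; rewrite mulmx1 mulrC mxtrace_mulC.
have -> : n%:R^-1 * (\sum_(a < m) p * q a) - 2 * c * tD =
  m%:R / n%:R * p * ((m%:R^-1 * (\sum_(a < m) \tr (D *m second_moment true true a)) - tD) +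
   (m%:R^-1 * (\sum_(a < m) \tr (D *m second_moment false false a)) - tD)) +
  2 * tD * (m%:R / n%:R * p - c).
  rewrite -mulr_sumr /q big_split/=.
  by field; rewrite nn mn.
apply: le_trans (ler_normD _ _) _.
have mp0 : 0 <= m%:R / n%:R * p by rewrite !mulr_ge0// invr_ge0 ltW.
have mpc : m%:R / n%:R * p <= c + 1 by rewrite mulrAC ler_pdivrMr// [leRHS]mulrC.
rewrite [leRHS]mulrDl; apply: lerD.
  rewrite normrM (ger0_norm mp0).
  have -> : 2 * k * (c + 1) * e = (c + 1) * (k * e + k * e) by ring.
  by apply: ler_pM => //; apply: le_trans (ler_normD _ _) _; exact: lerD.
rewrite (normrM (2 * tD)) (normrM 2) normr_nat; apply: ler_pM => //; last first.
  exact: (loop_mp hyps).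
by apply: ler_piMr => //; exact: trD_le.
Qed.

(** Tr (D A G) is computed in two ways: from A G = 1 + z G, and summand by summand, where the
    definition of [r] is solved for h (1 - f^2). *)
Let loop_identity w :
  (real_complex R (n%:R^-1 * \tr D) + z * (n%:R^-1 * \tr (resolvent (sum_mx w) z *m toC D))) *
    (1 - f ^+ 2) + 2 * f ^+ 2 * real_complex R c * real_complex R (n%:R^-1 * \tr D) =
  n%:R^-1 * (\sum_(a < m) (xi a w)%:R * r a w) -
  f ^+ 2 * real_complex R (n%:R^-1 * (\sum_(a < m) ((xi a w)%:R - p) * q a) +
    (n%:R^-1 * (\sum_(a < m) p * q a) - 2 * c * (n%:R^-1 * \tr D))).
Proof.
set G := resolvent (sum_mx w) z; set tD := n%:R^-1 * \tr D.
have nC : n%:R != 0 :> R[i] by rewrite pnatr_eq0 -lt0n (loop_n hyps).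
have e2 : real_complex R (\tr D) + z * \tr (G *m toC D) = \sum_(a < m) (xi a w)%:R * h a w.
  transitivity (\tr (toC D *m (toC (sum_mx w) *m G))).
    rewrite resolvent_mul ?sum_mx_sym// mulmxDr mulmx1 -scalemxAr.
    by rewrite mxtraceD mxtraceZ tr_toC (mxtrace_mulC G).
  rewrite {1}/sum_mx raddf_sum mulmx_suml mulmx_sumr raddf_sum/=.
  apply: eq_bigr => a _.
  have -> : toC ((xi a w)%:R *: (x a w *m (y a w)^T + y a w *m (x a w)^T)) =
     (xi a w)%:R *: (toC (x a w *m (y a w)^T) + toC (y a w *m (x a w)^T)).
    by rewrite map_mxZ map_mxD rmorph_nat.
  rewrite -scalemxAl -scalemxAr mxtraceZ mulmxDl mulmxDr mxtraceD !tr_rank1.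
  (* Either the summand vanishes, or the full matrix is [sum_mx_with a]. *)
  case xia : (xi a w); last by rewrite !mul0r.
  by rewrite /G (sum_mxE a) xia.
have e3 : real_complex R tD + z * (n%:R^-1 * \tr (G *m toC D)) =
    n%:R^-1 * \sum_(a < m) (xi a w)%:R * h a w.
  by rewrite -e2 /tD rmorphM fmorphV rmorph_nat; ring.
rewrite e3.
have -> : \sum_(a < m) (xi a w)%:R * r a w =
   (\sum_(a < m) (xi a w)%:R * h a w) * (1 - f ^+ 2) +
   f ^+ 2 * real_complex R (\sum_(a < m) (xi a w)%:R * q a).
  rewrite rmorph_sum mulr_suml mulr_sumr -big_split/=; apply: eq_bigr => a _.
  by rewrite /r rmorphM rmorph_nat; ring.
have -> : \sum_(a < m) ((xi a w)%:R - p) * q a =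
   \sum_(a < m) (xi a w)%:R * q a - \sum_(a < m) p * q a.
  by rewrite -sumrB; apply: eq_bigr => a _; ring.
rewrite /tD !(rmorphD, rmorphN, rmorphM, fmorphV, rmorph_nat)/=.
set s1 := \sum_(_ < m) _; set s2 := real_complex R (\sum_(_ < m) _).
by ring.
Qed.

Lemma loop_equation_dir : Ex P (fun w => cabs (
  (real_complex R (n%:R^-1 * \tr D) + z * (n%:R^-1 * \tr (resolvent (sum_mx w) z *m toC D))) *
    (1 - f ^+ 2) + 2 * f ^+ 2 * real_complex R c * real_complex R (n%:R^-1 * \tr D))) <=
  (c + 1) * S + F1 ^+ 2 * ((4 * k * (c + 1) + 2) * e).
Proof.
pose u w := n%:R^-1 * (\sum_(a < m) (xi a w)%:R * r a w) : R[i].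
pose v w := n%:R^-1 * (\sum_(a < m) ((xi a w)%:R - p) * q a).
pose v0 := n%:R^-1 * (\sum_(a < m) p * q a) - 2 * c * (n%:R^-1 * \tr D).
have bu a : bmf (fun w => (xi a w)%:R * cabs (r a w)) by apply: bmfM => //; exact: bmf_cabs.
have bU : bmf (fun w => n%:R^-1 * \sum_(a < m) (xi a w)%:R * cabs (r a w)).
  by apply: bmfM; [exact: bmf_cst|exact: bmf_sum].
have bv : bmf v.
  apply: bmfM; first exact: bmf_cst.
  by apply: bmf_sum => a; apply: bmfM; [apply: bmfB|]; rewrite //; exact: bmf_cst.
have b2 : bmf (fun w => `|v w| + `|v0|).
  by apply: bmfD; [exact: bmf_norm|exact: bmf_cst].
have hu : Ex P (fun w => n%:R^-1 * \sum_(a < m) (xi a w)%:R * cabs (r a w)) <= (c + 1) * S.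
  rewrite ExZ ?Ex_sum//; last exact: bmf_sum.
  rewrite (eq_bigr (fun a => p * Ex P (fun w => cabs (r a w)))); last first.
    move=> a _; rewrite (Ex_gindep (F := gens (inl a)) (G := other_systems (inl a))) ?Exi//.
    - by rewrite -coord_gens; exact: coord_indep.
    - exact: gens_xi.
    - exact: bmf_cabs.
  have S0 : 0 <= S.
    rewrite -(pmulr_rge0 _ m0); apply: le_trans sum_r; apply: sumr_ge0 => a _.
    by apply: Ex_ge0 => w; exact: cabs_ge0.
  rewrite -mulr_sumr ler_pdivrMl//.
  apply: (@le_trans _ _ (p * (m%:R * S))); first by apply: ler_wpM2l => //; exact: sum_r.
  by rewrite !mulrA (mulrC p); apply: ler_wpM2r => //; exact: mp_le.
have hv : Ex P (fun w => `|v w| + `|v0|) <= (4 * k * (c + 1) + 2) * e.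
  rewrite ExD ?Ex_cst; [|exact: bmf_norm|exact: bmf_cst].
  apply: le_trans (lerD xi_fluct q_avg) _.
  by rewrite le_eqVlt; apply/orP; left; apply/eqP; ring.
apply: (@le_trans _ _ (Ex P (fun w => n%:R^-1 * \sum_(a < m) (xi a w)%:R * cabs (r a w) +
    F1 ^+ 2 * (`|v w| + `|v0|)))).
  have bF : bmf (fun w => F1 ^+ 2 * (`|v w| + `|v0|)).
    by apply: bmfM => //; exact: bmf_cst.
  apply: Ex_le => [||w]; [|exact: bmfD|].
    apply: bmf_cabs; apply: cbmfD; last exact: cbmf_cst.
    apply: cbmfM; last exact: cbmf_cst.
    apply: cbmfD; first exact: cbmf_cst.
    apply: cbmfM; first exact: cbmf_cst.
    apply: cbmfM; first exact: cbmf_cst.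
    apply: (resD_cbmf (K := 1)) => //; [exact: sum_mx_sym|exact: sum_mx_meas|exact: toC_opb].
  rewrite loop_identity; apply: le_trans (cabsB _ _) _; apply: lerD.
    rewrite cabsM; apply: ler_pM; rewrite ?cabs_ge0//.
      by rewrite cabsV -(rmorph_nat (real_complex R)) cabs_real normr_nat.
    apply: le_trans (cabs_sum _ _ _) _; apply: ler_sum => a _; rewrite cabsM.
    by rewrite -(rmorph_nat (real_complex R)) cabs_real normr_nat.
  rewrite cabsM cabs_real cabsX; apply: ler_pM => //.
  - by rewrite exprn_ge0// cabs_ge0.
  - by rewrite ler_pXn2r// nnegrE cabs_ge0.
  - exact: ler_normD.
rewrite ExD//; last by apply: bmfM => //; exact: bmf_cst.
by apply: lerD => //; rewrite ExZ//; apply: ler_wpM2l => //; exact: sqr_ge0.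
Qed.

End Direction.
End Deviation.
End Proofs.
End LoopEquation.

(** * Asymptotics of normalized traces *)

Section LoopRate.
Context {R : realType}.
Local Notation toC := (map_mx (real_complex R)).

(** The coefficient of [delta] in the loop equation, all the rest being a multiple of [e]. It stays
    bounded as eta grows, whereas the factor z (1 - f^2) it competes with does not. *)
Definition loop_rate (C0 k c eta F1 : R) : R :=
  (c + 1) * (2 * k * (C0 / eta + F1) * (C0 / eta + 1)).

(** [K2] is fixed before n, the probability space and f, which makes the bound uniform along the
    sequence. *)
Lemma loop_equation (C0 k c F1 : R) (z : R[i]) : 0 < complex.Im z ->
  exists K2 : R, forall (d : measure_display) (T : measurableType d)
    (P : probability T R) (n m : nat) (xi : 'I_m -> T -> bool)
    (x y : 'I_m -> T -> 'cV[R]_n) (e p delta : R) (f : R[i]),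
  loop_hyps P xi x y C0 k c e p -> cabs f <= F1 ->
  (forall D, opb D 1 -> Ex P (fun w => cabs (tr_dev xi x y z f D w)) <= delta) ->
  forall D, opb D 1 -> Ex P (fun w => cabs (
    (real_complex R (n%:R^-1 * \tr D) +
       z * (n%:R^-1 * \tr (resolvent (sum_mx xi x y w) z *m toC D))) *
     (1 - f ^+ 2) + 2 * f ^+ 2 * real_complex R c * real_complex R (n%:R^-1 * \tr D))) <=
  loop_rate C0 k c (complex.Im z) F1 * delta + K2 * e.
Proof.
move=> z0; set eta := complex.Im z.
pose K := 2 / eta + 2 * k * C0 / eta ^+ 2; pose B := C0 / eta.
exists ((c + 1) * (2 * B * ((B + F1) * (K + F1) + (2 + B) * (K + eta^-1)) +
  (1 + B) * (2 * (K + eta^-1)) + 2 * (B + F1) * (K + F1)) +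
  F1 ^+ 2 * (4 * k * (c + 1) + 2)).
move=> d T P n m xi x y e p delta f hyps hf hdelta D hD.
apply: le_trans (loop_equation_dir hyps z0 hf hdelta hD) _.
rewrite -/eta -/K -/B /loop_rate -/B; move: K B (eta^-1) => K B ei.
by rewrite le_eqVlt; apply/orP; left; apply/eqP; ring.
Qed.

End LoopRate.

(** * Interpolation of the resolvent in the spectral parameter *)

Section Interpolation.
Context {R : realType}.
Local Notation C := R[i].

(* The resolvent at [z] is a combination of resolvents at the nodes [w j], up to
   the Cauchy-kernel interpolation error
   [(prod_j (z - w j) G(w j)) G(z)], where G is the resolvent. *)
Lemma resolvent_interpolation (z : C) (w : nat -> C) (rho : R) :
  0 < complex.Im z -> (forall j, 0 < complex.Im (w j)) -> injective w ->
  (forall j, cabs (z - w j) <= rho * complex.Im (w j)) ->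
  forall N, exists l : nat -> C, forall n (A : 'M[R]_n), A^T = A ->
    copb (resolvent A z - \sum_(j < N) l j *: resolvent A (w j))
      (rho ^+ N / complex.Im z).
Proof.
move=> z0 w0 winj hrho.
have rho0 : 0 <= rho.
  by rewrite -(pmulr_lge0 _ (w0 0)); exact: le_trans (cabs_ge0 _) (hrho 0).
have nz0 : complex.Im z != 0 by rewrite gt_eqF.
have nw0 j : complex.Im (w j) != 0 by rewrite gt_eqF.
elim=> [|N [l hl]].
  exists (fun=> 0) => n A sA; rewrite big_ord0 subr0 expr0 mul1r.
  by rewrite -(gtr0_norm z0); exact: resolvent_copb.
(* The new error is the old one times (z - w N) G(w N). The resolvent identity splits each product
   G(w j) G(w N), which gives [l'], and G(w N) collects the remaining coefficient 1 - sum l'. *)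
pose l' j := l j * (z - w N) / (w j - w N).
exists (fun j => if (j < N)%N then l' j else 1 - \sum_(i < N) l' i) => n A sA.
have -> : resolvent A z - \sum_(j < N.+1)
    (if (j < N)%N then l' j else 1 - \sum_(i < N) l' i) *: resolvent A (w j) =
  (z - w N) *: ((resolvent A z - \sum_(j < N) l j *: resolvent A (w j)) *m
    resolvent A (w N)).
  rewrite mulmxBl scalerBr -resolvent_identity// mulmx_suml scaler_sumr.
  rewrite big_ord_recr/= ltnn scalerBl scale1r scaler_suml.
  have -> : \sum_(i < N) (if (i < N)%N then l' i else 1 - \sum_(j < N) l' j) *:
      resolvent A (w i) = \sum_(i < N) l' i *: resolvent A (w i).
    by apply: eq_bigr => i _; rewrite ltn_ord.
  have -> : \sum_(i < N) (z - w N) *: (l i *: resolvent A (w i) *m resolvent A (w N)) =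
      \sum_(i < N) l' i *: resolvent A (w i) - \sum_(i < N) l' i *: resolvent A (w N).
    rewrite -sumrB; apply: eq_bigr => i _.
    rewrite -scalerBr resolvent_identity// -scalemxAl !scalerA; congr (_ *: _).
    have wiN : w i - w N != 0.
      rewrite subr_eq0; apply/eqP => /winj iN.
      by have := ltn_ord i; rewrite iN ltnn.
    by rewrite /l' mulfVK// mulrC.
  by rewrite !opprD !opprK -!addrA; congr (_ + _); rewrite addrCA.
have h := copbZ (z - w N) (copbM (hl n A sA) (resolvent_copb sA (nw0 N))).
apply: copb_le h.
  by rewrite !mulr_ge0 ?cabs_ge0 ?exprn_ge0 ?invr_ge0// ltW.
rewrite gtr0_norm// exprSr mulrCA [leRHS]mulrAC; apply: ler_wpM2l.
  by rewrite mulr_ge0 ?exprn_ge0 ?invr_ge0// ltW.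
by rewrite ler_pdivrMr.
Qed.

End Interpolation.

Section Asymptotics.
Context {R : realType}.
Variables (m : nat -> nat) (d : nat -> measure_display)
  (T : forall n, measurableType (d n)) (P : forall n, probability (T n) R)
  (xi : forall n, 'I_(m n) -> T n -> bool)
  (x y : forall n, 'I_(m n) -> T n -> 'cV[R]_n) (p : nat -> R) (C0 k c : R).
Local Notation toC := (map_mx (real_complex R)).
Hypothesis hyps : forall e : R, 0 < e <= 1 -> \forall n \near \oo,
  loop_hyps (P n) (@xi n) (@x n) (@y n) C0 k c e (p n).

Let near0 : \forall n \near \oo, loop_hyps (P n) (@xi n) (@x n) (@y n) C0 k c 1 (p n).
Proof. by apply: hyps; rewrite ltr01 lexx. Qed.

Lemma loop_consts : [/\ 0 <= c, 1 <= k & 0 <= C0].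
Proof.
have [N _ h] := near0; have hN := h N (leqnn N).
by split; [exact: loop_c hN|exact: loop_k hN|exact: loop_C0 hN].
Qed.

Definition dev n (z f : R[i]) (D : 'M[R]_n) : R :=
  Ex (P n) (fun w => cabs (tr_dev (@xi n) (@x n) (@y n) z f D w)).

(** The quantifier over [D] stands inside the eventuality: the rank from which the bound holds does
    not depend on [D]. *)
Definition averaged_law (z f : R[i]) : Prop := forall e : R, 0 < e ->
  \forall n \near \oo, forall D : 'M[R]_n, opb D 1 -> dev z f D <= e.

Section FixedDimension.
Variables (n : nat) (e : R).
Hypothesis hn : loop_hyps (P n) (@xi n) (@x n) (@y n) C0 k c e (p n).
Variable z : R[i].
Hypothesis z0 : 0 < complex.Im z.

Lemma dev_bmf (f : R[i]) (D : 'M[R]_n) : opb D 1 ->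
  cbmf (tr_dev (@xi n) (@x n) (@y n) z f D).
Proof.
move=> hD; apply: cbmfB; last exact: cbmf_cst.
apply: cbmfM; first exact: cbmf_cst.
apply: (resD_cbmf z0 ler01); [exact: sum_mx_sym| |exact: toC_opb].
exact: sum_mx_meas hn.
Qed.

Lemma ninv_tr (M : 'M[R[i]]_n) K : 0 <= K -> copb M K -> cabs (n%:R^-1 * \tr M) <= K.
Proof.
move=> K0 hM; have n0 : 0 < n%:R :> R by rewrite ltr0n (loop_n hn).
rewrite cabsM cabsV -(rmorph_nat (real_complex R)) cabs_real normr_nat.
by rewrite ler_pdivrMl//; exact: copb_tr.
Qed.

Lemma cabs_ninv_trD (D : 'M[R]_n) : opb D 1 ->
  cabs (real_complex R (n%:R^-1 * \tr D)) <= 1.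
Proof.
move=> hD.
have -> : real_complex R (n%:R^-1 * \tr D) = n%:R^-1 * \tr (toC D).
  by rewrite tr_toC rmorphM fmorphV rmorph_nat.
exact: ninv_tr ler01 (toC_opb hD).
Qed.

Lemma dev_le (f : R[i]) (D : 'M[R]_n) : opb D 1 -> dev z f D <= (complex.Im z)^-1 + cabs f.
Proof.
move=> hD; rewrite -[leRHS](Ex_cst (P n)); apply: Ex_le => [||w].
- by apply: bmf_cabs; exact: dev_bmf.
- exact: bmf_cst.
- apply: le_trans (cabsB _ _) _; apply: lerD.
    apply: ninv_tr; first by rewrite invr_ge0 ltW.
    by rewrite -[_^-1]mulr1; apply: copbM (toC_opb hD);
      rewrite -(gtr0_norm z0); apply: resolvent_copb; [exact: sum_mx_sym|rewrite gt_eqF].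
  rewrite cabsM -[leRHS]mulr1; apply: ler_wpM2l; first exact: cabs_ge0.
  exact: cabs_ninv_trD.
Qed.

Lemma dev_change (f g : R[i]) (D : 'M[R]_n) : opb D 1 ->
  dev z f D <= dev z g D + cabs (f - g).
Proof.
move=> hD; rewrite -(Ex_cst (P n) (cabs (f - g))) -ExD; last 2 first.
- by apply: bmf_cabs; exact: dev_bmf.
- exact: bmf_cst.
apply: Ex_le => [||w].
- by apply: bmf_cabs; exact: dev_bmf.
- by apply: bmfD; [by apply: bmf_cabs; exact: dev_bmf|exact: bmf_cst].
rewrite (_ : tr_dev _ _ _ z f D w = tr_dev (@xi n) (@x n) (@y n) z g D w -
   (f - g) * real_complex R (n%:R^-1 * \tr D)); last by rewrite /tr_dev; ring.
apply: le_trans (cabsB _ _) _; rewrite lerD2l cabsM -[leRHS]mulr1.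
by apply: ler_wpM2l; [exact: cabs_ge0|exact: cabs_ninv_trD].
Qed.

Lemma dev_unique (f g : R[i]) : cabs (f - g) <= dev z f (1%:M : 'M[R]_n) + dev z g (1%:M : 'M[R]_n).
Proof.
have o1 := @opb1 R n; rewrite -(Ex_cst (P n) (cabs (f - g))) -ExD; last 2 first.
- by apply: bmf_cabs; exact: dev_bmf.
- by apply: bmf_cabs; exact: dev_bmf.
apply: Ex_le => [||w]; first exact: bmf_cst.
  by apply: bmfD; apply: bmf_cabs; exact: dev_bmf.
have nn : n%:R != 0 :> R by rewrite pnatr_eq0 -lt0n (loop_n hn).
have -> : f - g = tr_dev (@xi n) (@x n) (@y n) z g 1%:M w -
    tr_dev (@xi n) (@x n) (@y n) z f 1%:M w.
  by rewrite /tr_dev mxtrace1 mulVf// rmorph1; ring.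
by rewrite [leRHS]addrC; exact: cabsB.
Qed.

End FixedDimension.

Lemma loop_rate_le (z : R[i]) (F1 : R) : 0 <= F1 <= 2^-1 ->
  0 < complex.Im z -> C0 <= complex.Im z ->
  loop_rate C0 k c (complex.Im z) F1 <= 6 * k * (c + 1).
Proof.
have [c0 k1 C00] := loop_consts; move=> /andP[F0 F2] z0 Cz.
have hB : 0 <= C0 / complex.Im z <= 1.
  apply/andP; split; first by rewrite divr_ge0// ltW.
  by rewrite ler_pdivrMr// mul1r.
rewrite /loop_rate; move: (C0 / complex.Im z) hB => B /andP[B0 B1].
have h1 : (B + F1) * (B + 1) <= 3.
  have : (B + F1) * (B + 1) <= (3 / 2) * 2 by apply: ler_pM; lra.
  by lra.
have kc : 0 <= 2 * k * (c + 1) by rewrite !mulr_ge0//; lra.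
by have := ler_wpM2l kc h1; lra.
Qed.

(** Divided by z the cubic is monic with product of roots 1/z, of modulus at most 1/8; so one of the
    three roots has modulus at most 1/2. *)
Lemma cubic_small_root (z : R[i]) : 8 <= cabs z -> exists f : R[i],
  z * f ^+ 3 + (1 - 2 * real_complex R c) * f ^+ 2 - z * f - 1 = 0 /\ cabs f <= 2^-1.
Proof.
move=> hz; have zn : z != 0.
  by rewrite -cabs_gt0; apply: lt_le_trans hz.
pose q : {poly R[i]} := Poly [:: - z^-1; -1; (1 - 2 * real_complex R c) / z; 1].
have q3 : q = [:: - z^-1; -1; (1 - 2 * real_complex R c) / z; 1] :> seq _.
  by rewrite (@PolyK _ 0)//= oner_eq0.
have qm : q \is monic by rewrite monicE lead_coefE q3.
have [r hr] := closed_field_poly_normal q.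
move: hr; rewrite (monicP qm) scale1r => hr.
have sr : size r = 3%N.
  by have : size q = 4%N by [rewrite q3]; rewrite hr size_prod_XsubC => -[].
have [f fr fs] : exists2 f, f \in r & cabs f <= 2^-1.
  apply: contrapT => hno.
  have hbig f : f \in r -> 2^-1 < cabs f.
    by move=> fr; rewrite ltNge; apply/negP => fs; apply: hno; exists f.
  have : cabs (\prod_(f <- r) f) = (cabs z)^-1.
    have := congr1 (horner^~ 0) hr; rewrite /q horner_Poly/= !(mul0r, mulr0, add0r).
    rewrite horner_prod; under eq_bigr do rewrite hornerXsubC sub0r.
    move: sr; case: r {hr hno hbig} => [|r1 [|r2 [|r3 [|]]]]// _.
    rewrite !big_cons !big_nil !mulr1 => h; rewrite -cabsV -(cabsN z^-1) h.
    by rewrite -[LHS]cabsN; congr cabs; ring.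
  move: sr hbig; case: r {hr hno} => [|r1 [|r2 [|r3 [|]]]]// _ hbig.
  rewrite !big_cons big_nil mulr1 !cabsM => h.
  have h1 := hbig r1; have h2 := hbig r2; have h3 := hbig r3.
  rewrite !inE !eqxx ?orbT in h1 h2 h3.
  have {}h1 := h1 isT; have {}h2 := h2 isT; have {}h3 := h3 isT.
  have hzi : (cabs z)^-1 <= 8^-1 by rewrite lef_pV2 ?posrE// (lt_le_trans _ hz).
  have : 2^-1 * (2^-1 * 2^-1) < cabs r1 * (cabs r2 * cabs r3).
    by apply: ltr_pM => //; apply: ltr_pM.
  by rewrite h => /lt_le_trans/(_ hzi); rewrite ltNge; case/negP; lra.
exists f; split => //.
have : q.[f] = 0 by apply/eqP; rewrite hr -[_ == 0]/(root _ f) root_prod_XsubC.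
rewrite /q horner_Poly/= mul0r add0r => /(congr1 (fun u => z * u)); rewrite mulr0 => <-.
by field.
Qed.

(* For large Im z the loop equation contracts the deviations towards the small
   root of the cubic. *)
Lemma averaged_law_large : exists eta0 : R, 0 < eta0 /\
  forall z : R[i], eta0 <= complex.Im z -> exists f, averaged_law z f.
Proof.
have [c0 k1 C00] := loop_consts.
have kc1 : 1 <= k * (c + 1) by rewrite -[leLHS]mulr1 ler_pM//; lra.
(* 8 provides the small root and [C0] makes C0 / Im z at most 1, so that the rate is at most 6 k (c
   + 1). The last term gives |z (1 - f^2)| >= 16 k (c + 1) * 3/4 = 12 k (c + 1), twice that rate. *)
pose eta0 := 8 + C0 + 16 * (k * (c + 1)).
exists eta0; split; first by rewrite /eta0; lra.
move=> z hz; set eta := complex.Im z.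
have e0 : 0 < eta by apply: lt_le_trans hz; rewrite /eta0; lra.
have etaz : eta <= cabs z by apply: le_trans (ler_norm _) (Im_le_cabs z).
have [|f [hf fs]] := @cubic_small_root z.
  by apply: le_trans etaz; apply: le_trans hz; rewrite /eta0; lra.
have [K2 hK2] := loop_equation C0 k c 2^-1 e0.
have rate_le : loop_rate C0 k c eta 2^-1 <= 6 * (k * (c + 1)).
  rewrite mulrA; apply: loop_rate_le => //; first by rewrite lexx andbT invr_ge0.
  by apply: le_trans hz; rewrite /eta0; lra.
have f2 : 3 / 4 <= cabs (1 - f ^+ 2).
  have : cabs 1 <= cabs (1 - f ^+ 2) + cabs (f ^+ 2).
    by apply: le_trans (cabsD _ _); rewrite subrK.
  rewrite cabs1 cabsX.
  have : cabs f ^+ 2 <= 2^-1 ^+ 2 by rewrite ler_pXn2r// nnegrE ?cabs_ge0// invr_ge0.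
  by rewrite expr2; lra.
exists f => e ep.
pose K3 := `|K2| + 1; have K30 : 0 < K3 by rewrite ltr_wpDl.
pose e' := Num.min 1 (e / K3).
have e'0 : 0 < e' <= 1 by rewrite lt_min ltr01 divr_gt0//= ge_min lexx.
have e'K : K2 * e' <= e.
  apply: le_trans (ler_wpM2r (ltW (andP e'0).1) (ler_norm K2)) _.
  apply: (@le_trans _ _ (K3 * (e / K3))); last by rewrite mulrCA divff ?mulr1// gt_eqF.
  apply: ler_pM => //; first by rewrite ltW//; case/andP: e'0.
    by rewrite lerDl.
  by rewrite ge_min lexx orbT.
near=> n => D hD.
have hn : loop_hyps (P n) (@xi n) (@x n) (@y n) C0 k c e' (p n).
  by near: n; exact: hyps.
(* The supremum of the deviations serves as [delta] in the loop equation. Being finite, it is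
   bounded by e / 6 through 12 sup <= 6 sup + e. *)
pose S : set R := [set dev z f D | D in [set D : 'M[R]_n | opb D 1]].
have hS : has_sup S.
  split; first by exists (dev z f (1%:M : 'M[R]_n)), 1%:M => //; exact: opb1.
  by exists (eta^-1 + cabs f) => _ [D' hD' <-]; exact: (dev_le hn).
have Sub (D' : 'M[R]_n) : opb D' 1 -> dev z f D' <= sup S.
  by move=> hD'; apply: sup_upper_bound => //; exists D'.
have main (D' : 'M[R]_n) : opb D' 1 -> 12 * dev z f D' <= 6 * sup S + e.
  move=> hD'.
  have := hK2 _ _ _ _ _ _ _ _ e' _ (sup S) f hn fs Sub D' hD'.
  (* As f solves the cubic, the deterministic part cancels and the left side of the loop equation is
     exactly z (1 - f^2) times the deviation. *)
  rewrite (_ : (fun w => cabs _) = fun w => cabs (z * (1 - f ^+ 2)) *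
      cabs (tr_dev (@xi n) (@x n) (@y n) z f D' w)); last first.
    apply/funext => w; rewrite -cabsM; congr cabs.
    rewrite /tr_dev; set t := n%:R^-1 * \tr _; set dd := real_complex R (_ * _).
    apply/eqP; rewrite -subr_eq0; apply/eqP.
    transitivity (- dd * (z * f ^+ 3 + (1 - 2 * real_complex R c) * f ^+ 2 - z * f - 1)).
      by ring.
    by rewrite hf mulr0.
  rewrite ExZ; last by apply: bmf_cabs; exact: (dev_bmf hn).
  rewrite -/(dev z f D') => h.
  have S0 : 0 <= sup S.
    by apply: le_trans (Sub _ hD'); apply: Ex_ge0 => w; exact: cabs_ge0.
  have dev0 : 0 <= dev z f D' by apply: Ex_ge0 => w; exact: cabs_ge0.
  have zf : 12 * (k * (c + 1)) <= cabs (z * (1 - f ^+ 2)).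
    rewrite cabsM; apply: (@le_trans _ _ (16 * (k * (c + 1)) * (3 / 4))); first by lra.
    apply: ler_pM; [lra|lra| |exact: f2]; apply: le_trans etaz; apply: le_trans hz.
    by rewrite /eta0; lra.
  have h1 : 12 * (k * (c + 1)) * dev z f D' <= 6 * (k * (c + 1)) * sup S + e.
    apply: le_trans (ler_wpM2r dev0 zf) _; apply: le_trans h _.
    by apply: lerD => //; exact: ler_wpM2r.
  have kc0 : 0 < k * (c + 1) by lra.
  rewrite -(ler_pM2l kc0).
  have -> : k * (c + 1) * (12 * dev z f D') = 12 * (k * (c + 1)) * dev z f D' by ring.
  apply: le_trans h1 _.
  have -> : k * (c + 1) * (6 * sup S + e) = 6 * (k * (c + 1)) * sup S + k * (c + 1) * e.
    by ring.
  by rewrite lerD2l ler_peMl// ltW.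
have supS : sup S <= (6 * sup S + e) / 12.
  apply: ge_sup; first by case: hS.
  by move=> _ [D' hD' <-]; rewrite ler_pdivlMr// mulrC; exact: main.
apply: le_trans (Sub _ hD) _; rewrite ler_pdivlMr// in supS.
by move: (sup S) supS => s hs; lra.
Unshelve. all: by end_near.
Qed.

(** The limit is the supremum of the lower bounds u_j - 1/(j+1), each of which lies below every u_l
    + 1/(l+1). *)
Lemma cvg_harmonic_bound (u : nat -> R) :
  (forall j l, `|u j - u l| <= j.+1%:R^-1 + l.+1%:R^-1) ->
  exists v, forall l, `|u l - v| <= l.+1%:R^-1.
Proof.
move=> hu; pose S := [set u j - j.+1%:R^-1 | j in [set: nat]].
have ubS l : ubound S (u l + l.+1%:R^-1).
  move=> _ [j _ <-]; have := hu j l; rewrite ler_norml => /andP[_].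
  by move: (u j) (u l) (j.+1%:R^-1) (l.+1%:R^-1) => a b a' b' hjl; lra.
have hS : has_sup S.
  by split; [exists (u 0%N - 1%:R^-1), 0%N|exists (u 0%N + 1%:R^-1); exact: ubS].
exists (sup S) => l; rewrite ler_norml.
have h1 : u l - l.+1%:R^-1 <= sup S by apply: sup_upper_bound => //; exists l.
have h2 : sup S <= u l + l.+1%:R^-1 by apply: ge_sup; [case: hS|exact: ubS].
by move: (sup S) (u l) (l.+1%:R^-1) h1 h2 => a b a' h1 h2; apply/andP; split; lra.
Qed.

(** Constants that describe the same traces up to small errors are close to one another by
    [dev_unique]; the constants obtained for the errors 1/(j+1) thus have a limit. *)
Lemma averaged_law_limit (z : R[i]) : 0 < complex.Im z ->
  (forall e : R, 0 < e -> exists g, \forall n \near \oo,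
    forall D : 'M[R]_n, opb D 1 -> dev z g D <= e) ->
  exists f, averaged_law z f.
Proof.
move=> z0 hg.
have hj (j : nat) : exists g, \forall n \near \oo,
    forall D : 'M[R]_n, opb D 1 -> dev z g D <= j.+1%:R^-1.
  by apply: hg; rewrite invr_gt0.
have [g {}hg'] := choice hj.
have cauchy j l : cabs (g j - g l) <= j.+1%:R^-1 + l.+1%:R^-1.
  near \oo => n.
  have hn : loop_hyps (P n) (@xi n) (@x n) (@y n) C0 k c 1 (p n) by near: n.
  apply: le_trans (dev_unique hn z0 (g j) (g l)) _; apply: lerD.
    by have : forall D : 'M[R]_n, opb D 1 -> dev z (g j) D <= j.+1%:R^-1;
      [near: n; exact: hg'|apply; exact: opb1].
  by have : forall D : 'M[R]_n, opb D 1 -> dev z (g l) D <= l.+1%:R^-1;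
    [near: n; exact: hg'|apply; exact: opb1].
have [a ha] := @cvg_harmonic_bound (fun j => complex.Re (g j)) (fun j l =>
  le_trans (eq_ind _ (fun r => `|r| <= cabs (g j - g l)) (Re_le_cabs (g j - g l)) _
     (etrans (cReD _ _) (congr1 _ (cReN _)))) (cauchy j l)).
have [b hb] := @cvg_harmonic_bound (fun j => complex.Im (g j)) (fun j l =>
  le_trans (eq_ind _ (fun r => `|r| <= cabs (g j - g l)) (Im_le_cabs (g j - g l)) _
     (etrans (cImD _ _) (congr1 _ (cImN _)))) (cauchy j l)).
exists (Complex a b) => e e0.
(* Three errors of size 1/(j+1) occur: one deviation and the two coordinates of the limit. *)
pose j := Num.truncn (3 / e).
have je : j.+1%:R^-1 <= e / 3.
  rewrite -[e / 3]invrK invf_div lef_pV2 ?posrE ?divr_gt0//.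
  by rewrite ltW// truncnS_gt.
near=> n => D hD.
have hn : loop_hyps (P n) (@xi n) (@x n) (@y n) C0 k c 1 (p n) by near: n.
apply: le_trans (dev_change hn z0 _ (g j) hD) _.
have h1 : dev z (g j) D <= j.+1%:R^-1.
  have : forall D : 'M[R]_n, opb D 1 -> dev z (g j) D <= j.+1%:R^-1; last exact.
  by near: n; exact: hg'.
have h2 : cabs (Complex a b - g j) <= j.+1%:R^-1 + j.+1%:R^-1.
  apply: le_trans (cabs_le_ReIm _) _; rewrite cReD cImD cReN cImN /=.
  by apply: lerD; rewrite distrC.
apply: le_trans (lerD h1 h2) _.
by move: (j.+1%:R^-1) je => s hs; lra.
Unshelve. all: by end_near.
Qed.

Lemma averaged_law_upper (z : R[i]) : 0 < complex.Im z -> exists f, averaged_law z f.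
Proof.
move=> z0; have [eta0 [eta00 hlarge]] := averaged_law_large.
have [zl|zs] := leP eta0 (complex.Im z); first exact: hlarge.
set b := complex.Im z; apply: averaged_law_limit => // e e0.
(* Infinitely many distinct nodes straight above z, with heights between eta0, where the law is
   known, and 2 eta0. *)
pose w (j : nat) : R[i] := Complex (complex.Re z) (eta0 * (2 - j.+1%:R^-1)).
have jle (j : nat) : j.+1%:R^-1 <= 1 :> R by rewrite invf_le1 ?ler1n.
have jgt (j : nat) : 0 < j.+1%:R^-1 :> R by rewrite invr_gt0.
have weta j : eta0 <= complex.Im (w j).
  apply: ler_peMr; first exact: ltW.
  by move: (j.+1%:R^-1) (jle j) => s hs; lra.
have weta2 j : complex.Im (w j) <= 2 * eta0.
  by rewrite /= mulrC ler_pM2r//; move: (j.+1%:R^-1) (jgt j) => s hs; lra.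
have w0 j : 0 < complex.Im (w j) by exact: lt_le_trans (weta j).
(* The distance from z to a node is its height minus b, and b >= (b / (2 eta0)) times the height
   because heights do not exceed 2 eta0. *)
pose rho := 1 - b / (2 * eta0).
have rho1 : rho < 1 by rewrite /rho gtrBl divr_gt0// mulr_gt0.
have rho0 : 0 <= rho.
  by rewrite /rho subr_ge0 ler_pdivrMr ?mulr_gt0// mul1r; rewrite -/b in zs; lra.
have winj : injective w.
  move=> i j [] /(mulfI (lt0r_neq0 eta00)) /addrI /oppr_inj /invr_inj /eqP.
  by rewrite eqr_nat => /eqP[].
have hrho j : cabs (z - w j) <= rho * complex.Im (w j).
  have -> : cabs (z - w j) = complex.Im (w j) - b.
    rewrite cabsE cReD cReN cImD cImN /= subrr expr0n add0r sqrtr_sqr distrC ger0_norm//.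
    by rewrite subr_ge0; apply: le_trans (ltW zs) (weta j).
  rewrite /rho mulrBl mul1r lerD2l lerN2 mulrAC ler_pdivrMr ?mulr_gt0//.
  by rewrite ler_pM2l//; exact: weta2.
have [f hf] := choice (fun j => hlarge (w j) (weta j)).
have [N hN] : exists N, rho ^+ N / b <= e / 2.
  have eb : 0 < e / 2 * b by rewrite mulr_gt0// divr_gt0.
  have [N _ hN] : \forall N \near \oo, `|rho ^+ N| < e / 2 * b.
    have : rho ^+ n @[n --> \oo] --> 0 by apply: cvg_expr; rewrite ger0_norm.
    by move=> /cvgr0_norm_lt; apply.
  exists N; rewrite ler_pdivrMr//; apply: le_trans (ltW (hN N (leqnn N))).
  exact: ler_norm.
have [l hl] := resolvent_interpolation z0 w0 winj hrho N.
pose L := \sum_(j < N) cabs (l j) + 1.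
have L0 : 0 < L by rewrite ltr_wpDl// sumr_ge0// => j _; exact: cabs_ge0.
exists (\sum_(j < N) l j * f j).
have hall : \forall n \near \oo, forall j : 'I_N, forall D : 'M[R]_n, opb D 1 ->
    dev (w j) (f j) D <= e / 2 / L.
  by apply: filter_forall => j; apply: hf; rewrite !divr_gt0.
near=> n => D hD.
have hn : loop_hyps (P n) (@xi n) (@x n) (@y n) C0 k c 1 (p n) by near: n.
have hw : forall j : 'I_N, forall D : 'M[R]_n, opb D 1 -> dev (w j) (f j) D <= e / 2 / L.
  by near: n.
have bw (j : 'I_N) : bmf (fun u => cabs (l j) *
    cabs (tr_dev (@xi n) (@x n) (@y n) (w j) (f j) D u)).
  by apply: bmfM; [exact: bmf_cst|apply: bmf_cabs; exact: (dev_bmf hn)].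
have bs := bmf_sum (index_enum 'I_N) xpredT bw.
apply: (@le_trans _ _ (Ex (P n) (fun u => e / 2 + \sum_(j < N) cabs (l j) *
    cabs (tr_dev (@xi n) (@x n) (@y n) (w j) (f j) D u)))).
  apply: Ex_le => [||u].
  - by apply: bmf_cabs; exact: (dev_bmf hn).
  - by apply: bmfD => //; exact: bmf_cst.
  pose A := sum_mx (@xi n) (@x n) (@y n) u.
  have -> : tr_dev (@xi n) (@x n) (@y n) z (\sum_(j < N) l j * f j) D u =
    n%:R^-1 * \tr ((resolvent A z - \sum_(j < N) l j *: resolvent A (w j)) *m toC D) +
    \sum_(j < N) l j * tr_dev (@xi n) (@x n) (@y n) (w j) (f j) D u.
    rewrite mulmxBl raddfB/= mulrBr /tr_dev -/A mulmx_suml raddf_sum/= !mulr_sumr !mulr_suml.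
    rewrite -addrA; congr (_ + _).
    rewrite -!sumrN -big_split/=; apply: eq_bigr => j _.
    by rewrite -scalemxAl mxtraceZ; ring.
  apply: le_trans (cabsD _ _) _; apply: lerD.
    apply: le_trans hN; apply: (ninv_tr hn).
      by rewrite divr_ge0 ?exprn_ge0// ltW.
    rewrite -[_ / b]mulr1; apply: copbM (toC_opb hD).
    by apply: hl; exact: sum_mx_sym.
  apply: le_trans (cabs_sum _ _ _) _; apply: ler_sum => j _.
  by rewrite cabsM.
rewrite ExD ?Ex_cst//; last exact: bmf_cst.
rewrite [leRHS](splitr e) lerD2l Ex_sum//.
apply: (@le_trans _ _ (\sum_(j < N) cabs (l j) * (e / 2 / L))).
  apply: ler_sum => j _; rewrite ExZ; last by apply: bmf_cabs; exact: (dev_bmf hn).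
  by apply: ler_wpM2l; [exact: cabs_ge0|exact: hw].
rewrite -mulr_suml mulrCA ler_piMr//; first by rewrite divr_ge0// ltW.
by rewrite ler_pdivrMr// mul1r lerDl.
Unshelve. all: by end_near.
Qed.

Lemma averaged_law_cubic (z f : R[i]) : 0 < complex.Im z -> averaged_law z f ->
  z * f ^+ 3 + (1 - 2 * real_complex R c) * f ^+ 2 - z * f - 1 = 0.
Proof.
move=> z0 hf; have [K2 hK2] := loop_equation C0 k c (cabs f) z0.
set q := _ - 1; set rt := loop_rate C0 k c (complex.Im z) (cabs f) in hK2.
pose W := `|rt| + `|K2| + cabs (z * (1 - f ^+ 2)) + 1.
have W0 : 0 < W by rewrite ltr_wpDl// !addr_ge0// cabs_ge0.
apply/eqP; rewrite -cabs_eq0 eq_le cabs_ge0 andbT; apply/ler_addgt0Pr => e e0.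
rewrite add0r; pose e' := Num.min 1 (e / W).
have e'0 : 0 < e' <= 1 by rewrite lt_min ltr01 divr_gt0//= ge_min lexx.
have e'p : 0 < e' by case/andP: e'0.
near \oo => n.
have hn : loop_hyps (P n) (@xi n) (@x n) (@y n) C0 k c e' (p n).
  by near: n; exact: hyps.
have hD : forall D : 'M[R]_n, opb D 1 -> dev z f D <= e'.
  by near: n; exact: hf.
have o1 := @opb1 R n.
have h := hK2 _ _ _ _ _ _ _ _ e' _ e' f hn (lexx _) hD 1%:M o1.
have nn : n%:R != 0 :> R by rewrite pnatr_eq0 -lt0n (loop_n hn).
have b1 : bmf (fun w => cabs (tr_dev (@xi n) (@x n) (@y n) z f 1%:M w)).
  by apply: bmf_cabs; exact: (dev_bmf hn).
have b2 : cbmf (fun w => n%:R^-1 * \tr (resolvent (sum_mx (@xi n) (@x n) (@y n) w) z *m toC 1%:M)).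
  apply: cbmfM; first exact: cbmf_cst.
  apply: (resD_cbmf z0 ler01); [exact: sum_mx_sym|exact: (sum_mx_meas hn)|exact: toC_opb].
have b3 : bmf (fun w => cabs ((real_complex R (n%:R^-1 * \tr (1%:M : 'M[R]_n)) +
    z * (n%:R^-1 * \tr (resolvent (sum_mx (@xi n) (@x n) (@y n) w) z *m toC 1%:M))) * (1 - f ^+ 2) +
    2 * f ^+ 2 * real_complex R c * real_complex R (n%:R^-1 * \tr (1%:M : 'M[R]_n)))).
  apply: bmf_cabs; apply: cbmfD; last exact: cbmf_cst.
  apply: cbmfM; last exact: cbmf_cst.
  apply: cbmfD; first exact: cbmf_cst.
  by apply: cbmfM => //; exact: cbmf_cst.
have : cabs q <= rt * e' + K2 * e' + cabs (z * (1 - f ^+ 2)) * e'.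
  apply: le_trans (lerD h (ler_wpM2l (cabs_ge0 _) (hD _ o1))).
  rewrite -ExZ// -ExD//; last by apply: bmfM => //; exact: bmf_cst.
  rewrite -[leLHS](Ex_cst (P n)); apply: Ex_le => [||w]; first exact: bmf_cst.
    by apply: bmfD => //; apply: bmfM => //; exact: bmf_cst.
  rewrite -cabsM -(cabsN q); apply: le_trans (cabsB _ _).
  rewrite le_eqVlt; apply/orP; left; apply/eqP; congr cabs.
  by rewrite /q /tr_dev mxtrace1 mulVf// rmorph1; ring.
move=> /le_trans; apply; rewrite -!mulrDl.
apply: (@le_trans _ _ (W * (e / W))); last by rewrite mulrCA divff ?mulr1// gt_eqF.
apply: (@le_trans _ _ (W * e')); last first.
  by rewrite ler_pM2l// ge_min lexx orbT.
rewrite ler_pM2r//; have := ler_norm rt; have := ler_norm K2; rewrite /W.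
by move: (cabs (z * _)) => *; lra.
Unshelve. all: by end_near.
Qed.

End Asymptotics.

(** * Linear eigenvalue statistics *)

Section LinearStatistics.
Context {R : realType}.
Variables (d : nat -> measure_display)
  (T : forall n, measurableType (d n)) (P : forall n, probability (T n) R)
  (eig : forall n, T n -> seq R).
Hypothesis size_eig : forall n w, size (@eig n w) = n.
Implicit Types (phi psi : R -> R) (z : R[i]).

Definition linstat phi n (w : T n) : R := n%:R^-1 * \sum_(l <- eig w) phi l.

(* Convergence to a constant in L1, without naming the limit. *)
Definition self_averaging phi : Prop := [/\ exists B, forall t, `|phi t| <= B,
  forall n, measurable_fun setT (@linstat phi n) &
  forall e : R, 0 < e -> exists l : R, \forall n \near \oo,
    Ex (P n) (fun w => `|linstat phi w - l|) <= e].

Lemma linstat_le phi psi n (w : T n) : (forall t, phi t <= psi t) ->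
  linstat phi w <= linstat psi w.
Proof. by move=> h; apply: ler_wpM2l; [rewrite invr_ge0|apply: ler_sum]. Qed.

Lemma linstatD phi psi n (w : T n) :
  linstat (fun t => phi t + psi t) w = linstat phi w + linstat psi w.
Proof. by rewrite /linstat big_split mulrDr. Qed.

Lemma linstatZ a phi n (w : T n) : linstat (fun t => a * phi t) w = a * linstat phi w.
Proof. by rewrite /linstat -mulr_sumr mulrCA. Qed.

Lemma linstat_cst a n (w : T n) : (0 < n)%N -> linstat (fun=> a) w = a.
Proof.
move=> n0; rewrite /linstat big_const_seq count_predT size_eig.
rewrite iter_addr_0 -[a *+ n]mulr_natl mulrA mulVf ?mul1r//.
by rewrite pnatr_eq0 -lt0n.
Qed.

Lemma linstat_norm phi n (w : T n) : `|linstat phi w| <= linstat (fun t => `|phi t|) w.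
Proof.
rewrite /linstat normrM ger0_norm ?invr_ge0//; apply: ler_wpM2l; first by rewrite invr_ge0.
exact: ler_norm_sum.
Qed.

Lemma linstat_bound phi B n (w : T n) : 0 <= B -> (forall t, `|phi t| <= B) ->
  `|linstat phi w| <= B.
Proof.
(* At n = 0 the factor n^-1 is 0. *)
move=> B0 hB; case: (posnP n) => [n0|n0].
  by rewrite /linstat {1}n0 invr0 mul0r normr0.
apply: le_trans (linstat_norm _ _) _; rewrite -[leRHS](linstat_cst B w n0).
exact: linstat_le.
Qed.

Lemma linstat_bmf phi B n : (forall t, `|phi t| <= B) ->
  measurable_fun setT (@linstat phi n) -> bmf (@linstat phi n).
Proof.
move=> hB mphi; apply: (bmf_le (K := B)) => // w; apply: linstat_bound => //.
exact: le_trans (normr_ge0 _) (hB 0).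
Qed.

Lemma savg_bmf phi n : self_averaging phi -> bmf (@linstat phi n).
Proof. by move=> [[B hB] mphi _]; exact: linstat_bmf hB (mphi n). Qed.

Lemma savg_cst a : self_averaging (fun=> a).
Proof.
split; first by exists `|a|.
  move=> n; case: (posnP n) => [n0|n0].
    rewrite (_ : @linstat _ n = fun=> 0); first exact: measurable_cst.
    by apply/funext => w; rewrite /linstat {1}n0 invr0 mul0r.
  rewrite (_ : @linstat _ n = fun=> a); first exact: measurable_cst.
  by apply/funext => w; rewrite linstat_cst.
move=> e e0; exists a; exists 1%N => // n /= n0.
rewrite (@Ex_eq _ _ _ (P n) _ (fun=> 0)) ?Ex_cst ?ltW// => w.
by rewrite linstat_cst ?subrr ?normr0.
Qed.

Lemma savgD phi psi : self_averaging phi -> self_averaging psi -> self_averaging (fun t => phi t + psi t).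
Proof.
move=> cf cg; have [[B hB] mf lf] := cf; have [[B' hB'] mg lg] := cg; split.
- by exists (B + B') => t; exact: le_trans (ler_normD _ _) (lerD _ _).
- move=> n; rewrite (_ : @linstat _ n = fun w => linstat phi w + linstat psi w).
    exact: measurable_funD.
  by apply/funext => w; exact: linstatD.
- move=> e e0; have e2 : 0 < e / 2 by rewrite divr_gt0.
  have [l hl] := lf _ e2; have [l' hl'] := lg _ e2; exists (l + l').
  near=> n.
  have h : Ex (P n) (fun w => `|linstat phi w - l|) <= e / 2 by near: n.
  have h' : Ex (P n) (fun w => `|linstat psi w - l'|) <= e / 2 by near: n.
  rewrite (splitr e); apply: le_trans (lerD h h').
  have b1 : bmf (fun w : T n => `|linstat phi w - l|).
    by apply: bmf_norm; apply: bmfB; [exact: savg_bmf|exact: bmf_cst].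
  have b2 : bmf (fun w : T n => `|linstat psi w - l'|).
    by apply: bmf_norm; apply: bmfB; [exact: savg_bmf|exact: bmf_cst].
  rewrite -ExD//; apply: Ex_le => [||w]; last first.
  + by rewrite linstatD opprD addrACA; exact: ler_normD.
  + exact: bmfD.
  + apply: bmf_norm; apply: bmfB; last exact: bmf_cst.
    rewrite (_ : @linstat _ n = fun w => linstat phi w + linstat psi w).
      by apply: bmfD; exact: savg_bmf.
    by apply/funext => w; exact: linstatD.
Unshelve. all: by end_near.
Qed.

Lemma savgZ a phi : self_averaging phi -> self_averaging (fun t => a * phi t).
Proof.
move=> cf; have [[B hB] mf lf] := cf; split.
- by exists (`|a| * B) => t; rewrite normrM; apply: ler_wpM2l.
- move=> n; rewrite (_ : @linstat _ n = fun w => a * linstat phi w).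
    by apply: measurable_funM => //; exact: measurable_cst.
  by apply/funext => w; exact: linstatZ.
- move=> e e0; have ea : 0 < e / (`|a| + 1) by rewrite divr_gt0// ltr_wpDl.
  have [l hl] := lf _ ea; exists (a * l); near=> n.
  have h : Ex (P n) (fun w => `|linstat phi w - l|) <= e / (`|a| + 1) by near: n.
  rewrite (@Ex_eq _ _ _ (P n) _ (fun w => `|a| * `|linstat phi w - l|)); last first.
    by move=> w; rewrite linstatZ -mulrBr normrM.
  rewrite ExZ; last first.
    by apply: bmf_norm; apply: bmfB; [exact: savg_bmf|exact: bmf_cst].
  apply: le_trans (ler_wpM2l (normr_ge0 a) h) _.
  rewrite mulrCA; apply: ler_piMr; first exact: ltW.
  by rewrite ler_pdivrMr ?ltr_wpDl// mul1r lerDl.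
Unshelve. all: by end_near.
Qed.

Lemma savgB phi psi : self_averaging phi -> self_averaging psi -> self_averaging (fun t => phi t - psi t).
Proof.
move=> cf cg; have := savgD cf (savgZ (-1) cg).
by under eq_fun do rewrite mulN1r.
Qed.

Lemma savg_sum (I : Type) (s : seq I) (F : I -> R -> R) :
  (forall i, self_averaging (F i)) -> self_averaging (fun t => \sum_(i <- s) F i t).
Proof.
move=> hF; elim: s => [|i s IH].
  by under eq_fun do rewrite big_nil; exact: savg_cst.
by under eq_fun do rewrite big_cons; exact: savgD.
Qed.

Variable F : R[i] -> R[i].
Hypothesis ker_meas : forall z, 0 < complex.Im z -> forall n,
  cmeas (fun w => n%:R^-1 * \sum_(l <- @eig n w) stieltjes_kernel z l).
Hypothesis ker_cvg : forall z, 0 < complex.Im z -> forall e : R, 0 < e ->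
  \forall n \near \oo, Ex (P n) (fun w =>
    cabs (n%:R^-1 * \sum_(l <- @eig n w) stieltjes_kernel z l - F z)) <= e.
Hypothesis F_tight : forall e : R, 0 < e -> exists L : R, 0 < L /\
  1 - L * complex.Im (F (Complex 0 L)) <= e.

Lemma cabs_kernel_le z l : 0 < complex.Im z ->
  cabs (stieltjes_kernel z l) <= (complex.Im z)^-1.
Proof.
move=> z0; rewrite /stieltjes_kernel cabsV lef_pV2 ?posrE//.
  apply: le_trans (Im_le_cabs _); rewrite cImD cImN /= add0r normrN.
  exact: ler_norm.
rewrite cabs_gt0 subr_eq0; apply: contraTneq z0 => <-.
by rewrite ltxx.
Qed.

Lemma linstat_Re_kernel z n (w : T n) :
  linstat (fun t => complex.Re (stieltjes_kernel z t)) w =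
  complex.Re (n%:R^-1 * \sum_(l <- eig w) stieltjes_kernel z l).
Proof.
rewrite -(rmorph_nat (real_complex R)) -fmorphV cReM /= mul0r subr0 cRe_sum.
by [].
Qed.

Lemma linstat_Im_kernel z n (w : T n) :
  linstat (fun t => complex.Im (stieltjes_kernel z t)) w =
  complex.Im (n%:R^-1 * \sum_(l <- eig w) stieltjes_kernel z l).
Proof.
by rewrite -(rmorph_nat (real_complex R)) -fmorphV cImM /= mul0r addr0 cIm_sum.
Qed.

Lemma ker_bmf z n : 0 < complex.Im z ->
  cbmf (fun w => n%:R^-1 * \sum_(l <- @eig n w) stieltjes_kernel z l).
Proof.
move=> z0; have [m1 m2] := ker_meas z0 n; split.
  rewrite (_ : (fun w => _) = @linstat (fun t => complex.Re (stieltjes_kernel z t)) n);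
    last by apply/funext => w; rewrite linstat_Re_kernel.
  apply: (@linstat_bmf _ (complex.Im z)^-1).
    by move=> t; exact: le_trans (Re_le_cabs _) (cabs_kernel_le t z0).
  by rewrite (_ : @linstat _ n = fun w => complex.Re
    (n%:R^-1 * \sum_(l <- eig w) stieltjes_kernel z l))//;
    apply/funext => w; exact: linstat_Re_kernel.
rewrite (_ : (fun w => _) = @linstat (fun t => complex.Im (stieltjes_kernel z t)) n);
  last by apply/funext => w; rewrite linstat_Im_kernel.
apply: (@linstat_bmf _ (complex.Im z)^-1).
  by move=> t; exact: le_trans (Im_le_cabs _) (cabs_kernel_le t z0).
by rewrite (_ : @linstat _ n = fun w => complex.Im
  (n%:R^-1 * \sum_(l <- eig w) stieltjes_kernel z l))//;
  apply/funext => w; exact: linstat_Im_kernel.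
Qed.

Lemma savg_Re_kernel z : 0 < complex.Im z ->
  self_averaging (fun t => complex.Re (stieltjes_kernel z t)).
Proof.
move=> z0; split.
- by exists (complex.Im z)^-1 => t; exact: le_trans (Re_le_cabs _) (cabs_kernel_le t z0).
- move=> n; have [m1 m2] := ker_meas z0 n.
  rewrite (_ : @linstat _ n = fun w => complex.Re
    (n%:R^-1 * \sum_(l <- eig w) stieltjes_kernel z l))//.
  by apply/funext => w; exact: linstat_Re_kernel.
- move=> e e0; exists (complex.Re (F z)); near=> n.
  have h : Ex (P n) (fun w => cabs (n%:R^-1 * \sum_(l <- @eig n w) stieltjes_kernel z l - F z)) <= e.
    by near: n; exact: ker_cvg.
  apply: le_trans h; apply: Ex_le => [||w].
  + apply: bmf_norm; apply: bmfB; last exact: bmf_cst.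
    rewrite (_ : @linstat _ n = fun w => complex.Re
      (n%:R^-1 * \sum_(l <- eig w) stieltjes_kernel z l)); first exact: (ker_bmf n z0).1.
    by apply/funext => w; exact: linstat_Re_kernel.
  + by apply: bmf_cabs; apply: cbmfB; [exact: ker_bmf|exact: cbmf_cst].
  + by rewrite linstat_Re_kernel -cReN -cReD; exact: Re_le_cabs.
Unshelve. all: by end_near.
Qed.

Lemma savg_Im_kernel z : 0 < complex.Im z ->
  self_averaging (fun t => complex.Im (stieltjes_kernel z t)).
Proof.
move=> z0; split.
- by exists (complex.Im z)^-1 => t; exact: le_trans (Im_le_cabs _) (cabs_kernel_le t z0).
- move=> n; have [m1 m2] := ker_meas z0 n.
  rewrite (_ : @linstat _ n = fun w => complex.Im
    (n%:R^-1 * \sum_(l <- eig w) stieltjes_kernel z l))//.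
  by apply/funext => w; exact: linstat_Im_kernel.
- move=> e e0; exists (complex.Im (F z)); near=> n.
  have h : Ex (P n) (fun w => cabs (n%:R^-1 * \sum_(l <- @eig n w) stieltjes_kernel z l - F z)) <= e.
    by near: n; exact: ker_cvg.
  apply: le_trans h; apply: Ex_le => [||w].
  + apply: bmf_norm; apply: bmfB; last exact: bmf_cst.
    rewrite (_ : @linstat _ n = fun w => complex.Im
      (n%:R^-1 * \sum_(l <- eig w) stieltjes_kernel z l)); first exact: (ker_bmf n z0).2.
    by apply/funext => w; exact: linstat_Im_kernel.
  + by apply: bmf_cabs; apply: cbmfB; [exact: ker_bmf|exact: cbmf_cst].
  + by rewrite linstat_Im_kernel -cImN -cImD; exact: Im_le_cabs.
Unshelve. all: by end_near.
Qed.

Lemma Re_kernel z t : complex.Re (stieltjes_kernel z t) =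
  (t - complex.Re z) / ((t - complex.Re z) ^+ 2 + complex.Im z ^+ 2).
Proof. by case: z => a b; rewrite /stieltjes_kernel/= sub0r sqrrN. Qed.

Lemma Im_kernel z t : complex.Im (stieltjes_kernel z t) =
  complex.Im z / ((t - complex.Re z) ^+ 2 + complex.Im z ^+ 2).
Proof. by case: z => a b; rewrite /stieltjes_kernel/= sub0r sqrrN -mulNr opprK. Qed.

(** This is 2 t^2 / (t^2 + L^2), a majorant of the indicator of |t| >= L whose mean can be read off
    the Stieltjes transform at i L. *)
Definition tailfun (L t : R) : R := 2 * (1 - L * (L / (t ^+ 2 + L ^+ 2))).

Lemma tailfunE L t : 0 < L ->
  tailfun L t = 2 * (1 - L * complex.Im (stieltjes_kernel (Complex 0 L) t)).
Proof. by move=> L0; rewrite Im_kernel /= subr0. Qed.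

Lemma tailfun_ge0 L t : 0 < L -> 0 <= tailfun L t.
Proof.
move=> L0; rewrite mulr_ge0// subr_ge0 mulrA -expr2 ler_pdivrMr.
  by rewrite mul1r lerDr sqr_ge0.
by rewrite ltr_wpDl ?sqr_ge0// exprn_gt0.
Qed.

Lemma tailfun_le2 L t : 0 < L -> tailfun L t <= 2.
Proof.
move=> L0; rewrite -[leRHS]mulr1; apply: ler_wpM2l => //; rewrite lerBlDr lerDl.
apply: mulr_ge0; first exact: ltW.
by apply: divr_ge0; [exact: ltW|rewrite addr_ge0 ?sqr_ge0].
Qed.

Lemma tailfun_ge1 L t : 0 < L -> L <= `|t| -> 1 <= tailfun L t.
Proof.
move=> L0 Lt; have t2 : L ^+ 2 <= t ^+ 2.
  by rewrite -[leRHS]real_normK ?num_real// ler_pXn2r// nnegrE ltW.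
have D0 : 0 < t ^+ 2 + L ^+ 2 by rewrite ltr_wpDl ?sqr_ge0// exprn_gt0.
have : L * (L / (t ^+ 2 + L ^+ 2)) <= 2^-1.
  by rewrite mulrA -expr2 ler_pdivrMr//; lra.
by rewrite /tailfun; lra.
Qed.

Lemma savg_tailfun L : 0 < L -> self_averaging (tailfun L).
Proof.
move=> L0; rewrite (_ : tailfun L = fun t => 2 * (1 - L * complex.Im
    (stieltjes_kernel (Complex 0 L) t))); last first.
  by apply/funext => t; exact: tailfunE.
apply: savgZ; apply: savgB; first exact: savg_cst.
by apply: savgZ; exact: savg_Im_kernel.
Qed.

Lemma tail_small (e : R) : 0 < e -> exists L : R, 0 < L /\
  \forall n \near \oo, Ex (P n) (fun w => linstat (tailfun L) w) <= e.
Proof.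
move=> e0; have e4 : 0 < e / 4 by rewrite divr_gt0.
have [L [L0 hL]] := F_tight e4; exists L; split => //.
have z0 : 0 < complex.Im (Complex 0 L) by [].
(* The bound e/4 on the side of the limit enters twice, and the error e/(4 L) of the transform
   enters 2 L times: e/2 each. *)
have eL : 0 < e / 4 / L by rewrite divr_gt0.
near=> n.
have h : Ex (P n) (fun w => cabs (n%:R^-1 * \sum_(l <- @eig n w) stieltjes_kernel (Complex 0 L) l
    - F (Complex 0 L))) <= e / 4 / L by near: n; exact: ker_cvg.
have n0 : (0 < n)%N by near: n; exists 1%N.
have bk := ker_bmf n z0.
apply: (@le_trans _ _ (Ex (P n) (fun w => 2 * L * cabs (n%:R^-1 *
    \sum_(l <- @eig n w) stieltjes_kernel (Complex 0 L) l - F (Complex 0 L)) + e / 2))).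
  apply: Ex_le => [||w]; first exact: savg_bmf (savg_tailfun L0).
    apply: bmfD; last exact: bmf_cst.
    apply: bmfM; first exact: bmf_cst.
    by apply: bmf_cabs; apply: cbmfB => //; exact: cbmf_cst.
  rewrite (_ : linstat (tailfun L) w = 2 * (1 - L * complex.Im (n%:R^-1 *
    \sum_(l <- @eig n w) stieltjes_kernel (Complex 0 L) l))); last first.
    rewrite -linstat_Im_kernel -linstatZ -{2}(linstat_cst 1 w n0).
    rewrite -mulN1r -linstatZ -linstatD -linstatZ; congr (_ * _); apply: eq_bigr => t _.
    by rewrite tailfunE// mulN1r.
  set s := _ * \sum_(_ <- _) _; have := Im_le_cabs (s - F (Complex 0 L)).
  rewrite cImD cImN ler_norml => /andP[hs _].
  have hLs := ler_wpM2l (ltW L0) hs.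
  by move: (cabs _) (complex.Im s) (complex.Im _) hLs hL => a b a' hLs hL; lra.
rewrite ExD; last 2 first.
- apply: bmfM; first exact: bmf_cst.
  by apply: bmf_cabs; apply: cbmfB => //; exact: cbmf_cst.
- exact: bmf_cst.
rewrite Ex_cst ExZ; last by apply: bmf_cabs; apply: cbmfB => //; exact: cbmf_cst.
have L2 : 0 <= 2 * L by rewrite mulr_ge0// ltW.
apply: le_trans (lerD (ler_wpM2l L2 h) (lexx _)) _.
by rewrite (_ : 2 * L * (e / 4 / L) = e / 2); [lra|field; rewrite gt_eqF].
Unshelve. all: by end_near.
Qed.

Lemma linstatB phi psi n (w : T n) :
  linstat (fun t => phi t - psi t) w = linstat phi w - linstat psi w.
Proof.
by rewrite /linstat sumrB mulrBr.
Qed.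

(** For a fixed outcome there are finitely many eigenvalues, all within the interval of
    approximation from some index on. *)
Lemma linstat_approx_cvg phi (psi : nat -> R -> R) n (w : T n) :
  (forall k t, `|t| <= k%:R -> `|phi t - psi k t| <= k.+1%:R^-1) ->
  linstat (psi k) w @[k --> \oo] --> linstat phi w.
Proof.
move=> h; apply: cvgMr; elim: (eig w) => [|l s IH].
  by under eq_fun do rewrite big_nil; rewrite big_nil; exact: cvg_cst.
under eq_fun do rewrite big_cons; rewrite big_cons; apply: cvgD => //.
apply/cvgrPdist_le => e e0; near=> k.
apply: le_trans (h k l _) _.
  by near: k; apply: nbhs_infty_ger.
by apply: ltW; near: k; exact: (near_infty_natSinv_lt (PosNum e0)).
Unshelve. all: by end_near.
Qed.

(** Inside [-L, L] the approximation is good; outside, the difference is at most B + B' and is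
    dominated by a multiple of [tailfun L], whose mean is eventually small. The bound [B'] must
    therefore not depend on L. *)
Lemma savg_approx phi (B B' : R) : (forall t, `|phi t| <= B) ->
  (forall e L : R, 0 < e -> 0 < L -> exists psi, [/\ self_averaging psi, forall t, `|psi t| <= B' &
     forall t, `|t| <= L -> `|phi t - psi t| <= e]) ->
  self_averaging phi.
Proof.
move=> hB happ.
have B0 : 0 <= B by exact: le_trans (normr_ge0 _) (hB 0).
(* Measurability is inherited as well, from approximants on growing intervals. *)
have mphi n : measurable_fun setT (@linstat phi n).
  have hk (k : nat) : exists psi, self_averaging psi /\
      forall t, `|t| <= k%:R -> `|phi t - psi t| <= k.+1%:R^-1.
    have k0 : 0 < k.+1%:R^-1 :> R by rewrite invr_gt0.
    have [psi [cpsi _ hpsi]] := happ k.+1%:R^-1 k.+1%:R k0 (ltr0Sn _ _).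
    exists psi; split => // t tk; apply: hpsi; apply: le_trans tk _.
    by rewrite ler_nat.
  have [psi hpsi] := choice hk.
  apply: (@measurable_fun_cvg _ _ _ setT (fun k => @linstat (psi k) n)).
    by move=> k; have [[_ mpsi _] _] := hpsi k.
  move=> w _; apply: linstat_approx_cvg => k t tk; have [_] := hpsi k; exact.
split => //; first by exists B.
move=> e e0; have e3 : 0 < e / 3 by rewrite divr_gt0.
pose W := `|B| + `|B'| + 1; have W0 : 0 < W by rewrite ltr_wpDl// addr_ge0.
have [L [L0 hL]] := tail_small (divr_gt0 e3 W0).
have [psi [cpsi hB' hpsi]] := happ _ _ e3 L0.
have [_ _ lpsi] := cpsi; have [l hl] := lpsi _ e3; exists l.
near=> n.
have n0 : (0 < n)%N by near: n; exists 1%N.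
have h1 : Ex (P n) (fun w => linstat (tailfun L) w) <= e / 3 / W by near: n.
have h2 : Ex (P n) (fun w => `|linstat psi w - l|) <= e / 3 by near: n.
have bphi := linstat_bmf hB (mphi n).
have bt := savg_bmf n (savg_tailfun L0); have bpsi := savg_bmf n cpsi.
apply: (@le_trans _ _ (Ex (P n) (fun w => (e / 3 + W * linstat (tailfun L) w) +
    `|linstat psi w - l|))).
  apply: Ex_le => [||w].
  - by apply: bmf_norm; apply: bmfB => //; exact: bmf_cst.
  - apply: bmfD; last by apply: bmf_norm; apply: bmfB => //; exact: bmf_cst.
    by apply: bmfD; [exact: bmf_cst|apply: bmfM => //; exact: bmf_cst].
  - apply: (@le_trans _ _ (`|linstat phi w - linstat psi w| + `|linstat psi w - l|)).
      by apply: le_trans (ler_normD _ _); rewrite addrA subrK.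
    rewrite lerD2r -linstatB; apply: le_trans (linstat_norm _ _) _.
    rewrite -(linstat_cst (e / 3) w n0) -linstatZ -linstatD; apply: linstat_le => t.
    have [tL|Lt] := leP `|t| L.
      by apply: le_trans (hpsi t tL) _; rewrite lerDl mulr_ge0 ?tailfun_ge0// ltW.
    apply: le_trans (ler_normB _ _) _; apply: le_trans (lerD (hB t) (hB' t)) _.
    apply: (@le_trans _ _ (W * 1)).
      by rewrite mulr1 /W; have := ler_norm B; have := ler_norm B'; move=> h h'; lra.
    apply: (@le_trans _ _ (W * tailfun L t)); last by rewrite lerDr ltW.
    by rewrite ler_pM2l//; apply: tailfun_ge1 => //; exact: ltW.
rewrite ExD; last 2 first.
- by apply: bmfD; [exact: bmf_cst|apply: bmfM => //; exact: bmf_cst].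
- by apply: bmf_norm; apply: bmfB => //; exact: bmf_cst.
rewrite ExD; last 2 first.
- exact: bmf_cst.
- by apply: bmfM => //; exact: bmf_cst.
rewrite Ex_cst ExZ//.
have h3 : W * Ex (P n) (@linstat (tailfun L) n) <= e / 3.
  apply: le_trans (ler_wpM2l (ltW W0) h1) _.
  by rewrite mulrCA divff ?mulr1// gt_eqF.
by move: (W * _) (Ex _ _) h2 h3 => a a' h2 h3; lra.
Unshelve. all: by end_near.
Qed.

Lemma savg_unif phi : (forall e : R, 0 < e -> exists psi, self_averaging psi /\
  forall t, `|phi t - psi t| <= e) -> self_averaging phi.
Proof.
move=> h; have [psi0 [[[B hB] _ _] h0]] := h 1 ltr01.
have hphi t : `|phi t| <= B + 1.
  rewrite -(subrK (psi0 t) (phi t)); apply: le_trans (ler_normD _ _) _.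
  by rewrite addrC; exact: lerD.
apply: (@savg_approx phi (B + 1) (B + 2)) => // e L e0 L0.
(* Capping the error at 1 gives all approximants the common bound B + 2. *)
have e1 : 0 < Num.min e 1 by rewrite lt_min e0 ltr01.
have [psi [cpsi hpsi]] := h _ e1; exists psi; split => // t.
  rewrite -(subrK (phi t) (psi t)); apply: le_trans (ler_normD _ _) _.
  have : `|psi t - phi t| <= 1.
    by rewrite distrC; apply: le_trans (hpsi t) _; rewrite ge_min lexx orbT.
  by move=> h1; have := lerD h1 (hphi t); lra.
by move=> _; apply: le_trans (hpsi t) _; rewrite ge_min lexx.
Qed.

(* Riemann sums of [s |-> psi (s - t)] over [a, b], uniformly in [t]. *)
Lemma savg_primitive (Psi psi : R -> R) (K a b : R) : a < b ->
  (forall r : R, is_derive r 1 Psi (psi r)) ->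
  (forall r s, `|psi r - psi s| <= K * `|r - s|) ->
  (forall c, self_averaging (fun t => psi (c - t))) ->
  self_averaging (fun t => Psi (b - t) - Psi (a - t)).
Proof.
move=> ab dPsi lip cpsi.
have K0 : 0 <= K.
  by have := lip 1 0; rewrite subr0 normr1 mulr1; apply: le_trans.
apply: savg_unif => e e0.
(* Each of the M cells, of width h, contributes an error K h^2, hence K (b - a) h altogether. *)
have [M [M0 hM]] : exists M : nat, (0 < M)%N /\ K * (b - a) * ((b - a) / M%:R) <= e.
  pose q := K * (b - a) * (b - a) / e.
  exists (Num.truncn q).+1; split => //.
  rewrite mulrA ler_pdivrMr// [leRHS]mulrC -ler_pdivrMr//.
  by apply: ltW; exact: truncnS_gt.
pose h := (b - a) / M%:R; have h0 : 0 < h by rewrite divr_gt0 ?subr_gt0// ltr0n.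
pose s (j : nat) := a + j%:R * h.
exists (fun t => \sum_(j < M) h * psi (s j - t)); split.
  by apply: savg_sum => j; apply: savgZ; exact: cpsi.
move=> t.
have sM : s M = b by rewrite /s /h mulrCA divff ?mulr1 ?subrKC// pnatr_eq0 -lt0n.
have -> : Psi (b - t) - Psi (a - t) = \sum_(j < M) (Psi (s j.+1 - t) - Psi (s j - t)).
  rewrite -(big_mkord xpredT (fun j => Psi (s j.+1 - t) - Psi (s j - t))).
  by rewrite (telescope_sumr (fun j => Psi (s j - t)))// sM /s mul0r addr0.
rewrite -sumrB; apply: le_trans (ler_norm_sum _ _ _) _.
apply: (@le_trans _ _ (\sum_(j < M) K * h * h)); last first.
  rewrite sumr_const card_ord -[leLHS]mulr_natl; apply: le_trans hM.
  rewrite le_eqVlt; apply/orP; left; apply/eqP; rewrite /h.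
  by field; rewrite pnatr_eq0 -lt0n.
apply: ler_sum => j _.
have sj : s j.+1 - t - (s j - t) = h.
  by rewrite /s -natr1; ring.
have lt_s : s j - t < s j.+1 - t by rewrite -subr_gt0 sj.
have [|c hc ->] := @MVT _ Psi psi _ _ lt_s (fun x _ => dPsi x).
  apply: derivable_within_continuous => x _; exact: ex_derive.
rewrite sj [h * _]mulrC -mulrBl normrM (gtr0_norm h0) ler_pM2r//.
apply: le_trans (lip _ _) _; apply: ler_wpM2l => //.
move: hc; rewrite in_itv /= => /andP[c1 c2].
have c0 : 0 <= c - (s j - t) by rewrite subr_ge0 ltW.
by rewrite ger0_norm// -sj lerD2r ltW.
Qed.

End LinearStatistics.

(** * Arctangents as primitives of Poisson kernels *)

Section Arctangent.
Context {R : realType}.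
Implicit Types (e r s t : R).

Lemma is_derive_inv r : r != 0 -> is_derive r 1 (fun u : R => u^-1) (- r ^- 2).
Proof.
move=> r0; apply: DeriveDef; first exact: (@derivableV R R id).
by rewrite (@deriveV R R id)// derive_id -[LHS]/(- r ^- 2 * 1) mulr1.
Qed.

(** On the positive half-line atan u + 1/u does not increase, and atan t tends to pi/2. *)
Lemma pihalf_atan s : 0 < s -> pi / 2 - atan s <= s^-1.
Proof.
move=> s0; rewrite lerBlDr leNgt; apply/negP => hlt.
pose h (u : R) : R := atan u + u^-1; pose dh (u : R) : R := (1 + u ^+ 2)^-1 - u ^- 2.
have dH (u : R) : 0 < u -> is_derive u 1 h (dh u).
  by move=> u0; apply: is_deriveD; apply: is_derive_inv; rewrite gt_eqF.
have hle (t : R) : s < t -> atan t < s^-1 + atan s.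
  move=> st; have t0 := lt_trans s0 st.
  have dHx x : x \in `]s, t[ -> is_derive x 1 h (dh x).
    by rewrite in_itv /= => /andP[sx _]; apply: dH; exact: lt_trans sx.
  have cH : {within `[s, t], continuous h}.
    apply: derivable_within_continuous => x; rewrite in_itv /= => /andP[sx _].
    by have [] := dH x (lt_le_trans s0 sx).
  have [c hc hts] := MVT st dHx cH.
  have c0 : 0 < c by apply: lt_trans s0 _; move: hc; rewrite in_itv /= => /andP[].
  have : h t - h s <= 0.
    rewrite hts mulr_le0_ge0// ?subr_ge0 ?(ltW st)// /dh subr_le0 lef_pV2 ?posrE ?exprn_gt0//.
      by rewrite lerDr.
    by rewrite ltr_pwDl// sqr_ge0.
  rewrite /h; have : 0 < t^-1 by rewrite invr_gt0.
  by move: (t^-1) (s^-1) => ti si; lra.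
have : \forall t \near +oo, s^-1 + atan s < atan t :> R.
  exact: (@cvgr_gt _ _ _ _ _ _ (@cvgy_atan R) _ hlt).
move=> hnear; have hgt : \forall t \near +oo, s < t by apply: nbhs_pinfty_gt; rewrite num_real.
have [t [h1 h2]] := filter_ex (filterI hnear hgt).
by have := lt_trans h1 (hle t h2); rewrite ltxx.
Qed.

(** For r > 0 the difference is (2/pi) r (pi/2 - atan (r/e)), at most (2/pi) e by [pihalf_atan];
    both functions are even. *)
Lemma abs_atan r e : 0 < e -> `| `|r| - 2 / pi * (r * atan (r / e))| <= e.
Proof.
move=> e0; wlog r0 : r / 0 <= r.
  move=> h; have [|r0] := leP 0 r; first exact: h.
  have := h (- r); rewrite oppr_ge0 ltW// normrN !mulNr atanN mulrN opprK !mulrN; by apply.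
rewrite (ger0_norm r0); have [->|rn] := eqVneq r 0.
  by rewrite mul0r mulr0 subr0 normr0 ltW.
have {rn}rp : 0 < r by rewrite lt_def rn.
have pi0 := @pi_gt0 R; have re : 0 < r / e by rewrite divr_gt0.
have h1 := pihalf_atan re; rewrite invf_div in h1.
have h2 := @atan_ltpi2 R (r / e).
have -> : r - 2 / pi * (r * atan (r / e)) = 2 / pi * (r * (pi / 2 - atan (r / e))).
  have pn : pi != 0 :> R by rewrite gt_eqF.
  have key (q A u : R) : q != 0 -> u - 2 / q * (u * A) = 2 / q * (u * (q / 2 - A)).
    by move=> q0; field.
  exact: key.
have p2 : 0 < 2 / pi :> R by rewrite divr_gt0.
rewrite ger0_norm; last by rewrite mulr_ge0 ?(ltW p2)// mulr_ge0// subr_ge0 ltW.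
have p21 : 2 / pi <= 1 :> R by rewrite ler_pdivrMr// mul1r pi_ge2.
have h3 : r * (pi / 2 - atan (r / e)) <= e.
  apply: le_trans (ler_wpM2l r0 h1) _; rewrite mulrCA divff ?mulr1// gt_eqF//.
apply: le_trans (ler_wpM2l (ltW p2) h3) _; rewrite -[leRHS]mul1r.
by apply: ler_wpM2r => //; exact: ltW.
Qed.

(** With r = c - t, [poisson] is the imaginary part of 1/(t - z) at z = c + i e, and [conj_poisson]
    is the opposite of its real part. *)
Definition poisson e r : R := e / (r ^+ 2 + e ^+ 2).
Definition conj_poisson e r : R := r / (r ^+ 2 + e ^+ 2).

Lemma poisson_den e r : 0 < e -> 0 < r ^+ 2 + e ^+ 2.
Proof. by move=> e0; rewrite ltr_wpDl ?sqr_ge0// exprn_gt0. Qed.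

Lemma poisson_le e r : 0 < e -> `|poisson e r| <= e^-1.
Proof.
move=> e0; have D0 := poisson_den r e0.
rewrite ger0_norm; last by apply: divr_ge0; exact: ltW.
rewrite ler_pdivrMr// ler_pdivlMl// -expr2 lerDr sqr_ge0//.
Qed.

Lemma poisson_lipschitz e r s : 0 < e ->
  `|poisson e r - poisson e s| <= e ^- 2 * `|r - s|.
Proof.
move=> e0; have Dr := poisson_den r e0; have Ds := poisson_den s e0.
rewrite /poisson; have -> : e / (r ^+ 2 + e ^+ 2) - e / (s ^+ 2 + e ^+ 2) =
  (r - s) * (- (e * (r + s)) / ((r ^+ 2 + e ^+ 2) * (s ^+ 2 + e ^+ 2))).
  by field; rewrite !gt_eqF.
rewrite normrM mulrC; apply: ler_wpM2r => //.
rewrite normrM normrV ?unitfE ?gt_eqF ?mulr_gt0// (gtr0_norm (mulr_gt0 Dr Ds)).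
rewrite ler_pdivrMr ?mulr_gt0// ler_pdivlMl ?exprn_gt0// normrN normrM (gtr0_norm e0).
have h : `|r + s| <= `|r| + `|s| by exact: ler_normD.
have hr : `|r| * e <= r ^+ 2 + e ^+ 2 / 4.
  by rewrite -(real_normK (num_real r)); have := sqr_ge0 (`|r| - e / 2); nra.
have hs : `|s| * e <= s ^+ 2 + e ^+ 2 / 4.
  by rewrite -(real_normK (num_real s)); have := sqr_ge0 (`|s| - e / 2); nra.
apply: (@le_trans _ _ (e ^+ 2 * (r ^+ 2 + s ^+ 2 + e ^+ 2))).
  apply: ler_wpM2l; first exact: sqr_ge0.
  apply: le_trans (ler_wpM2l (ltW e0) h) _; have := sqr_ge0 e.
  by rewrite mulrC mulrDl => ?; lra.
have : 0 <= r ^+ 2 * s ^+ 2 by rewrite mulr_ge0 ?sqr_ge0.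
by move=> ?; lra.
Qed.

Lemma conj_poisson_lipschitz e r s : 0 < e ->
  `|conj_poisson e r - conj_poisson e s| <= e ^- 2 * `|r - s|.
Proof.
move=> e0; have Dr := poisson_den r e0; have Ds := poisson_den s e0.
rewrite /conj_poisson; have -> : r / (r ^+ 2 + e ^+ 2) - s / (s ^+ 2 + e ^+ 2) =
  (r - s) * ((e ^+ 2 - r * s) / ((r ^+ 2 + e ^+ 2) * (s ^+ 2 + e ^+ 2))).
  by field; rewrite !gt_eqF.
rewrite normrM mulrC; apply: ler_wpM2r => //.
rewrite normrM normrV ?unitfE ?gt_eqF ?mulr_gt0// (gtr0_norm (mulr_gt0 Dr Ds)).
rewrite ler_pdivrMr ?mulr_gt0// ler_pdivlMl ?exprn_gt0//.
have h : `|e ^+ 2 - r * s| <= e ^+ 2 + (r ^+ 2 + s ^+ 2).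
  rewrite ler_norml; apply/andP; split.
    by have := sqr_ge0 (r - s); have := sqr_ge0 e; have := sqr_ge0 r; have := sqr_ge0 s; nra.
  by have := sqr_ge0 (r + s); have := sqr_ge0 r; have := sqr_ge0 s; nra.
apply: le_trans (ler_wpM2l (sqr_ge0 e) h) _.
have : 0 <= r ^+ 2 * s ^+ 2 by rewrite mulr_ge0 ?sqr_ge0.
by move=> ?; lra.
Qed.

Lemma is_derive_atan_scale e r : 0 < e ->
  is_derive r 1 (fun u : R => atan (u / e)) (poisson e r).
Proof.
move=> e0; have d1 : is_derive r 1 (fun u : R => u / e) e^-1.
  rewrite (_ : (fun u : R => u / e) = e^-1 \*: id); last first.
    by apply/funext => u /=; rewrite mulrC.
  by apply: is_derive_eq; rewrite /GRing.scale/= mulr1.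
have := @is_derive1_comp R atan (fun u : R => u / e) r _ _ (is_derive1_atan (r / e)) d1.
move=> d2; apply: (is_derive_eq d2).
have D0 := poisson_den r e0.
by rewrite /poisson /GRing.scale /=; field; rewrite !gt_eqF//=.
Qed.

End Arctangent.

(** A continuous descent from 1 to 0 across [a, b], written with absolute values because these arise
    as limits of u atan (u / e). *)
Definition ramp (R : realType) (a b t : R) : R :=
  2^-1 + (2 * (b - a))^-1 * (`|b - t| - `|a - t|).

Section Ramp.
Context {R : realType}.
Implicit Types a b t : R.

Lemma ramp_le a b t : a < b -> t <= a -> ramp a b t = 1.
Proof.
move=> ab ta; rewrite /ramp !ger0_norm ?subr_ge0//; last exact: le_trans (ltW ab).
by field; rewrite subr_eq0 gt_eqF.
Qed.

Lemma ramp_ge a b t : a < b -> b <= t -> ramp a b t = 0.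
Proof.
move=> ab bt; rewrite /ramp !ler0_norm ?subr_le0//; last exact: le_trans (ltW ab) bt.
by field; rewrite subr_eq0 gt_eqF.
Qed.

Lemma ramp_mid a b t : a < b -> a <= t -> t <= b -> ramp a b t = (b - t) / (b - a).
Proof.
move=> ab at_ tb; rewrite /ramp ger0_norm ?subr_ge0// ler0_norm ?subr_le0//.
by field; rewrite subr_eq0 gt_eqF.
Qed.

Lemma ramp_ge0 a b t : a < b -> 0 <= ramp a b t.
Proof.
move=> ab; have [ta|/ltW at_] := leP t a; first by rewrite ramp_le.
have [bt|/ltW tb] := leP b t; first by rewrite ramp_ge.
by rewrite ramp_mid// divr_ge0// subr_ge0// ltW.
Qed.

Lemma ramp_le1 a b t : a < b -> ramp a b t <= 1.
Proof.
move=> ab; have [ta|/ltW at_] := leP t a; first by rewrite ramp_le.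
have [bt|/ltW tb] := leP b t; first by rewrite ramp_ge.
by rewrite ramp_mid// ler_pdivrMr ?subr_gt0// mul1r lerD2l lerN2.
Qed.

Lemma continuous_ramp a b : continuous (ramp a b).
Proof.
move=> t; apply: cvgD; first exact: cvg_cst.
apply: cvgMr; apply: cvgB; apply: cvg_norm; apply: cvgB; (exact: cvg_cst || exact: cvg_id).
Qed.

(** The step at the supremum of the points of [a, b] where [S] holds starts from such a point close
    below it; it would lead beyond the supremum unless b is already within reach. *)
Lemma real_induction a b (S : R -> Prop) : a <= b -> S a ->
  (forall x, a <= x <= b -> exists2 r, 0 < r &
     forall s t, S s -> a <= s -> x - r <= s -> s <= t -> t <= b -> t <= x + r -> S t) ->
  S b.
Proof.
move=> ab Sa step; pose E := [set x | [/\ a <= x, x <= b & S x]].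
have Ea : E a by split.
have hE : has_sup E by split; [exists a|exists b => x []].
have aE : a <= sup E by exact: ub_le_sup (hE.2) a Ea.
have Eb : sup E <= b by apply: ge_sup; [exists a|move=> x []].
have /step[r r0 hr] : a <= sup E <= b by rewrite aE.
have [x [ax xb Sx] xr] := sup_adherent r0 hE.
have xs : x <= sup E by apply: ub_le_sup; [exact: hE.2|split].
have [h|h] := leP b (sup E + r).
  by apply: (hr x) => //; exact: ltW.
have St : S (sup E + r).
  by apply: (hr x) => //; [exact: ltW|apply: le_trans xs _; rewrite lerDl ltW|exact: ltW].
have : sup E + r <= sup E.
  by apply: ub_le_sup; [exact: hE.2|split => //; [apply: le_trans aE _; rewrite lerDl ltW|exact: ltW]].
by rewrite gerDl leNgt r0.
Qed.

End Ramp.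

(** * Piecewise linear approximation of bounded continuous functions *)

Section Interpolation.
Context {R : realType}.
Variable V : (R -> R) -> Prop.
Implicit Types (phi psi : R -> R) (a b e t : R).
Hypothesis V_cst : forall a, V (fun=> a).
Hypothesis V_D : forall phi psi, V phi -> V psi -> V (fun t => phi t + psi t).
Hypothesis V_Z : forall a phi, V phi -> V (fun t => a * phi t).
Hypothesis V_approx : forall phi (B B' : R), continuous phi -> (forall t, `|phi t| <= B) ->
  (forall e L : R, 0 < e -> 0 < L -> exists psi, [/\ V psi, forall t, `|psi t| <= B' &
     forall t, `|t| <= L -> `|phi t - psi t| <= e]) -> V phi.
Hypothesis V_ramp : forall a b, a < b -> V (ramp a b).

(** A piecewise linear interpolant on [-L, L] is built from left to right by [real_induction], one
    ramp per step. Its values interpolate those of [phi], hence the bound B holds for every L. *)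
Lemma class_continuous phi B : continuous phi -> (forall t, `|phi t| <= B) -> V phi.
Proof.
move=> cphi hB; apply: (V_approx (B := B) (B' := B)) => // e L e0 L0.
(* The approximant is constant to the right of x, so that a ramp starting there prolongs it without
   changing what lies to the left. *)
pose S x := exists psi, [/\ V psi, forall t, `|psi t| <= B,
  forall t, x <= t -> psi t = phi x &
  forall t, - L <= t -> t <= x -> `|phi t - psi t| <= e].
suff [psi [Vpsi psiB _ he]] : S L.
  exists psi; split => // t; rewrite ler_norml => /andP[? ?]; exact: he.
apply: (@real_induction _ (- L) L S); first by rewrite ge0_cp// ltW.
  exists (fun=> phi (- L)); split => // t Lt tL.
  by rewrite (_ : t = - L) ?subrr ?normr0 ?ltW//; apply/le_anti; rewrite tL.
move=> x _; have e2 : 0 < e / 2 by rewrite divr_gt0.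
have [r r0 hr] : exists2 r, 0 < r & forall t, `|x - t| <= r -> `|phi x - phi t| <= e / 2.
  have /cvgrPdist_le/(_ _ e2)/nbhs_ballP[r /= r0 hr] := cphi x.
  exists (r / 2); first by rewrite divr_gt0.
  by move=> t xt; apply: hr; rewrite /ball/=; apply: le_lt_trans xt _; rewrite ltr_pdivrMr// ltr_pMr// ltr1n.
exists r => // s t [psi [Vpsi psiB hs he]] Ls xs.
rewrite le_eqVlt => /predU1P[<- _ _|st tL tx]; first by exists psi.
pose lam u := 1 - ramp s t u.
have lam0 u : 0 <= lam u by rewrite subr_ge0 ramp_le1.
have lam1 u : lam u <= 1 by rewrite lerBlDr lerDl ramp_ge0.
(* Balls are convex: with w = 0 this gives the bound B, with w = phi u the approximation. *)
have hconv u (v1 v2 w K : R) : `|w - v1| <= K -> `|w - v2| <= K ->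
    `|w - (v1 + (v2 - v1) * lam u)| <= K.
  have := lam0 u; have := lam1 u; move: (lam u) => l l1 l0.
  rewrite !ler_norml => /andP[h1 h2] /andP[h3 h4].
  by apply/andP; split; nra.
exists (fun u => psi u + (phi t - phi s) * lam u); split.
- apply: V_D => //; apply: V_Z; rewrite (_ : lam = fun u => 1 + -1 * ramp s t u).
    by apply: V_D; [exact: V_cst|apply: V_Z; exact: V_ramp].
  by apply/funext => u; rewrite mulN1r.
- move=> u; have [us|/ltW su] := leP u s.
    by rewrite /lam ramp_le// subrr mulr0 addr0.
  rewrite hs//; have := hconv u (phi s) (phi t) 0 B.
  by rewrite !sub0r !normrN; apply.
- move=> u tu; rewrite hs ?(le_trans (ltW st))// /lam ramp_ge// subr0 mulr1.
  by rewrite addrC subrK.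
- move=> u Lu ut; have [us|/ltW su] := leP u s.
    by rewrite /lam ramp_le// subrr mulr0 addr0; exact: he.
  rewrite hs//.
  have near_x v : s <= v -> v <= t -> `|phi x - phi v| <= e / 2.
    by move=> sv vt; apply: hr; rewrite ler_norml; apply/andP; split; lra.
  have tri v : s <= v -> v <= t -> `|phi u - phi v| <= e.
    move=> sv vt; rewrite -(subrKA (phi x)) [leRHS](splitr e).
    apply: le_trans (ler_normD _ _) _; apply: lerD; last exact: near_x.
    by rewrite distrC; exact: near_x.
  by apply: hconv; apply: tri => //; exact: ltW.
Qed.

End Interpolation.

(** * From Poisson kernels to ramps *)

Section FunctionClass.
Context {R : realType}.
Variable V : (R -> R) -> Prop.
Implicit Types (phi psi : R -> R) (a b c e t : R).
Hypothesis V_cst : forall a, V (fun=> a).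
Hypothesis V_D : forall phi psi, V phi -> V psi -> V (fun t => phi t + psi t).
Hypothesis V_Z : forall a phi, V phi -> V (fun t => a * phi t).
Hypothesis V_approx : forall phi (B B' : R), continuous phi -> (forall t, `|phi t| <= B) ->
  (forall e L : R, 0 < e -> 0 < L -> exists psi, [/\ V psi, forall t, `|psi t| <= B' &
     forall t, `|t| <= L -> `|phi t - psi t| <= e]) -> V phi.
Hypothesis V_unif : forall phi, (forall e, 0 < e -> exists psi, V psi /\
  forall t, `|phi t - psi t| <= e) -> V phi.
Hypothesis V_poisson : forall e c, 0 < e -> V (fun t => poisson e (c - t)).
Hypothesis V_conj_poisson : forall e c, 0 < e -> V (fun t => conj_poisson e (c - t)).
Hypothesis V_primitive : forall (Psi psi : R -> R) (K a b : R), a < b ->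
  (forall r : R, is_derive r 1 Psi (psi r)) ->
  (forall r s, `|psi r - psi s| <= K * `|r - s|) ->
  (forall c, V (fun t => psi (c - t))) ->
  V (fun t => Psi (b - t) - Psi (a - t)).

Let V_B phi psi : V phi -> V psi -> V (fun t => phi t - psi t).
Proof.
move=> h1 h2; rewrite (_ : (fun t => _) = (fun t => phi t + -1 * psi t)).
  by apply: V_D => //; exact: V_Z.
by apply/funext => t; rewrite mulN1r.
Qed.

(** The primitive between a and c gives a difference of two arctangents; as a tends to minus
    infinity the second one tends to -pi/2, uniformly on [-L, L]. *)
Let V_atan e c : 0 < e -> V (fun t => atan ((c - t) / e)).
Proof.
move=> e0; apply: (@V_approx _ (pi / 2) (pi / 2 + pi / 2 + pi / 2)).
- move=> t; apply: (@continuous_comp _ _ _ (fun u : R => (c - u) / e) atan).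
    by apply: cvgMl; apply: cvgB; [exact: cvg_cst|exact: cvg_id].
  exact: continuous_atan.
- move=> t; rewrite ler_norml; apply/andP; split; apply: ltW.
    exact: atan_gtNpi2.
  exact: atan_ltpi2.
move=> eps L eps0 L0.
(* For t >= -L this gives t - a >= e / eps, so that pi/2 - atan ((t - a)/e) <= e/(t - a) <= eps; the
   bound c - 1 ensures a < c. *)
pose a := Num.min (- L - e / eps) (c - 1).
have ac : a < c by rewrite gt_min; apply/orP; right; rewrite ltrBlDr ltrDl.
have aL : a <= - L - e / eps by rewrite ge_min lexx.
have habs r : `|atan r| <= pi / 2 :> R.
  by rewrite ler_norml; apply/andP; split; apply: ltW; [exact: atan_gtNpi2|exact: atan_ltpi2].
exists (fun t => atan ((c - t) / e) - atan ((a - t) / e) - pi / 2); split.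
- apply: V_B; last exact: V_cst.
  apply: (V_primitive (Psi := fun u => atan (u / e)) (psi := poisson e) (K := e ^- 2)) => //.
  + by move=> r; exact: is_derive_atan_scale.
  + by move=> r s; exact: poisson_lipschitz.
  + by move=> c'; exact: V_poisson.
- move=> t; apply: le_trans (ler_normB _ _) _; apply: lerD.
    by apply: le_trans (ler_normB _ _) _; exact: lerD.
  by rewrite ger0_norm// divr_ge0// ltW// pi_gt0.
- move=> t; rewrite ler_norml => /andP[Lt _].
  have ta : e / eps <= t - a by lra.
  have ee : 0 < e / eps by rewrite divr_gt0.
  have ta0 : 0 < t - a := lt_le_trans ee ta.
  have te : 0 < (t - a) / e by rewrite divr_gt0.
  rewrite opprB.
  have -> : atan ((a - t) / e) = - atan ((t - a) / e) by rewrite -atanN -mulNr opprB.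
  have -> : atan ((c - t) / e) + (pi / 2 - (atan ((c - t) / e) - - atan ((t - a) / e)))
     = pi / 2 - atan ((t - a) / e) by ring.
  rewrite ger0_norm; last by rewrite subr_ge0 ltW// atan_ltpi2.
  apply: le_trans (pihalf_atan te) _; rewrite invf_div ler_pdivrMr//.
  by rewrite mulrC -ler_pdivrMr.
Qed.

(** The derivative of r atan (r/e) is atan (r/e) + e times the conjugate Poisson kernel, both of the
    class; each absolute value is then approximated within eps/2. *)
Let V_abs a b : a < b -> V (fun t => `|b - t| - `|a - t|).
Proof.
move=> ab; apply: V_unif => eps eps0; have e0 : 0 < eps / 2 by rewrite divr_gt0.
set e := eps / 2 in e0.
pose Psi r : R := r * atan (r / e).
pose psi r : R := atan (r / e) + e * conj_poisson e r.
exists (fun t => 2 / pi * (Psi (b - t) - Psi (a - t))); split; last first.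
  move=> t; have -> : `|b - t| - `|a - t| - 2 / pi * (Psi (b - t) - Psi (a - t)) =
     (`|b - t| - 2 / pi * Psi (b - t)) - (`|a - t| - 2 / pi * Psi (a - t)) by ring.
  apply: le_trans (ler_normB _ _) _; rewrite [leRHS](splitr eps).
  by apply: lerD; exact: abs_atan.
apply: (V_Z (2 / pi)).
have einv : 0 < e^-1 by rewrite invr_gt0.
apply: (V_primitive (psi := psi) (K := e^-1 + e^-1)) => //.
- move=> r; have h1 := is_derive_atan_scale r e0.
  have h2 : is_derive r 1 (id : R -> R) 1 by exact: is_derive_id.
  have h := is_deriveM h2 h1; apply: (is_derive_eq h).
  by rewrite /psi /poisson /conj_poisson /GRing.scale/= mulr1 addrC; congr (_ + _); ring.
- have lip r s : r < s -> `|atan (r / e) - atan (s / e)| <= e^-1 * `|r - s|.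
    move=> rs.
    have dH x : x \in `]r, s[ -> is_derive x 1 (fun u : R => atan (u / e)) (poisson e x).
      by move=> _; exact: is_derive_atan_scale.
    have cH : {within `[r, s], continuous (fun u : R => atan (u / e))}.
      apply: derivable_within_continuous => x _.
      by have [] := is_derive_atan_scale x e0.
    have [x _ hx] := MVT rs dH cH.
    rewrite distrC hx normrM [`|r - s|]distrC; apply: ler_wpM2r => //; exact: poisson_le.
  have lip' r s : `|atan (r / e) - atan (s / e)| <= e^-1 * `|r - s|.
    have [rs|sr|->] := ltgtP r s; [exact: lip| |by rewrite !subrr normr0 mulr0].
    by rewrite distrC [`|r - s|]distrC; exact: lip.
  move=> r s; rewrite /psi.
  have -> : atan (r / e) + e * conj_poisson e r - (atan (s / e) + e * conj_poisson e s) =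
    (atan (r / e) - atan (s / e)) + e * (conj_poisson e r - conj_poisson e s) by ring.
  rewrite mulrDl; apply: le_trans (ler_normD _ _) _; apply: lerD; first exact: lip'.
  rewrite normrM (gtr0_norm e0); apply: le_trans (ler_wpM2l (ltW e0) (conj_poisson_lipschitz r s e0)) _.
  by rewrite mulrA; apply: ler_wpM2r => //; rewrite expr2 invfM mulrA divff ?mul1r// gt_eqF.
- by move=> c; apply: V_D; [exact: V_atan|apply: V_Z; exact: V_conj_poisson].
Qed.

Lemma class_ramp a b : a < b -> V (ramp a b).
Proof. by move=> ab; apply: V_D; [exact: V_cst|apply: V_Z; exact: V_abs]. Qed.

End FunctionClass.

(** * Probability measures from mean functionals *)

Section CumulativeDistribution.
Context {R : realType} (f : R -> R).
Hypothesis f_nd : nondecreasing f.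
Hypothesis f_rc : right_continuous f.
Hypothesis f_Ny : f @ -oo --> (0 : R).
Hypothesis f_y : f @ +oo --> (1 : R).

Lemma probability_of_cdf :
  exists N : probability R R, forall r, N `]-oo, r]%classic = (f r)%:E.
Proof.
pose g : cumulativeBounded (0 : R) (1 : R) :=
  HB.pack f (isCumulative.Build R _ _ f f_nd f_rc)
            (isCumulativeBounded.Build R 0 1 f f_Ny f_y).
(* The Lebesgue-Stieltjes measure lives on a copy of the line; the identity, taken as a random
   variable, transports it to [R]. *)
pose idR : measurableTypeR R -> R := idfun.
have mid : measurable_fun setT idR by exact: measurable_id.
pose X : {RV (lebesgue_stieltjes_measure g) >-> R} :=
  HB.pack idR (isMeasurableFun.Build _ _ _ _ idR mid).
exists (distribution (lebesgue_stieltjes_measure g) X) => r.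
exact: (cdf_lebesgue_stieltjes_id g r).
Qed.

End CumulativeDistribution.

Section MeanFunctional.
Context {R : realType}.
Implicit Types (phi psi : R -> R) (a b x e : R) (M : (R -> R) -> R).

Definition bounded_continuous phi : Prop :=
  continuous phi /\ exists B, forall t, `|phi t| <= B.

(** A normalized positive linear functional on bounded continuous functions. The last clause is
    tightness: it prevents mass from escaping to infinity. *)
Definition mean_functional M : Prop :=
  [/\ forall a, M (fun=> a) = a,
      forall phi psi, bounded_continuous phi -> bounded_continuous psi ->
        M (fun t => phi t + psi t) = M phi + M psi,
      forall a phi, bounded_continuous phi -> M (fun t => a * phi t) = a * M phi,
      forall phi psi, bounded_continuous phi -> bounded_continuous psi ->
        (forall t, phi t <= psi t) -> M phi <= M psi
    & forall e, 0 < e -> exists2 L, 0 < L & M (tailfun L) <= e].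

Lemma bc_cst a : bounded_continuous (fun=> a).
Proof. by split; [move=> t; exact: cvg_cst|exists `|a|]. Qed.

Lemma bcD phi psi : bounded_continuous phi -> bounded_continuous psi ->
  bounded_continuous (fun t => phi t + psi t).
Proof.
move=> [c1 [B1 h1]] [c2 [B2 h2]]; split; first by move=> t; apply: cvgD; [exact: c1|exact: c2].
by exists (B1 + B2) => t; exact: le_trans (ler_normD _ _) (lerD _ _).
Qed.

Lemma bcZ a phi : bounded_continuous phi -> bounded_continuous (fun t => a * phi t).
Proof.
move=> [c1 [B1 h1]]; split; first by move=> t; apply: cvgMr; exact: c1.
by exists (`|a| * B1) => t; rewrite normrM; apply: ler_wpM2l.
Qed.

Lemma bc_sum (I : Type) (s : seq I) (F : I -> R -> R) :
  (forall i, bounded_continuous (F i)) ->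
  bounded_continuous (fun t => \sum_(i <- s) F i t).
Proof.
move=> hF; elim: s => [|i s IH].
  by under eq_fun do rewrite big_nil; exact: bc_cst.
by under eq_fun do rewrite big_cons; exact: bcD.
Qed.

Lemma bc_ramp a b : a < b -> bounded_continuous (ramp a b).
Proof.
move=> ab; split; first exact: continuous_ramp.
by exists 1 => t; rewrite ger0_norm ?ramp_ge0// ramp_le1.
Qed.

Lemma bc_tailfun L : 0 < L -> bounded_continuous (tailfun L).
Proof.
move=> L0; have D0 (t : R) : 0 < t ^+ 2 + L ^+ 2 by rewrite ltr_wpDl ?sqr_ge0// exprn_gt0.
split.
  move=> t; apply: cvgMr; apply: cvgB; first exact: cvg_cst.
  apply: cvgMr; apply: cvgMr; apply: cvgV; first by rewrite gt_eqF.
  by apply: cvgD; [exact: exprn_continuous|exact: cvg_cst].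
by exists 2 => t; rewrite ger0_norm ?tailfun_ge0// tailfun_le2.
Qed.

Lemma mean_sum M (I : Type) (s : seq I) (F : I -> R -> R) : mean_functional M ->
  (forall i, bounded_continuous (F i)) ->
  M (fun t => \sum_(i <- s) F i t) = \sum_(i <- s) M (F i).
Proof.
move=> [Mc MD _ _ _] hF; elim: s => [|i s IH].
  by under eq_fun do rewrite big_nil; rewrite big_nil; exact: Mc.
under eq_fun do rewrite big_cons.
by rewrite big_cons MD ?IH//; exact: bc_sum.
Qed.

Lemma mean_approx M phi psi (B B' e L : R) : mean_functional M ->
  bounded_continuous phi -> bounded_continuous psi ->
  (forall t, `|phi t| <= B) -> (forall t, `|psi t| <= B') -> 0 < L -> 0 <= e ->
  (forall t, `|t| <= L -> `|phi t - psi t| <= e) ->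
  `|M phi - M psi| <= e + (B + B') * M (tailfun L).
Proof.
move=> hM c1 c2 hB hB' L0 e0 h; have [Mc MD MZ Mle _] := hM.
have BB : 0 <= B + B'.
  by apply: addr_ge0; [exact: le_trans (hB 0)|exact: le_trans (hB' 0)].
have key t : `|phi t - psi t| <= e + (B + B') * tailfun L t.
  have t0 := tailfun_ge0 t L0; have [tL|/ltW tL] := leP `|t| L.
    by apply: le_trans (h _ tL) _; rewrite lerDl mulr_ge0.
  have t1 := tailfun_ge1 L0 tL.
  apply: (@le_trans _ _ (B + B')).
    by apply: le_trans (ler_normB _ _) _; exact: lerD.
  by apply: (@le_trans _ _ ((B + B') * tailfun L t)); [rewrite ler_peMr|rewrite lerDr].
have cT := bcD (bc_cst e) (bcZ (B + B') (bc_tailfun L0)).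
have MT : M (fun t => e + (B + B') * tailfun L t) = e + (B + B') * M (tailfun L).
  by rewrite (MD _ _ (bc_cst e) (bcZ (B + B') (bc_tailfun L0))) Mc MZ//; exact: bc_tailfun.
have half f g : bounded_continuous f -> bounded_continuous g ->
    (forall t, `|f t - g t| <= e + (B + B') * tailfun L t) ->
    M f <= M g + (e + (B + B') * M (tailfun L)).
  move=> cf cg hfg; rewrite -MT -MD//; apply: Mle => //; first exact: bcD.
  by move=> t; rewrite -lerBlDl; apply: le_trans (ler_norm _) (hfg t).
rewrite ler_norml; apply/andP; split.
  by have := half _ _ c2 c1 (fun t => eq_ind_r (fun v => v <= _) (key t) (distrC _ _)); lra.
by have := half _ _ c1 c2 key; lra.
Qed.

(** The differences of absolute values over k equal cells telescope. *)
Lemma ramp_subdivision a b (k : nat) t : a < b -> (0 < k)%N ->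
  ramp a b t = k%:R^-1 * \sum_(j < k)
    ramp (a + j%:R * ((b - a) / k%:R)) (a + j.+1%:R * ((b - a) / k%:R)) t.
Proof.
move=> ab k0; have kR : 0 < k%:R :> R by rewrite ltr0n.
set h := (b - a) / k%:R.
pose g (j : nat) : R := `|a + j%:R * h - t|.
have hk : k%:R * h = b - a by rewrite /h mulrC divfK// gt_eqF.
have -> : \sum_(j < k) ramp (a + j%:R * h) (a + j.+1%:R * h) t =
    \sum_(j < k) (2^-1 + (2 * h)^-1 * (g j.+1 - g j)).
  apply: eq_bigr => j _; rewrite /ramp /g; congr (_ + (2 * _)^-1 * _).
  by rewrite -natr1; ring.
rewrite big_split/= sumr_const card_ord -mulr_sumr.
rewrite -(big_mkord xpredT (fun j => g j.+1 - g j)) telescope_sumr//.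
rewrite /g mul0r addr0 hk [a + _]addrC subrK /ramp [RHS]mulrDr; congr (_ + _).
  by rewrite -[2^-1 *+ k]mulr_natl mulrA mulVf ?mul1r// gt_eqF.
rewrite mulrA; congr (_ * _); rewrite -hk; field.
by rewrite (gt_eqF kR) /h mulf_neq0 ?invr_eq0 ?subr_eq0 ?(gt_eqF ab) ?(gt_eqF kR).
Qed.

(** F may jump, so the squeeze says little about one ramp. Cut into k ramps, the discrepancy of each
    is at most an increment of F over two cells; the increments add up to at most 2, and the average
    over k tends to 0. The passage from ramps to all functions is [class_continuous]. *)
Lemma mean_ext M M' (F : R -> R) : mean_functional M -> mean_functional M' ->
  (forall x, 0 <= F x <= 1) ->
  (forall x a b, x < a -> a < b -> F x <= M (ramp a b) <= F b) ->
  (forall x a b, x < a -> a < b -> F x <= M' (ramp a b) <= F b) ->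
  forall phi, bounded_continuous phi -> M phi = M' phi.
Proof.
move=> hM hM' F01 hF hF' phi [cphi [B hB]].
pose V f := bounded_continuous f /\ M f = M' f.
have [Mc MD MZ Mle Mt] := hM; have [Mc' MD' MZ' Mle' Mt'] := hM'.
suff [] : V phi by [].
apply: (@class_continuous R V _ _ _ _ _ phi B) => //.
- by move=> a; split; [exact: bc_cst|rewrite Mc Mc'].
- by move=> f g [cf ef] [cg eg]; split; [exact: bcD|rewrite MD// MD'// ef eg].
- by move=> a f [cf ef]; split; [exact: bcZ|rewrite MZ// MZ'// ef].
- move=> f K K' cf hK happ; have bf : bounded_continuous f by split => //; exists K.
  split => //; apply/eqP; rewrite -subr_eq0 -normr_le0; apply/ler_addgt0Pr => e e0.
  rewrite add0r.
  have K0 : 0 <= K + `|K'| by apply: addr_ge0 => //; exact: le_trans (hK 0).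
  have e4 : 0 < e / 4 by rewrite divr_gt0.
  have eK : 0 < e / 4 / (K + `|K'| + 1) by rewrite divr_gt0// ltr_wpDl.
  have [L1 L10 h1] := Mt _ eK; have [L2 L20 h2] := Mt' _ eK.
  have bound N L : mean_functional N -> 0 < L -> N (tailfun L) <= e / 4 / (K + `|K'| + 1) ->
      (K + `|K'|) * N (tailfun L) <= e / 4.
    move=> _ _ h; apply: le_trans (ler_wpM2l K0 h) _.
    rewrite mulrCA ler_piMr ?(ltW e4)// ler_pdivrMr ?mul1r ?lerDl// ltr_wpDl//.
  have L12 : 0 < Num.max L1 L2 by rewrite lt_max L10.
  have [psi [[bpsi epsi] hpsi happr]] := happ (e / 4) (Num.max L1 L2) e4 L12.
  have hpsi' t : `|psi t| <= `|K'| by apply: le_trans (hpsi t) (ler_norm _).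
  have a1 : `|M f - M psi| <= e / 4 + (K + `|K'|) * M (tailfun L1).
    apply: mean_approx => //; first exact: ltW.
    by move=> t tL; apply: happr; rewrite le_max tL.
  have a2 : `|M' f - M' psi| <= e / 4 + (K + `|K'|) * M' (tailfun L2).
    apply: mean_approx => //; first exact: ltW.
    by move=> t tL; apply: happr; rewrite le_max tL orbT.
  have b1 := bound _ _ hM L10 h1; have b2 := bound _ _ hM' L20 h2.
  have -> : M f - M' f = (M f - M psi) - (M' f - M' psi) by rewrite epsi; ring.
  apply: le_trans (ler_normB _ _) _; lra.
move=> a b ab; split; first exact: bc_ramp.
apply/eqP; rewrite -subr_eq0 -normr_le0; apply/ler_addgt0Pr => e e0; rewrite add0r.
have [k k0 hk] : exists2 k : nat, (0 < k)%N & 2 / e <= k%:R.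
  exists (Num.truncn (2 / e)).+1 => //; exact: ltW (truncnS_gt _).
have kR : 0 < k%:R :> R by rewrite ltr0n.
set h := (b - a) / k%:R; have h0 : 0 < h by rewrite divr_gt0// subr_gt0.
pose r (j : nat) := ramp (a + j%:R * h) (a + j.+1%:R * h).
have jlt (j : nat) : a + j%:R * h < a + j.+1%:R * h by rewrite ltrD2l ltr_pM2r// ltr_nat.
have cr j : bounded_continuous (r j) by exact: bc_ramp.
have E N : mean_functional N -> N (ramp a b) = k%:R^-1 * \sum_(j < k) N (r j).
  move=> hN; have [_ _ NZ _ _] := hN.
  rewrite (_ : ramp a b = fun t => k%:R^-1 * \sum_(j < k) r j t); last first.
    by apply/funext => t; exact: ramp_subdivision.
  have cs := @bc_sum _ (index_enum 'I_k) (fun j : 'I_k => r j) (fun j => cr j).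
  by rewrite (NZ _ _ cs) (@mean_sum N _ (index_enum 'I_k) (fun j : 'I_k => r j) hN (fun j => cr j)).
rewrite !E// -mulrBr -sumrB normrM ger0_norm ?invr_ge0//.
(* The grid is shifted one cell to the left, because the lower bound by F requires a point strictly
   before the ramp. *)
pose s (j : nat) := a + (j%:R - 1) * h.
have sF j : s j < a + j%:R * h by rewrite ltrD2l ltr_pM2r// ltrBlDr ltrDl.
have sS j : s j.+2 = a + j.+1%:R * h by rewrite /s -!natr1; ring.
have le1 : `|\sum_(j < k) (M (r j) - M' (r j))| <= 2.
  apply: le_trans (ler_norm_sum _ _ _) _.
  apply: (@le_trans _ _ (\sum_(j < k) ((F (s j.+2) - F (s j.+1)) + (F (s j.+1) - F (s j))))).
    apply: ler_sum => j _; have := hF _ _ _ (sF j) (jlt j); have := hF' _ _ _ (sF j) (jlt j).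
    rewrite -/(r j) -sS => /andP[? ?] /andP[? ?].
    by rewrite ler_norml; apply/andP; split; lra.
  rewrite big_split/= -(big_mkord xpredT (fun j => F (s j.+2) - F (s j.+1))).
  rewrite -(big_mkord xpredT (fun j => F (s j.+1) - F (s j))).
  rewrite (telescope_sumr (fun j => F (s j.+1)))// telescope_sumr//.
  have /andP[? ?] := F01 (s k.+1); have /andP[? ?] := F01 (s k).
  have /andP[? ?] := F01 (s 1%N); have /andP[? ?] := F01 (s 0%N); lra.
apply: le_trans (ler_wpM2l _ le1) _; first by rewrite invr_ge0.
by rewrite mulrC ler_pdivrMr// mulrC -ler_pdivrMr.
Qed.

End MeanFunctional.

(** * Representation of mean functionals by probability measures *)

Section RieszMarkov.
Context {R : realType}.
Implicit Types (phi psi : R -> R) (a b x e : R) (M : (R -> R) -> R) (N : probability R R).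

Lemma bc_bmf phi : bounded_continuous phi -> bmf phi.
Proof. by move=> [cphi hB]; split => //; exact: continuous_measurable_fun. Qed.

(** Dominated convergence with the constant 2: this is the tightness of a probability measure. *)
Lemma Ex_tailfun_cvg N : Ex N (tailfun n.+1%:R) @[n --> \oo] --> (0 : R).
Proof.
have mt n : measurable_fun setT (EFin \o tailfun (n.+1%:R : R)).
  by apply/measurable_EFinP; exact: (bc_bmf (bc_tailfun _)).1.
have pt x : setT x -> (EFin \o tailfun (n.+1%:R : R)) x @[n --> \oo] --> 0%E.
  move=> _; apply: cvg_EFin; first by near=> n.
  apply/cvgrPdist_le => e e0.
  near=> n; rewrite /= sub0r normrN ger0_norm ?tailfun_ge0//.
  have n0 : 0 < n.+1%:R :> R by [].
  have D0 : 0 < x ^+ 2 + n.+1%:R ^+ 2 :> R by rewrite ltr_wpDl ?sqr_ge0// exprn_gt0.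
  have -> : tailfun n.+1%:R x = 2 * x ^+ 2 / (x ^+ 2 + n.+1%:R ^+ 2).
    by move: (n.+1%:R : R) D0 => L D0; rewrite /tailfun; field; rewrite gt_eqF.
  rewrite ler_pdivrMr// mulrDr; apply: (@le_trans _ _ (e * n.+1%:R ^+ 2)); last first.
    by rewrite lerDr mulr_ge0 ?sqr_ge0// ltW.
  have h0 : 2 * x ^+ 2 / e <= n%:R by near: n; apply: nbhs_infty_ger; rewrite num_real.
  have h1 : 2 * x ^+ 2 / e <= n.+1%:R by apply: le_trans h0 _; rewrite ler_nat.
  rewrite -ler_pdivrMl// mulrC.
  apply: le_trans h1 _; rewrite expr2 ler_peMr// ler1n//.
have fin (x : R) : setT x -> (2%:E : \bar R) \is a fin_num by [].
have ig : N.-integrable setT (fun=> 2%:E : \bar R).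
  exact: (bmf_int N (bmf_cst 2)).
have hb n x : setT x -> (`|(EFin \o tailfun (n.+1%:R : R)) x| <= 2%:E)%E.
  by move=> _; rewrite /= lee_fin ger0_norm ?tailfun_ge0// tailfun_le2.
have := dominated_cvg measurableT mt pt fin ig hb.
rewrite integral0 => /fine_cvg; exact.
Unshelve. all: by end_near. Qed.

Lemma mean_functional_Ex N : mean_functional (Ex N).
Proof.
split.
- by move=> a; exact: Ex_cst.
- by move=> f g cf cg; apply: ExD; exact: bc_bmf.
- by move=> a f cf; apply: ExZ; exact: bc_bmf.
- by move=> f g cf cg; apply: Ex_le; exact: bc_bmf.
- move=> e e0; have /cvgrPdist_le/(_ e e0) := Ex_tailfun_cvg N.
  move=> /filter_ex[n]; rewrite sub0r normrN => h.
  by exists n.+1%:R => //; apply: le_trans (ler_norm _) h.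
Qed.

Lemma Ex_indic d (T : measurableType d) (P : probability T R) (A : set T) :
  measurable A -> Ex P \1_A = fine (P A).
Proof. by move=> mA; rewrite /Ex /Rintegral integral_indic// setIT. Qed.

Lemma bmf_indic d (T : measurableType d) (A : set T) :
  measurable A -> bmf (\1_A : T -> R).
Proof.
move=> mA; split; first exact: measurable_indic.
by exists 1 => t; rewrite indicE; case: (t \in A); rewrite ?normr1 ?normr0.
Qed.

Lemma cdf_ramp N x a b : x < a -> a < b ->
  fine (N `]-oo, x]%classic) <= Ex N (ramp a b) <= fine (N `]-oo, b]%classic).
Proof.
move=> xa ab; have bR := bc_bmf (bc_ramp ab).
rewrite -!Ex_indic//; apply/andP; split; apply: Ex_le => //; try exact: bmf_indic.
- move=> t; rewrite indicE; case: (boolP (t \in _)) => [|_]; last by rewrite ramp_ge0.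
  rewrite inE /= in_itv /= => tx; rewrite ramp_le//.
  exact: le_trans tx (ltW xa).
- move=> t; rewrite indicE; case: (boolP (t \in _)) => [_|]; first by rewrite ramp_le1.
  move=> tb; rewrite ramp_ge// leNgt; apply: contra tb => tb.
  by rewrite inE /= in_itv /= ltW.
Qed.

Variable M : (R -> R) -> R.
Hypothesis hM : mean_functional M.

(** The infimum [F] of [E] is the candidate distribution function. Ramps descending strictly to the
    right of x are used, and this yields right continuity. *)
Let E x := [set v | exists a b, [/\ x < a, a < b & v = M (ramp a b)]].
Let F x := inf (E x).

Let M_ramp a b : a < b -> 0 <= M (ramp a b) <= 1.
Proof.
move=> ab; have [Mc _ _ Mle _] := hM; have bR := bc_ramp ab.
apply/andP; split; [rewrite -[leLHS](Mc 0)|rewrite -[leRHS](Mc 1)].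
  by apply: Mle; [exact: bc_cst|exact: bR|move=> t; exact: ramp_ge0].
by apply: Mle; [exact: bR|exact: bc_cst|move=> t; exact: ramp_le1].
Qed.

Let E_lb x : has_lbound (E x).
Proof. by exists 0 => v [a [b [_ /M_ramp/andP[? _] ->]]]. Qed.

Let E_ne x : E x !=set0.
Proof.
by exists (M (ramp (x + 1) (x + 2))), (x + 1), (x + 2); split => //; rewrite ?ltrDl// ltrD2l ltr1n.
Qed.

Let F_le x a b : x < a -> a < b -> F x <= M (ramp a b).
Proof. by move=> xa ab; apply: ge_inf => //; exists a, b. Qed.

Let F_ge x a b : a < b -> b <= x -> M (ramp a b) <= F x.
Proof.
move=> ab bx; have [_ _ _ Mle _] := hM; apply: lb_le_inf => // v [a' [b' [xa ab' ->]]].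
apply: Mle; [exact: bc_ramp|exact: bc_ramp|] => t.
have [ta|ta] := leP t a'; first by rewrite (ramp_le ab' ta) ramp_le1.
rewrite ramp_ge ?ramp_ge0//; apply: le_trans bx _; apply: ltW; exact: lt_trans xa ta.
Qed.

Let F01 x : 0 <= F x <= 1.
Proof.
apply/andP; split; first by apply: lb_le_inf => // v [a [b [_ /M_ramp/andP[? _] ->]]].
have h : x + 1 < x + 2 by rewrite ltrD2l ltr1n.
by apply: le_trans (F_le _ h) _; [rewrite ltrDl|case/andP: (M_ramp h)].
Qed.

Let F_nd : nondecreasing F.
Proof.
move=> x y xy; apply: lb_le_inf => // v [a [b [ya ab ->]]].
by apply: F_le => //; exact: le_lt_trans ya.
Qed.

(** A ramp that nearly attains the infimum at x starts at some a > x, hence is admissible for every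
    y between x and a. *)
Let F_rc : right_continuous F.
Proof.
move=> x; apply/cvgrPdist_le => e e0.
have [v [a [b [xa ab ->]]] hv] := inf_adherent e0 (conj (E_ne x) (E_lb x)).
near=> y; have xy : x < y by near: y; exact: nbhs_right_gt.
have ya : y < a by near: y; exact: nbhs_right_lt.
have h1 := F_nd (ltW xy); have h2 := F_le ya ab; rewrite -/(F x) in hv.
by rewrite ler_norml; apply/andP; split; lra.
Unshelve. all: by end_near. Qed.

Let F_Ny : F @ -oo --> (0 : R).
Proof.
apply/cvgrPdist_le => e e0; have [_ _ _ Mle Mt] := hM; have [L L0 hL] := Mt _ e0.
near=> x; have xL : x < - L - 1.
  by near: x; apply: nbhs_ninfty_lt; rewrite num_real.
have /andP[F0 _] := F01 x; rewrite sub0r normrN ger0_norm//.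
have ab : - L - 1 < - L by rewrite gtrDl oppr_lt0.
apply: le_trans (F_le xL ab) _; apply: le_trans hL; apply: Mle.
- exact: bc_ramp.
- exact: bc_tailfun.
- move=> t; have [tL|tL] := leP (- L) t.
    by rewrite ramp_ge// tailfun_ge0.
  apply: le_trans (ramp_le1 _ ab) _; apply: tailfun_ge1 => //.
  by rewrite ler0_norm; lra.
Unshelve. all: by end_near. Qed.

Let F_y : F @ +oo --> (1 : R).
Proof.
apply/cvgrPdist_le => e e0; have [Mc MD MZ Mle Mt] := hM; have [L L0 hL] := Mt _ e0.
near=> x; have xL : L + 1 <= x.
  by near: x; apply: nbhs_pinfty_ge; rewrite num_real.
have /andP[_ F1] := F01 x; rewrite ger0_norm ?subr_ge0//.
have ab : L < L + 1 by rewrite ltrDl.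
have h1 := F_ge ab xL; have bT := bc_tailfun L0; have bR := bc_ramp ab.
have : M (fun=> 1) <= M (fun t => ramp L (L + 1) t + tailfun L t).
  apply: Mle; [exact: bc_cst|exact: bcD|] => t.
  have [tL|/ltW tL] := leP t L; first by rewrite ramp_le// lerDl tailfun_ge0.
  rewrite -[leLHS]add0r; apply: lerD; first exact: ramp_ge0.
  by apply: tailfun_ge1 => //; apply: le_trans tL (ler_norm _).
by rewrite Mc MD// => h2; lra.
Unshelve. all: by end_near. Qed.

(** The expectation under the measure with distribution function [F] and the functional [M] are
    squeezed on ramps by the same [F], so [mean_ext] identifies them. *)
Lemma mean_functional_riesz :
  exists N : probability R R, forall phi, bounded_continuous phi -> Ex N phi = M phi.
Proof.
have [N hN] := probability_of_cdf F_nd F_rc F_Ny F_y; exists N.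
apply: (mean_ext (F := F)) => //.
- exact: mean_functional_Ex.
- by move=> x a b xa ab; have := cdf_ramp N xa ab; rewrite !hN.
- by move=> x a b xa ab; rewrite F_le//= F_ge.
Qed.

End RieszMarkov.

(** * Integrals against the empirical spectral distribution *)

Section EmpiricalMean.
Context {R : realType} (n : nat) (A : 'M[R]_n).

Lemma integral_esd_ge0 (g : R -> R) : measurable_fun setT g -> (forall t, 0 <= g t) ->
  (\int[esd A]_x (g x)%:E = (n%:R^-1 * \sum_(l <- eigenvalues A) g l)%:E)%E.
Proof.
move=> mg g0; have mg' : measurable_fun setT (EFin \o g) by exact/measurable_EFinP.
have g0' x : setT x -> (0 <= (g x)%:E)%E by rewrite lee_fin.
rewrite /esd ge0_integral_mscale// ge0_integral_measure_sum// EFinM; congr (_ * _)%E.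
rewrite (big_nth 0) big_mkord -sumEFin; apply: eq_bigr => i _.
by rewrite integral_dirac// diracE mem_set// mul1e.
Qed.

Lemma esd_setT_fin : (esd A setT < +oo)%E.
Proof.
have := @integral_esd_ge0 (fun=> 1) (measurable_cst _) (fun=> ler01).
by rewrite integral_cst// mul1e => ->; rewrite ltry.
Qed.

Lemma Rintegral_esd (phi : R -> R) : bmf phi ->
  \int[esd A]_x phi x = n%:R^-1 * \sum_(l <- eigenvalues A) phi l.
Proof.
move=> [mphi [B hB]]; have B0 : 0 <= B by exact: le_trans (hB 0).
have fB (f : R -> R) (K : R) : measurable_fun setT f -> (forall t, `|f t| <= K) ->
    (esd A).-integrable setT (EFin \o f).
  move=> mf hf; apply: measurable_bounded_integrable => //; first exact: esd_setT_fin.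
  exists K; split; first exact: num_real.
  by move=> y Ky x _; apply: le_trans (hf x) _; exact: ltW.
have m1 : measurable_fun setT (fun x => phi x + B).
  by apply: measurable_funD => //; exact: measurable_cst.
(* Both phi + B and B are nonnegative, so the formula for nonnegative integrands applies to each. *)
have -> : \int[esd A]_x phi x = \int[esd A]_x ((phi x + B) - B).
  by congr (Rintegral _ _ _); apply/funext => x; rewrite addrK.
rewrite RintegralB//; first last.
- by apply: (fB _ B) => // t; rewrite ger0_norm.
- apply: (fB _ (B + B)) => // t; apply: le_trans (ler_normD _ _) _; apply: lerD => //.
  by rewrite ger0_norm.
rewrite /Rintegral integral_esd_ge0//; last first.
  by move=> t; have := hB t; rewrite ler_norml => /andP[? _]; lra.
rewrite (integral_esd_ge0 (g := fun=> B))// /= -mulrBr -sumrB.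
by congr (_ * _); apply: eq_bigr => l _; rewrite addrK.
Qed.

End EmpiricalMean.

(** * Weak limit of the empirical means *)

Section WeakLimit.
Context {R : realType}.
Variables (d : nat -> measure_display)
  (T : forall n, measurableType (d n)) (P : forall n, probability (T n) R)
  (eig : forall n, T n -> seq R).
Hypothesis size_eig : forall n w, size (@eig n w) = n.
Variable F : R[i] -> R[i].
Hypothesis ker_meas : forall z, 0 < complex.Im z -> forall n,
  cmeas (fun w => n%:R^-1 * \sum_(l <- @eig n w) stieltjes_kernel z l).
Hypothesis ker_cvg : forall z, 0 < complex.Im z -> forall e : R, 0 < e ->
  \forall n \near \oo, Ex (P n) (fun w =>
    cabs (n%:R^-1 * \sum_(l <- @eig n w) stieltjes_kernel z l - F z)) <= e.
Hypothesis F_tight : forall e : R, 0 < e -> exists L : R, 0 < L /\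
  1 - L * complex.Im (F (Complex 0 L)) <= e.
Implicit Types (phi psi : R -> R) (z : R[i]).

Let cv phi := self_averaging P eig phi.

Let conv_poisson e c : 0 < e -> cv (fun t => poisson e (c - t)).
Proof.
move=> e0; have z0 : 0 < complex.Im (Complex c e) by [].
rewrite (_ : (fun t => _) = fun t => complex.Im (stieltjes_kernel (Complex c e) t)).
  exact: (savg_Im_kernel size_eig ker_meas ker_cvg z0).
by apply/funext => t; rewrite Im_kernel /poisson /= -[c - t]opprB sqrrN.
Qed.

Let conv_conj_poisson e c : 0 < e -> cv (fun t => conj_poisson e (c - t)).
Proof.
move=> e0; have z0 : 0 < complex.Im (Complex c e) by [].
rewrite (_ : (fun t => _) = fun t => -1 * complex.Re (stieltjes_kernel (Complex c e) t)).
  by apply: (savgZ size_eig); exact: (savg_Re_kernel size_eig ker_meas ker_cvg z0).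
apply/funext => t; rewrite Re_kernel /conj_poisson /= -[c - t]opprB sqrrN.
by rewrite mulN1r -mulNr.
Qed.

Let conv_bc phi : bounded_continuous phi -> cv phi.
Proof.
move=> [cphi [B hB]].
have cst a : cv (fun=> a) by exact: (savg_cst P size_eig).
have D f g : cv f -> cv g -> cv (fun t => f t + g t) by exact: (savgD size_eig).
have Z a f : cv f -> cv (fun t => a * f t) by exact: (savgZ size_eig).
have app f (K K' : R) : continuous f -> (forall t, `|f t| <= K) ->
  (forall e L : R, 0 < e -> 0 < L -> exists psi, [/\ cv psi, forall t, `|psi t| <= K' &
     forall t, `|t| <= L -> `|f t - psi t| <= e]) -> cv f.
  by move=> _; exact: (savg_approx size_eig ker_meas ker_cvg F_tight).
have uni f : (forall e : R, 0 < e -> exists psi, cv psi /\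
    forall t, `|f t - psi t| <= e) -> cv f by exact: (savg_unif size_eig ker_meas ker_cvg F_tight).
have prim (Psi psi : R -> R) (K a b : R) : a < b ->
  (forall r : R, is_derive r 1 Psi (psi r)) ->
  (forall r s, `|psi r - psi s| <= K * `|r - s|) ->
  (forall c, cv (fun t => psi (c - t))) ->
  cv (fun t => Psi (b - t) - Psi (a - t)) by exact: (savg_primitive size_eig ker_meas ker_cvg F_tight).
apply: (@class_continuous R cv cst D Z app _ phi B) => // a b ab.
exact: (@class_ramp R cv cst D Z app uni conv_poisson conv_conj_poisson prim a b ab).
Qed.

Let X phi n := @linstat R d T eig phi n.

(** In [self_averaging] the constant may depend on e. The expectations form a Cauchy sequence, and
    its limit serves for all e. *)
Let Ex_cvg phi : cv phi -> exists l : R, forall e : R, 0 < e ->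
  \forall n \near \oo, Ex (P n) (fun w => `|X phi w - l|) <= e.
Proof.
move=> cphi; have [_ _ hphi] := cphi.
pose u n := Ex (P n) (@X phi n).
have bX n : bmf (@X phi n) by exact: (savg_bmf size_eig n cphi).
have hu n l : `|u n - l| <= Ex (P n) (fun w => `|X phi w - l|).
  rewrite /u -{1}(Ex_cst (P n) l) -ExB//; last exact: bmf_cst.
  by apply: Ex_norm; apply: bmfB => //; exact: bmf_cst.
have cu : cvg (u n @[n --> \oo]).
  apply/cauchy_cvgP/cauchy_exP => e e0.
  have e2 : 0 < e / 2 by rewrite divr_gt0.
  have [l hl] := hphi _ e2; exists l.
  suff : \forall n \near \oo, ball l e (u n) by [].
  near=> n; rewrite /ball /= distrC.
  apply: le_lt_trans (hu n l) _; apply: (@le_lt_trans _ _ (e / 2)); first by near: n.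
  by rewrite ltr_pdivrMr// ltr_pMr// ltr1n.
exists (lim (u n @[n --> \oo])) => e e0; have e3 : 0 < e / 3 by rewrite divr_gt0.
have [l hl] := hphi _ e3; have /cvgrPdist_le/(_ _ e3) hlim := cu.
near=> n; apply: (@le_trans _ _ (Ex (P n) (fun w => `|X phi w - l| + 2 * (e / 3)))); last first.
  rewrite ExD ?Ex_cst; [|by apply: bmf_norm; apply: bmfB => //; exact: bmf_cst|exact: bmf_cst].
  have : Ex (P n) (fun w => `|X phi w - l|) <= e / 3 by near: n.
  by move=> h; lra.
apply: Ex_le.
- by apply: bmf_norm; apply: bmfB => //; exact: bmf_cst.
- by apply: bmfD; [apply: bmf_norm; apply: bmfB => //|]; exact: bmf_cst.
move=> w; have -> : X phi w - lim (u n @[n --> \oo]) =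
  (X phi w - l) - ((u n - l) + (lim (u n @[n --> \oo]) - u n)) by ring.
apply: le_trans (ler_normB _ _) _; apply: lerD => //.
apply: le_trans (ler_normD _ _) _.
have h1 : `|u n - l| <= e / 3 by apply: le_trans (hu n l) _; near: n.
have h2 : `|lim (u n @[n --> \oo]) - u n| <= e / 3 by near: n.
by apply: le_trans (lerD h1 h2) _; lra.
Unshelve. all: by end_near. Qed.

Lemma linstat_weak_limit : exists N : probability R R, forall phi, bounded_continuous phi ->
  (forall n, bmf (@linstat R d T eig phi n)) /\
  forall e : R, 0 < e -> \forall n \near \oo,
    Ex (P n) (fun w => `|linstat eig phi w - Ex N phi|) <= e.
Proof.
(* The functional is defined by choosing a limit for every function, with the value 0 where the
   statistics do not self-average. *)
have : forall phi, exists l : R, cv phi -> forall e : R, 0 < e ->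
    \forall n \near \oo, Ex (P n) (fun w => `|X phi w - l|) <= e.
  move=> phi; have [/Ex_cvg[l hl]|ncv] := pselect (cv phi); first by exists l.
  by exists 0.
move=> /choice[M hM].
have bX phi n : bounded_continuous phi -> bmf (@X phi n).
  by move=> /conv_bc c; exact: (savg_bmf size_eig n c).
have lim_u phi : bounded_continuous phi -> Ex (P n) (@X phi n) @[n --> \oo] --> M phi.
  move=> bphi; apply/cvgrPdist_le => e e0; have := hM phi (conv_bc bphi) e e0.
  apply: filterS => n; apply: le_trans; rewrite distrC -{1}(Ex_cst (P n) (M phi)) -ExB.
  - by apply: Ex_norm; apply: bmfB; [exact: bX|exact: bmf_cst].
  - exact: bX.
  - exact: bmf_cst.
suff mM : mean_functional M.
  have [N hN] := mean_functional_riesz mM; exists N => phi bphi; split.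
    by move=> n; exact: bX.
  by rewrite hN//; exact: hM (conv_bc bphi).
split.
- move=> a; apply: (cvg_unique _ (lim_u _ (bc_cst a))) => //.
  apply: cvg_near_cst; near=> n; rewrite -[RHS](Ex_cst (P n) a); apply: Ex_eq => w.
  by apply: (linstat_cst size_eig); near: n; exact: nbhs_infty_gt.
- move=> phi psi b1 b2; apply: (cvg_unique _ (lim_u _ (bcD b1 b2))) => //.
  rewrite (_ : (fun n => _) = fun n => Ex (P n) (@X phi n) + Ex (P n) (@X psi n)).
    by apply: cvgD; exact: lim_u.
  apply/funext => n; rewrite -ExD; [|exact: bX|exact: bX].
  by apply: Ex_eq => w; exact: linstatD.
- move=> a phi b1; apply: (cvg_unique _ (lim_u _ (bcZ a b1))) => //.
  rewrite (_ : (fun n => _) = fun n => a * Ex (P n) (@X phi n)).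
    by apply: cvgMr; exact: lim_u.
  apply/funext => n; rewrite -ExZ; last exact: bX.
  by apply: Ex_eq => w; exact: linstatZ.
- move=> phi psi b1 b2 h; apply: (ler_cvg_to (lim_u _ b1) (lim_u _ b2)).
  near=> n; apply: Ex_le; [exact: bX|exact: bX|] => w; exact: linstat_le.
- move=> e e0; have [L [L0 hL]] := tail_small size_eig ker_meas ker_cvg F_tight e0.
  exists L => //; apply: (ler_cvg_to (lim_u _ (bc_tailfun L0)) (cvg_cst e)).
  by near=> n; near: n.
Unshelve. all: by end_near. Qed.

End WeakLimit.

(** * Roots of the cubic and Stieltjes transforms *)

Section CubicRoots.
Context {R : realType}.
Local Notation C := R[i].
Variable c : R.
Hypothesis c0 : 0 < c.
Implicit Types z f g w : C.

Definition cubic z f : C :=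
  z * f ^+ 3 + (1 - 2 * real_complex R c) * f ^+ 2 - z * f - 1.

Lemma cubic_conj z f : cubic z f = 0 -> cubic (conjc z) (conjc f) = 0.
Proof.
move=> /(congr1 (@conjc R)); rewrite /cubic conjc0 => <-.
have cr : conjc (real_complex R c) = real_complex R c by rewrite /= oppr0.
by rewrite !(rmorphB, rmorphD, rmorphM, rmorphXn, rmorph1) -{1}cr.
Qed.

(** A real root would also solve the conjugate equation, so f^3 = f and (1 - 2 c) f^2 = 1; neither f
    = 0 nor f^2 = 1 is compatible with c > 0. *)
Lemma cubic_Im_gt0 z f : 0 < complex.Im z -> 0 <= complex.Im f -> cubic z f = 0 ->
  0 < complex.Im f.
Proof.
move=> z0 f0 hf; rewrite lt_def f0 andbT; apply/eqP => If0.
have cf : conjc f = f by case: (f) If0 => a b /= ->; rewrite oppr0.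
have := cubic_conj hf; rewrite cf => hf'.
have zz : z - conjc z != 0.
  rewrite subr_eq0; apply/eqP => /(congr1 (@complex.Im R)) h.
  have : complex.Im z = - complex.Im z by rewrite {1}h; case: (z).
  by move: (complex.Im z) z0 => b b0 hb; lra.
have h1 : (z - conjc z) * (f ^+ 3 - f) = 0.
  by rewrite -(subrr (0 : C)) -{1}hf -hf' /cubic; ring.
have {h1}h1 : f ^+ 3 - f = 0 by apply/eqP; move/eqP: h1; rewrite mulf_eq0 (negbTE zz).
have h2 : (1 - 2 * real_complex R c) * f ^+ 2 - 1 = 0.
  by rewrite -hf /cubic -[LHS]addr0 -(mulr0 z) -h1; ring.
have : f * (f ^+ 2 - 1) = 0 by rewrite -h1; ring.
move/eqP; rewrite mulf_eq0 => /orP[/eqP f00|/eqP f1].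
  by move: h2; rewrite f00 expr0n mulr0 sub0r => /eqP; rewrite oppr_eq0 oner_eq0.
have : real_complex R (2 * c) = 0.
  have e1 : f ^+ 2 = 1 by apply/eqP; rewrite -subr_eq0 f1.
  move: h2; rewrite e1 rmorphM rmorph_nat => h2.
  by apply/eqP; rewrite -oppr_eq0 -h2; apply/eqP; ring.
by move/eqP; rewrite fmorph_eq0 mulf_eq0 pnatr_eq0 /= gt_eqF.
Qed.

Lemma cIm_inv w : complex.Im w^-1 = - complex.Im w / cabs w ^+ 2.
Proof. by rewrite cabs_sqr; case: w => a b /=; rewrite mulNr. Qed.

(** The strict inequality is the imaginary part of the partial fraction form of z, divided by Im f:
    the difference of its two sides is Im z / Im f > 0. *)
Lemma cubic_root_bound z f : 0 < complex.Im z -> 0 < complex.Im f -> cubic z f = 0 ->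
  [/\ f != 0, f - 1 != 0, f + 1 != 0,
      z = - f^-1 + real_complex R c * ((f - 1)^-1 + (f + 1)^-1) &
      c * (cabs (f - 1) ^- 2 + cabs (f + 1) ^- 2) < cabs f ^- 2].
Proof.
move=> z0 f0 hf.
have nz w : complex.Im w = complex.Im f -> w != 0.
  by move=> h; apply: contraTneq f0 => w0; rewrite -h w0 /= ltxx.
have n0 : f != 0 by exact: nz.
have n1 : f - 1 != 0 by apply: nz; rewrite cImD /= oppr0 addr0.
have n2 : f + 1 != 0 by apply: nz; rewrite cImD /= addr0.
have e : z = - f^-1 + real_complex R c * ((f - 1)^-1 + (f + 1)^-1).
  have fn : f * (f - 1) * (f + 1) != 0 by rewrite !mulf_neq0.
  apply: (mulfI fn); apply/eqP; rewrite -subr_eq0 -hf; apply/eqP.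
  by rewrite /cubic; field; rewrite n0 n1 n2.
split=> //.
have := congr1 (@complex.Im R) e.
rewrite cImD cImN cImM cImD !cIm_inv !cImD cImN /= mul0r addr0 oppr0 !addr0 => hI.
have i0 : 0 < complex.Im z / complex.Im f by rewrite divr_gt0.
have : complex.Im z / complex.Im f =
   cabs f ^- 2 - c * (cabs (f - 1) ^- 2 + cabs (f + 1) ^- 2).
  apply: (mulIf (lt0r_neq0 f0)); rewrite divfK ?lt0r_neq0// hI; ring.
by move=> h; rewrite -subr_gt0 -h.
Qed.

(* Two roots in the upper half-plane would satisfy
   1/(fg) = c/((f-1)(g-1)) + c/((f+1)(g+1)), against [cubic_root_bound] by
   Cauchy-Schwarz. *)
Lemma cubic_root_unique z f g : 0 < complex.Im z ->
  0 <= complex.Im f -> 0 <= complex.Im g -> cubic z f = 0 -> cubic z g = 0 -> f = g.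
Proof.
move=> z0 f0 g0 hf hg.
have [nf nf1 nf2 ef bf] := cubic_root_bound z0 (cubic_Im_gt0 z0 f0 hf) hf.
have [ng ng1 ng2 eg bg] := cubic_root_bound z0 (cubic_Im_gt0 z0 g0 hg) hg.
apply/eqP; rewrite -subr_eq0; apply/negPn/negP => fg.
have key : f^-1 * g^-1 =
    real_complex R c * ((f - 1)^-1 * (g - 1)^-1 + (f + 1)^-1 * (g + 1)^-1).
  apply: (mulfI fg); apply/eqP; rewrite -subr_eq0 -(subrr z) {1}ef eg.
  by apply/eqP; field; rewrite nf nf1 nf2 ng ng1 ng2.
have : cabs f^-1 * cabs g^-1 <= c * (cabs (f - 1)^-1 * cabs (g - 1)^-1 +
    cabs (f + 1)^-1 * cabs (g + 1)^-1).
  rewrite -cabsM key cabsM cabs_real gtr0_norm//; apply: ler_wpM2l; first exact: ltW.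
  by rewrite -!cabsM; exact: cabsD.
rewrite -!exprVn -!cabsV in bf bg *.
have := cabs_ge0 f^-1; have := cabs_ge0 g^-1; have := cabs_ge0 (f - 1)^-1.
have := cabs_ge0 (g - 1)^-1; have := cabs_ge0 (f + 1)^-1; have := cabs_ge0 (g + 1)^-1.
move: bf bg; move: (cabs f^-1) (cabs g^-1) (cabs (f - 1)^-1) (cabs (g - 1)^-1).
move: (cabs (f + 1)^-1) (cabs (g + 1)^-1) => q s a b u v bf bg s0 q0 v0 u0 b0 a0 h.
(* Cauchy-Schwarz for (u, q) and (v, s), with defect (u s - q v)^2; the product of [bf] and [bg] is
   the reverse strict inequality. *)
have h1 : (a * b) ^+ 2 <= c ^+ 2 * ((u ^+ 2 + q ^+ 2) * (v ^+ 2 + s ^+ 2)).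
  apply: (@le_trans _ _ ((c * (u * v + q * s)) ^+ 2)).
    by rewrite ler_pXn2r// nnegrE mulr_ge0// ?(ltW c0)// addr_ge0// mulr_ge0.
  rewrite exprMn; apply: ler_wpM2l; first exact: sqr_ge0.
  by rewrite -subr_ge0; have := sqr_ge0 (u * s - q * v); move=> h2; lra.
have h2 : c ^+ 2 * ((u ^+ 2 + q ^+ 2) * (v ^+ 2 + s ^+ 2)) < a ^+ 2 * b ^+ 2.
  rewrite (_ : _ * _ = (c * (u ^+ 2 + q ^+ 2)) * (c * (v ^+ 2 + s ^+ 2))); last by ring.
  by apply: ltr_pM => //; rewrite mulr_ge0 ?(ltW c0)// addr_ge0 ?sqr_ge0.
by rewrite -exprMn in h2; have := lt_le_trans h2 h1 => // h3; have := le_lt_trans h1 h2; rewrite ltxx.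
Qed.

(** The cubic factors as (1 + z f)(f^2 - 1) = 2 c f^2, with |f^2 - 1| >= 1/2. At z = i L the real
    part of 1 + z f measures the mass far out, so this is the source of tightness. *)
Lemma cubic_resolvent_bound z f : 2 <= cabs z -> cabs f <= 2^-1 -> cubic z f = 0 ->
  cabs (1 + z * f) <= 4 * c * cabs f ^+ 2.
Proof.
move=> hz hf h0.
have e : (1 + z * f) * (f ^+ 2 - 1) = real_complex R (2 * c) * f ^+ 2.
  apply/eqP; rewrite -subr_eq0 -h0 rmorphM rmorph_nat; apply/eqP; rewrite /cubic; ring.
have := congr1 cabs e; rewrite cabsM [RHS]cabsM cabs_real cabsX gtr0_norm ?mulr_gt0// => e'.
have h1 : 2^-1 <= cabs (f ^+ 2 - 1).
  have := cabsB (f ^+ 2) (f ^+ 2 - 1); rewrite subKr cabs1 cabsX.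
  have := cabs_ge0 f; nra.
have := cabs_ge0 (1 + z * f); have := cabs_ge0 f; nra.
Qed.

End CubicRoots.

(** * Stieltjes transforms of measures *)

Section StieltjesTransform.
Context {R : realType}.
Implicit Types (N : {measure set R -> \bar R}) (z : R[i]).

Lemma continuous_kernel_den z : complex.Im z != 0 ->
  continuous (fun t : R => ((t - complex.Re z) ^+ 2 + complex.Im z ^+ 2)^-1).
Proof.
move=> z0 t; have D0 : 0 < (t - complex.Re z) ^+ 2 + complex.Im z ^+ 2.
  by rewrite ltr_wpDl ?sqr_ge0// lt_def sqrf_eq0 z0 sqr_ge0.
apply: cvgV; first by rewrite gt_eqF.
apply: cvgD; last exact: cvg_cst.
apply: (@continuous_comp _ _ _ (fun t => t - complex.Re z) (fun u => u ^+ 2)).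
  by apply: cvgB; [exact: cvg_id|exact: cvg_cst].
exact: exprn_continuous.
Qed.

Lemma cabs_kernel_bound z t : complex.Im z != 0 ->
  cabs (stieltjes_kernel z t) <= `|complex.Im z|^-1.
Proof.
move=> z0; rewrite /stieltjes_kernel cabsV lef_pV2 ?posrE ?normr_gt0//.
  by apply: le_trans (Im_le_cabs _); rewrite cImD cImN /= add0r normrN.
rewrite cabs_gt0 subr_eq0; apply: contraNneq z0 => <-.
by [].
Qed.

Lemma bc_Re_kernel z : complex.Im z != 0 ->
  bounded_continuous (fun t => complex.Re (stieltjes_kernel z t)).
Proof.
move=> z0; split; last first.
  exists `|complex.Im z|^-1 => t; exact: le_trans (Re_le_cabs _) (cabs_kernel_bound t z0).
under eq_fun do rewrite Re_kernel; move=> t; apply: cvgM; last exact: continuous_kernel_den.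
by apply: cvgB; [exact: cvg_id|exact: cvg_cst].
Qed.

Lemma bc_Im_kernel z : complex.Im z != 0 ->
  bounded_continuous (fun t => complex.Im (stieltjes_kernel z t)).
Proof.
move=> z0; split; last first.
  exists `|complex.Im z|^-1 => t; exact: le_trans (Im_le_cabs _) (cabs_kernel_bound t z0).
under eq_fun do rewrite Im_kernel; move=> t; apply: cvgMr; exact: continuous_kernel_den.
Qed.

Lemma stieltjes_conj N z : has_stieltjes N -> complex.Im z != 0 ->
  stieltjes N (conjc z) = conjc (stieltjes N z).
Proof.
move=> hN z0; have [_ i2] := hN z z0; rewrite /stieltjes /=; congr Complex.
  by congr (Rintegral _ _ _); apply/funext => t; rewrite !Re_kernel; case: (z) => a b /=; rewrite sqrrN.
rewrite -mulN1r -RintegralZl//.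
congr (Rintegral _ _ _); apply/funext => t; rewrite !Im_kernel; case: (z) => a b /=.
by rewrite sqrrN mulN1r mulNr.
Qed.

Lemma Im_stieltjes_ge0 N z : 0 < complex.Im z -> 0 <= complex.Im (stieltjes N z).
Proof.
move=> z0; apply: Rintegral_ge0 => t _; rewrite Im_kernel; apply: divr_ge0; first exact: ltW.
by rewrite addr_ge0 ?sqr_ge0.
Qed.

Lemma has_stieltjes_probability (N : probability R R) : has_stieltjes N.
Proof.
move=> z z0; split; apply: bmf_int; apply: bc_bmf.
  exact: bc_Re_kernel.
exact: bc_Im_kernel.
Qed.

(** In the upper half-plane both transforms have nonnegative imaginary part, so [cubic_root_unique]
    applies; conjugation gives the lower one. *)
Lemma stieltjes_cubic_unique (c : R) N N' : 0 < c ->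
  has_stieltjes N -> has_stieltjes N' ->
  solves_cubic c (stieltjes N) -> solves_cubic c (stieltjes N') ->
  forall z, complex.Im z != 0 -> stieltjes N z = stieltjes N' z.
Proof.
move=> c0 hN hN' sN sN'.
have pos z : 0 < complex.Im z -> stieltjes N z = stieltjes N' z.
  move=> z0; have zn : complex.Im z != 0 by rewrite gt_eqF.
  apply: (cubic_root_unique c0 z0) (sN z zn) (sN' z zn); exact: Im_stieltjes_ge0.
move=> z; rewrite neq_lt => /orP[z0|/pos//].
have zn : complex.Im (conjc z) != 0 by case: (z) z0 => a b /= b0; rewrite oppr_eq0 lt_eqF.
rewrite -(conjcK z) (stieltjes_conj hN zn) (stieltjes_conj hN' zn) pos//.
by case: (z) z0 => a b /=; rewrite oppr_gt0.
Qed.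

End StieltjesTransform.

(** * The limit law *)

Section LimitLaw.
Context {R : realType}.
Variables (m : nat -> nat) (d : nat -> measure_display)
  (T : forall n, measurableType (d n)) (P : forall n, probability (T n) R)
  (xi : forall n, 'I_(m n) -> T n -> bool)
  (x y : forall n, 'I_(m n) -> T n -> 'cV[R]_n) (p : nat -> R) (C0 k c : R).
Hypothesis c_gt0 : 0 < c.
Hypothesis hyps : forall e : R, 0 < e <= 1 -> \forall n \near \oo,
  loop_hyps (P n) (@xi n) (@x n) (@y n) C0 k c e (p n).
(** [A] is kept apart from [sum_mx]: the latter will be built on truncated vectors, and the two
    agree only almost surely. *)
Variable A : forall n, T n -> 'M[R]_n.
Hypothesis A_sym : forall n w, (@A n w)^T = A w.
Hypothesis A_ae : forall n, {ae P n, forall w, A w = sum_mx (@xi n) (@x n) (@y n) w}.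
Hypothesis A_meas : forall n i j, measurable_fun setT (fun w => @A n w i j).

Let eig n (w : T n) : seq R := eigenvalues (A w).

Let size_eig n w : size (@eig n w) = n.
Proof. by apply: size_eigenvalues; exact: A_sym. Qed.

Let ker_tr n (z : R[i]) (w : T n) : complex.Im z != 0 ->
  \sum_(l <- eig w) stieltjes_kernel z l = \tr (resolvent (A w) z).
Proof. by move=> z0; rewrite tr_resolvent//; exact: A_sym. Qed.

Let ker_meas z : 0 < complex.Im z -> forall n,
  cmeas (fun w => n%:R^-1 * \sum_(l <- @eig n w) stieltjes_kernel z l).
Proof.
move=> z0 n; have zn : complex.Im z != 0 by rewrite gt_eqF.
rewrite (_ : (fun w => _) = fun w => n%:R^-1 * \tr (resolvent (@A n w) z)); last first.
  by apply/funext => w; rewrite ker_tr.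
apply: cmeasM; first exact: cmeas_cst.
apply: cmeas_tr => i j; exact: cmeas_resolvent.
Qed.

(** f is a limit of normalized traces of resolvents, whose modulus is at most 1 / Im z. *)
Lemma averaged_law_bound (z f : R[i]) : 0 < complex.Im z ->
  averaged_law P xi x y z f -> cabs f <= (complex.Im z)^-1.
Proof.
move=> z0 hf; apply/ler_addgt0Pr => e e0.
have lo : 0 < (1 : R) <= 1 by rewrite ltr01 lexx.
have [n [hn he]] := filter_ex (filterI (hyps lo) (hf e e0)).
have o1 := @opb1 R n; apply: (@le_trans _ _ ((complex.Im z)^-1 + dev P xi x y z f (1%:M : 'M[R]_n))).
  rewrite /dev -(Ex_cst (P n) (cabs f)) -[X in X + _](Ex_cst (P n)) -ExD; last 2 first.
  - exact: bmf_cst.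
  - by apply: bmf_cabs; exact: (dev_bmf hn z0 f o1).
  apply: Ex_le => [||w]; first exact: bmf_cst.
    by apply: bmfD; [exact: bmf_cst|apply: bmf_cabs; exact: (dev_bmf hn z0 f o1)].
  have nn : n%:R != 0 :> R by rewrite pnatr_eq0 -lt0n (loop_n hn).
  set t := tr_dev _ _ _ _ _ _ _.
  have e1 : f = n%:R^-1 * \tr (resolvent (sum_mx (@xi n) (@x n) (@y n) w) z) - t.
    rewrite /t /tr_dev map_mx1 mulmx1 subKr mxtrace1.
    by rewrite -(mulr_natl 1) mulr1 mulVf// rmorph1 mulr1.
  rewrite {1}e1; apply: le_trans (cabsB _ _) _; rewrite lerD2r.
  apply: (ninv_tr hn); first by rewrite invr_ge0 ltW.
  have zn : complex.Im z != 0 by rewrite gt_eqF.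
  rewrite -(gtr0_norm z0); exact: (resolvent_copb (sum_mx_sym _ _ _ w) zn).
by rewrite lerD2l; exact: he.
Qed.

Lemma limit_law : exists N : probability R R,
  (forall phi, bounded_continuous phi ->
     (forall n, bmf (fun w => \int[esd (@A n w)]_l phi l)) /\
     forall e : R, 0 < e -> \forall n \near \oo,
       Ex (P n) (fun w => `|\int[esd (@A n w)]_l phi l - \int[N]_l phi l|) <= e) /\
  solves_cubic c (stieltjes N).
Proof.
have : forall z, exists f, 0 < complex.Im z -> averaged_law P xi x y z f.
  move=> z; have [z0|z0] := ltP 0 (complex.Im z).
    by have [f hf] := averaged_law_upper hyps z0; exists f.
  by exists 0.
move=> /choice[F hF].
have ker_cvg z : 0 < complex.Im z -> forall e : R, 0 < e -> \forall n \near \oo,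
    Ex (P n) (fun w => cabs (n%:R^-1 * \sum_(l <- @eig n w) stieltjes_kernel z l - F z)) <= e.
  move=> z0 e e0; near=> n.
  have hyp1 : loop_hyps (P n) (@xi n) (@x n) (@y n) C0 k c 1 (p n).
    by near: n; apply: hyps; rewrite ltr01 lexx.
  have n0 := loop_n hyp1.
  have -> : Ex (P n) (fun w => cabs (n%:R^-1 * \sum_(l <- @eig n w) stieltjes_kernel z l - F z))
      = dev P xi x y z (F z) (1%:M : 'M[R]_n).
    apply: Ex_ae.
    - by apply: measurable_cabs; apply: cmeasD; [exact: ker_meas|exact: cmeas_cst].
    - by apply: (bmf_cabs (dev_bmf hyp1 z0 _ (@opb1 R n))).1.
    apply: filterS (A_ae n) => w Aw; congr cabs; rewrite ker_tr ?gt_eqF// Aw.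
    rewrite /tr_dev map_mx1 mulmx1 mxtrace1.
    by rewrite -(mulr_natl 1) mulr1 mulVf ?rmorph1 ?mulr1// pnatr_eq0 -lt0n.
  have hn : forall D : 'M[R]_n, opb D 1 -> dev P xi x y z (F z) D <= e.
    by near: n; exact: hF.
  by apply: hn; exact: opb1.
have F_cubic z : 0 < complex.Im z -> cubic c z (F z) = 0.
  by move=> z0; exact: (averaged_law_cubic hyps z0 (hF z z0)).
have F_tight e : 0 < e -> exists L : R, 0 < L /\ 1 - L * complex.Im (F (Complex 0 L)) <= e.
  (* L >= 2 gives |z| >= 2 and |F z| <= 1/L <= 1/2; L >= 4 c / e gives 4 c |F z|^2 <= 4 c / L <=
     e. *)
  move=> e0; pose L : R := 2 + 4 * c / e.
  have ce : 0 < 4 * c / e by rewrite divr_gt0// mulr_gt0.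
  have L2 : 2 <= L by rewrite lerDl ltW.
  have L0 : 0 < L by apply: lt_le_trans L2.
  exists L; split => //; set z : R[i] := Complex 0 L.
  have z0 : 0 < complex.Im z by [].
  have fL := averaged_law_bound z0 (hF z z0); rewrite /= in fL.
  have zL : 2 <= cabs z.
    by apply: le_trans L2 _; apply: le_trans (Im_le_cabs z); rewrite /= gtr0_norm.
  have f2 : cabs (F z) <= 2^-1 by apply: le_trans fL _; rewrite lef_pV2 ?posrE.
  have hb := cubic_resolvent_bound c_gt0 zL f2 (F_cubic z z0).
  have -> : 1 - L * complex.Im (F z) = complex.Re (1 + z * F z).
    by rewrite cReD cReM /= mul0r sub0r.
  apply: le_trans (ler_norm _) _; apply: le_trans (Re_le_cabs _) _; apply: le_trans hb _.
  have fe : cabs (F z) ^+ 2 <= L^-1.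
    have L1 : L^-1 <= 1 by rewrite invf_le1//; lra.
    have f0 := cabs_ge0 (F z); rewrite expr2; apply: (@le_trans _ _ (L^-1 * 1)).
      by apply: ler_pM => //; apply: le_trans fL L1.
    by rewrite mulr1.
  have c4 : 0 < 4 * c by rewrite mulr_gt0.
  apply: le_trans (ler_wpM2l (ltW c4) fe) _; rewrite ler_pdivrMr//.
  by rewrite [leRHS]mulrC -ler_pdivrMr// /L lerDr.
have [N hN] := linstat_weak_limit size_eig ker_meas ker_cvg F_tight.
exists N; split.
  move=> phi bphi; have [b1 b2] := hN phi bphi.
  have e1 n : (fun w => \int[esd (@A n w)]_l phi l) = @linstat R d T eig phi n.
    by apply/funext => w; rewrite Rintegral_esd//; exact: bc_bmf.
  split; first by move=> n; rewrite e1; exact: b1.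
  move=> e e0; have := b2 e e0; apply: filterS => n; apply: le_trans.
  rewrite le_eqVlt; apply/orP; left; apply/eqP; apply: Ex_eq => w.
  by rewrite -[LHS]/(`| (fun w => \int[esd (@A n w)]_l phi l) w - _|) e1.
(* L1 limits are unique; applied to the two parts of the kernel this identifies the transform of [N]
   with [F]. *)
have uniq_lim (phi : R -> R) (l : R) : bounded_continuous phi ->
    (forall e : R, 0 < e -> \forall n \near \oo,
      Ex (P n) (fun w => `|@linstat R d T eig phi n w - l|) <= e) -> Ex N phi = l.
  move=> bphi hl; have [b1 b2] := hN phi bphi.
  apply/eqP; rewrite -subr_eq0 -normr_le0; apply/ler_addgt0Pr => e e0; rewrite add0r.
  have e2 : 0 < e / 2 by rewrite divr_gt0.
  have [n [h1 h2]] := filter_ex (filterI (hl _ e2) (b2 _ e2)).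
  have bB a : bmf (fun w => `|@linstat R d T eig phi n w - a|).
    by apply: bmf_norm; apply: bmfB; [exact: b1|exact: bmf_cst].
  rewrite [leRHS](splitr e); apply: le_trans (lerD h1 h2); rewrite -ExD//.
  rewrite -[leLHS](Ex_cst (P n)); apply: Ex_le; [exact: bmf_cst|exact: bmfD|] => w.
  rewrite -[X in `|X|](_ : (@linstat R d T eig phi n w - l) - (@linstat R d T eig phi n w - Ex N phi) = _).
    exact: ler_normB.
  by ring.
have stE z : 0 < complex.Im z -> stieltjes N z = F z.
  move=> z0; have zn : complex.Im z != 0 by rewrite gt_eqF.
  apply: complex_eq => /=; (apply: uniq_lim; [exact: bc_Re_kernel || exact: bc_Im_kernel|]) => e e0.
    have := ker_cvg z z0 e e0; apply: filterS => n; apply: le_trans; apply: Ex_le.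
    - apply: bmf_norm; apply: bmfB; last exact: bmf_cst.
      by case: (hN _ (bc_Re_kernel zn)).
    - apply: bmf_cabs; apply: cbmfB; last exact: cbmf_cst.
      exact: (ker_bmf size_eig ker_meas n z0).
    - by move=> w; rewrite linstat_Re_kernel -cReN -cReD; exact: Re_le_cabs.
  have := ker_cvg z z0 e e0; apply: filterS => n; apply: le_trans; apply: Ex_le.
  - apply: bmf_norm; apply: bmfB; last exact: bmf_cst.
    by case: (hN _ (bc_Im_kernel zn)).
  - apply: bmf_cabs; apply: cbmfB; last exact: cbmf_cst.
    exact: (ker_bmf size_eig ker_meas n z0).
  - by move=> w; rewrite linstat_Im_kernel -cImN -cImD; exact: Im_le_cabs.
move=> z; rewrite neq_lt => /orP[z0|z0]; last by rewrite stE//; exact: F_cubic.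
have z1 : 0 < complex.Im (conjc z) by case: (z) z0 => a b /=; rewrite oppr_gt0.
have zn : complex.Im (conjc z) != 0 by rewrite gt_eqF.
rewrite -(conjcK z) (stieltjes_conj (@has_stieltjes_probability R N) zn) stE//.
by apply: (cubic_conj (c := c)); exact: F_cubic.
Unshelve. all: by end_near. Qed.

(** Markov's inequality for the sum of the deviations of the finitely many test functions. *)
Lemma limit_law_in_prob (N : probability R R) :
  (forall phi, bounded_continuous phi ->
     (forall n, bmf (fun w => \int[esd (@A n w)]_l phi l)) /\
     forall e : R, 0 < e -> \forall n \near \oo,
       Ex (P n) (fun w => `|\int[esd (@A n w)]_l phi l - \int[N]_l phi l|) <= e) ->
  cvg_in_prob_weakly P (fun n w => esd (@A n w)) N.
Proof.
move=> hN k' phi e cphi bphi e0.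
have bc i : bounded_continuous (phi i) by split => //; exact: bphi.
pose U i n (w : T n) := `|\int[esd (@A n w)]_l phi i l - \int[N]_l phi i l|.
have bU i n : bmf (@U i n).
  apply: bmf_norm; apply: bmfB; last exact: bmf_cst.
  by case: (hN _ (bc i)).
have bS n : bmf (fun w => \sum_i @U i n w) by apply: bmf_sum.
have SE n : [set w | ~ weak_nbhd N phi e (esd (@A n w))] =
    \bigcup_(i in [set: 'I_k']) [set w | e <= @U i n w].
  apply/seteqP; split => w /=.
    move=> /existsNP[i /negP]; rewrite -leNgt => ei; exists i => //.
  by move=> [i _ /= ei] /(_ i); rewrite ltNge ei.
have mS n : measurable [set w | ~ weak_nbhd N phi e (esd (@A n w))].
  rewrite SE; apply: fin_bigcup_measurable => // i _.
  rewrite (_ : [set w | _] = setT `&` (@U i n) @^-1` `[e, +oo[); last first.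
    by rewrite setTI; apply/seteqP; split => w /=; rewrite in_itv /= andbT.
  by apply: (bU i n).1.
have le_prob n : fine (P n [set w | ~ weak_nbhd N phi e (esd (@A n w))]) <=
    e^-1 * \sum_i Ex (P n) (@U i n).
  rewrite -Ex_indic// -Ex_sum// -ExZ//; apply: Ex_le => [||w]; first exact: bmf_indic.
    by apply: bmfM => //; exact: bmf_cst.
  have S0 : 0 <= \sum_i @U i n w by apply: sumr_ge0 => i _; exact: normr_ge0.
  rewrite indicE; case: (boolP (w \in _)) => [|_]; last by rewrite mulr_ge0// invr_ge0 ltW.
  rewrite inE SE => -[i _ /= ei]; rewrite ler_pdivlMl// mulr1; apply: le_trans ei _.
  by rewrite (bigD1 i)//= lerDl; apply: sumr_ge0 => j _; exact: normr_ge0.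
apply: cvg_EFin; first by apply: nearW => n; exact: fin_num_measure.
apply/cvgrPdist_le => r r0.
(* The successor of k' keeps the denominator positive when there is no test function. *)
have rk : 0 < e * r / k'.+1%:R by rewrite divr_gt0// mulr_gt0.
have hn : \forall n \near \oo, forall i, Ex (P n) (@U i n) <= e * r / k'.+1%:R.
  apply: filter_forall => i; exact: (hN _ (bc i)).2 _ rk.
apply: filterS hn => n hn; rewrite sub0r normrN ger0_norm ?fine_ge0//.
apply: le_trans (le_prob n) _; rewrite ler_pdivrMl//.
apply: le_trans (ler_sum _ (fun i _ => hn i)) _.
rewrite sumr_const card_ord -[leLHS]mulr_natl mulrCA -[leRHS]mulr1; apply: ler_wpM2l.
  by rewrite ltW// mulr_gt0.
by rewrite ler_pdivrMr// mul1r ler_nat.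
Qed.

End LimitLaw.

(** * Truncation of the vectors *)

Section OperatorNorm.
Context {R : realType} {n : nat}.
Implicit Types (D : 'M[R]_n) (u : 'cV[R]_n).

Lemma norm2_sqr u : norm2 u ^+ 2 = inner u u.
Proof. by rewrite /norm2 sqr_sqrtr// inner_ge0. Qed.

(** Cauchy-Schwarz row by row. It shows that the supremum in [op_norm] is taken over a bounded
    set. *)
Lemma opb_hs D : opb D (hs_norm D).
Proof.
move=> u; rewrite /hs_norm sqr_sqrtr; last first.
  by apply: sumr_ge0 => i _; apply: sumr_ge0 => j _; exact: sqr_ge0.
rewrite mulr_suml; apply: ler_sum => i _; rewrite -expr2 mxE.
apply: le_trans (cauchy_schwarz (fun j => D i j) (fun j => u j 0)) _.
by apply: ler_wpM2l; [apply: sumr_ge0 => j _; exact: sqr_ge0|apply: ler_sum => j _; rewrite expr2].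
Qed.

Let unit_image D := [set norm2 (D *m u) | u in [set u : 'cV[R]_n | norm2 u <= 1]].

Let opb_unit D K u : 0 <= K -> opb D K -> norm2 u <= 1 -> norm2 (D *m u) <= K.
Proof.
move=> K0 hD u1; rewrite -(@ler_pXn2r _ 2)// ?nnegrE ?sqrtr_ge0// norm2_sqr.
apply: le_trans (hD u) _; rewrite -[leRHS]mulr1; apply: ler_wpM2l; first exact: sqr_ge0.
by rewrite -norm2_sqr expr_le1// sqrtr_ge0.
Qed.

Let unit_image0 D : unit_image D 0.
Proof.
exists 0 => /=; rewrite /norm2 ?mulmx0 /inner big1 ?sqrtr0// => i _; by rewrite mxE mul0r.
Qed.

Lemma op_norm_le D K : 0 <= K -> opb D K -> op_norm D <= K.
Proof.
move=> K0 hD; apply: ge_sup; first by exists 0; exact: unit_image0.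
by move=> _ [u u1 <-]; exact: opb_unit.
Qed.

Let le_op_norm D u : norm2 u <= 1 -> norm2 (D *m u) <= op_norm D.
Proof.
move=> u1; apply: ub_le_sup; last by exists u.
exists (hs_norm D) => _ [v v1 <-]; apply: opb_unit => //; first exact: sqrtr_ge0.
exact: opb_hs.
Qed.

Lemma op_norm_ge0 D : 0 <= op_norm D.
Proof.
have [u u1 <-] := unit_image0 D; exact: le_op_norm.
Qed.

Lemma opb_op_norm D : opb D (op_norm D).
Proof.
move=> u; have [u0|un] := eqVneq (inner u u) 0.
  by have := opb_hs D u; rewrite u0 !mulr0.
have up : 0 < inner u u by rewrite lt_def un inner_ge0.
have np : 0 < norm2 u by rewrite sqrtr_gt0.
have vE : inner (D *m ((norm2 u)^-1 *: u)) (D *m ((norm2 u)^-1 *: u)) =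
    (norm2 u) ^- 2 * inner (D *m u) (D *m u).
  by rewrite -scalemxAr !innerZl innerC innerZl mulrA -invfM expr2.
have v1 : norm2 ((norm2 u)^-1 *: u) <= 1.
  rewrite -(@ler_pXn2r _ 2)// ?nnegrE ?sqrtr_ge0// norm2_sqr innerZl innerC innerZl mulrA.
  by rewrite -invfM -expr2 norm2_sqr expr1n mulVf.
have := le_op_norm D v1.
rewrite -(@ler_pXn2r _ 2)// ?nnegrE ?sqrtr_ge0 ?op_norm_ge0// norm2_sqr vE.
by rewrite mulrC ler_pdivrMr ?exprn_gt0// norm2_sqr.
Qed.

Lemma op_norm_normalized D : 0 < op_norm D -> op_norm ((op_norm D)^-1 *: D) = 1.
Proof.
move=> D0; have hb := opbZ (op_norm D)^-1 (opb_op_norm D).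
rewrite mulVf ?gt_eqF// in hb; apply/eqP; rewrite eq_le op_norm_le//=.
have h := opbZ (op_norm D) (opb_op_norm ((op_norm D)^-1 *: D)).
rewrite scalerA divff ?gt_eqF// scale1r in h.
have := op_norm_le (mulr_ge0 (ltW D0) (op_norm_ge0 _)) h.
by rewrite -{1}[op_norm D]mulr1 ler_pM2l.
Qed.

Lemma op_norm1 : (0 < n)%N -> op_norm (1%:M : 'M[R]_n) = 1.
Proof.
move=> n0; apply/eqP; rewrite eq_le op_norm_le ?ler01//=; last exact: opb1.
pose u : 'cV[R]_n := delta_mx (Ordinal n0) 0.
have u1 : norm2 u = 1.
  rewrite /norm2 /inner (bigD1 (Ordinal n0))//= big1 => [|i ni].
    by rewrite mxE !eqxx mulr1 addr0 sqrtr1.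
  by rewrite !mxE (negbTE ni) mulr0.
by rewrite -[leLHS]u1 -{1}[u]mul1mx; apply: le_op_norm; rewrite u1.
Qed.

End OperatorNorm.

Section AlmostSureModification.
Context {R : realType} {d : measure_display} {T : measurableType d}.
Variable P : probability T R.
Implicit Types X Y : T -> R.

Lemma variance_ae X Y : measurable_fun setT X -> bmf Y -> {ae P, forall w, X w = Y w} ->
  'V_P[X] = (Ex P (fun w => (Y w - Ex P Y) ^+ 2))%:E.
Proof.
move=> mX bY XY; have e : fine 'E_P[X] = Ex P Y by rewrite unlock; exact: (Ex_ae mX bY.1 XY).
have b2 : bmf (fun w => (Y w - Ex P Y) ^+ 2) by apply: bmfX; apply: bmfB => //; exact: bmf_cst.
rewrite /variance unlock e unlock /Ex /Rintegral fineK; last first.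
  by apply: integrable_fin_num => //; exact: bmf_int.
apply: ae_eq_integral => //.
- apply/measurable_EFinP; apply: measurable_funM; apply: measurable_funB => //; exact: measurable_cst.
- by apply/measurable_EFinP; exact: b2.1.
- by apply: filterS XY => w h _; congr EFin; rewrite expr2 -h.
Qed.

(** The vectors are bounded almost surely, whereas [bmf] asks for a bound at every outcome; vectors
    beyond the bound are replaced by 0. *)
Definition truncate n (C0 : R) (u : 'cV[R]_n) : 'cV[R]_n :=
  if inner u u <= C0 then u else 0.

Lemma inner_truncate n C0 (u : 'cV[R]_n) : 0 <= C0 ->
  inner (truncate C0 u) (truncate C0 u) <= C0.
Proof.
move=> h; rewrite /truncate; case: ifP => // _.
by rewrite /inner big1// => i _; rewrite mxE mul0r.
Qed.

Lemma measurable_truncate d' (T' : measurableType d') n C0 (u : T' -> 'cV[R]_n) :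
  (forall i, measurable_fun setT (fun w => u w i 0)) ->
  forall i, measurable_fun setT (fun w => truncate C0 (u w) i 0).
Proof.
move=> hu i; rewrite (_ : (fun w => _) = fun w => if inner (u w) (u w) <= C0 then u w i 0 else 0).
  apply: measurable_fun_ifT => //.
  apply: measurable_fun_ler; last exact: measurable_cst.
  by apply: measurable_sum => j; exact: measurable_funM.
by apply/funext => w; rewrite /truncate; case: ifP => //; rewrite mxE.
Qed.

End AlmostSureModification.

(** * Joint independence of the Bernoulli variables and the truncated pairs *)

Section IndependentSystems.
Context {R : realType} {d : measure_display} {T : measurableType d}.
Variable P : probability T R.
Variables (n m : nat) (xi : 'I_m -> T -> bool) (x y : 'I_m -> T -> 'cV[R]_n).

Lemma sigma_of_sub (I : Type) d' (T' : measurableType d') (X : I -> T -> T') (i : I) :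
  sigma_of (fun _ : unit => X i) `<=` sigma_of X.
Proof.
apply: sub_sigma_algebra2 => A [_ _ hA]; by exists i.
Qed.

Lemma sigma_of_bigcap (I : Type) d' (T' : measurableType d') (X : I -> T -> T')
    (J : finType) (D : {set J}) (A : J -> set T) :
  (forall j, j \in D -> sigma_of X (A j)) -> sigma_of X (\bigcap_(j in [set` D]) A j).
Proof.
move=> h; rewrite /sigma_of; set G := \bigcup_(i in _) _.
apply: (@fin_bigcap_measurable _ (g_sigma_algebraType G) J [set` D] A) => //; exact: finite_finpred.
Qed.

Lemma sigma_of_truncate C0 a :
  sigma_of (pair_coord (fun w => truncate C0 (x a w)) (fun w => truncate C0 (y a w))) `<=`
  sigma_of (pair_coord (x a) (y a)).
Proof.
set G := \bigcup_(i in [set: 'I_n + 'I_n]) preimage_set_system setT (pair_coord (x a) (y a) i) measurable.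
have gx (i : 'I_n + 'I_n) : gmeas G (pair_coord (x a) (y a) i).
  by move=> _ B mB; apply: sub_sigma_algebra; exists i => //; exists B.
apply: smallest_sub; first exact: smallest_sigma_algebra.
move=> _ [i _ [B mB <-]].
have : gmeas G (pair_coord (fun w => truncate C0 (x a w)) (fun w => truncate C0 (y a w)) i).
  case: i => i /=; apply: (measurable_truncate (T' := g_sigma_algebraType G)) => j; [exact: (gx (inl j))|exact: (gx (inr j))].
by move=> /(_ measurableT B mB).
Qed.

(** An intersection over indices of both kinds splits into one part per kind. The two parts are
    independent of each other, and each factors by independence within its kind; truncation only
    shrinks the sigma-algebras. *)
Lemma coord_system_indep C0 :
  mutually_independent P (fun a => sigma_of (fun _ : unit => xi a)) ->
  mutually_independent P (fun a => sigma_of (pair_coord (x a) (y a))) ->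
  independent2 P (sigma_of xi)
    (sigma_of (fun ak : 'I_m * ('I_n + 'I_n) => pair_coord (x ak.1) (y ak.1) ak.2)) ->
  mutually_independent P (coord_system xi (fun a w => truncate C0 (x a w))
    (fun a w => truncate C0 (y a w))).
Proof.
move=> ixi ixy ixx J A hA.
pose J1 := finset (fun a : 'I_m => inl a \in J) : {set 'I_m}.
pose J2 := finset (fun a : 'I_m => inr a \in J) : {set 'I_m}.
have h1 a : a \in J1 -> sigma_of (fun _ : unit => xi a) (A (inl a)).
  by rewrite finset.inE => /hA.
have h2 a : a \in J2 -> sigma_of (pair_coord (x a) (y a)) (A (inr a)).
  by rewrite finset.inE => /hA; exact: sigma_of_truncate.
have -> : \bigcap_(i in [set` J]) A i =
    (\bigcap_(a in [set` J1]) A (inl a)) `&` (\bigcap_(a in [set` J2]) A (inr a)).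
  apply/seteqP; split => w /=.
    by move=> h; split => a /=; rewrite finset.inE => aJ; exact: h.
  by move=> [hl hr] [a|a] aJ; [apply: hl|apply: hr]; rewrite /= finset.inE.
rewrite ixx.
- rewrite ixi// ixy// big_sumType /=; congr (_ * _)%E; apply: eq_bigl => a;
    by rewrite finset.inE.
- by apply: sigma_of_bigcap => a /h1; exact: (@sigma_of_sub _ _ _ xi a).
- apply: sigma_of_bigcap => a /h2.
  apply: sub_sigma_algebra2 => B [i _ hB].
  by exists (a, i).
Qed.

End IndependentSystems.

(** * Transfer of the moment and variance hypotheses to the truncated vectors *)

Section RandomMatrices.
Context {R : realType}.
Variables (m : nat -> nat) (d : nat -> measure_display)
  (T : forall n, measurableType (d n)) (P : forall n, probability (T n) R)
  (xi : forall n, 'I_(m n) -> T n -> bool)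
  (x y : forall n, 'I_(m n) -> T n -> 'cV[R]_n) (C0 : R).
Hypothesis C0_gt0 : 0 < C0.
Hypothesis xi_meas : forall n a, measurable_fun setT (@xi n a).
Hypothesis x_meas : forall n a, random_vector (@x n a).
Hypothesis y_meas : forall n a, random_vector (@y n a).
Hypothesis x_bd : forall n a, {ae P n, forall w, norm2 (@x n a w) ^+ 2 <= C0}.
Hypothesis y_bd : forall n a, {ae P n, forall w, norm2 (@y n a w) ^+ 2 <= C0}.

Let xt n (a : 'I_(m n)) (w : T n) := truncate C0 (x a w).
Let yt n (a : 'I_(m n)) (w : T n) := truncate C0 (y a w).

Lemma arm_truncate_ae n s a :
  {ae P n, forall w, arm (@x n) (@y n) s a w = arm (@xt n) (@yt n) s a w}.
Proof.
by case: s => /=; [apply: filterS (x_bd a)|apply: filterS (y_bd a)] => w;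
  rewrite norm2_sqr /arm /xt /yt /truncate => ->.
Qed.

Lemma arm_meas n s a : random_vector (arm (@x n) (@y n) s a).
Proof. by case: s; [exact: x_meas|exact: y_meas]. Qed.

Lemma arm_truncate_meas n s a : random_vector (arm (@xt n) (@yt n) s a).
Proof. by case: s; apply: measurable_truncate; [exact: x_meas|exact: y_meas]. Qed.

Lemma arm_truncate_le n s a w :
  inner (arm (@xt n) (@yt n) s a w) (arm (@xt n) (@yt n) s a w) <= C0.
Proof. by case: s; apply: inner_truncate; exact: ltW. Qed.

Lemma arm_truncate_bmf n s a i : bmf (fun w => arm (@xt n) (@yt n) s a w i 0).
Proof.
apply: (bmf_le (K := Num.sqrt C0)); first exact: arm_truncate_meas.
move=> w; rewrite -sqrtr_sqr ler_wsqrtr//; apply: le_trans (arm_truncate_le s a w).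
by rewrite /inner (bigD1 i)//= -expr2 lerDl sumr_ge0// => j _; rewrite -expr2 sqr_ge0.
Qed.

Lemma mean_mx_arm n s t a :
  mean_mx (P n) (fun w => arm (@x n) (@y n) s a w *m (arm (@x n) (@y n) t a w)^T) =
  second_moment (P n) (@xt n) (@yt n) s t a.
Proof.
apply/matrixP => i j; rewrite !mxE unlock.
have b : bmf (fun w => arm (@xt n) (@yt n) s a w i 0 * arm (@xt n) (@yt n) t a w j 0).
  by apply: bmfM; exact: arm_truncate_bmf.
apply: (Ex_ae (f := fun w => (arm (@x n) (@y n) s a w *m (arm (@x n) (@y n) t a w)^T) i j) _ b.1).
  under eq_fun do rewrite mxE big_ord1 mxE.
  by apply: measurable_funM; exact: arm_meas.
apply: filterS2 (arm_truncate_ae s a) (arm_truncate_ae t a) => w -> ->.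
by rewrite mxE big_ord1 mxE.
Qed.

Definition quad_var n (D : 'M[R]_n) (s t : bool) (a b : 'I_(m n)) : R :=
  Ex (P n) (fun w => (inner (D *m arm (@xt n) (@yt n) s a w) (arm (@xt n) (@yt n) t b w) -
    Ex (P n) (fun w => inner (D *m arm (@xt n) (@yt n) s a w) (arm (@xt n) (@yt n) t b w))) ^+ 2).

Let quad_bmf n (D : 'M[R]_n) s t a b :
  bmf (fun w => inner (D *m arm (@xt n) (@yt n) s a w) (arm (@xt n) (@yt n) t b w)).
Proof.
apply: bmf_sum => i; apply: bmfM; last exact: arm_truncate_bmf.
under eq_fun do rewrite mxE; apply: bmf_sum => j.
by apply: bmfM; [exact: bmf_cst|exact: arm_truncate_bmf].
Qed.

Lemma quad_varE n (D : 'M[R]_n) s t a b :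
  'V_(P n)[fun w => inner (D *m arm (@x n) (@y n) s a w) (arm (@x n) (@y n) t b w)] =
  (quad_var D s t a b)%:E.
Proof.
apply: variance_ae; [|exact: quad_bmf|].
  apply: measurable_sum => i; apply: measurable_funM; last exact: arm_meas.
  under eq_fun do rewrite mxE; apply: measurable_sum => j.
  by apply: measurable_funM; [exact: measurable_cst|exact: arm_meas].
by apply: filterS2 (arm_truncate_ae s a) (arm_truncate_ae t b) => w -> ->.
Qed.

Lemma quad_varZ n r (D : 'M[R]_n) s t a b :
  quad_var (r *: D) s t a b = r ^+ 2 * quad_var D s t a b.
Proof.
rewrite /quad_var; set Z := fun w => inner (D *m _) _.
have e w : inner ((r *: D) *m arm (@xt n) (@yt n) s a w) (arm (@xt n) (@yt n) t b w) = r * Z w.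
  by rewrite -scalemxAl innerZl.
have eM : Ex (P n) (fun w => inner ((r *: D) *m arm (@xt n) (@yt n) s a w)
    (arm (@xt n) (@yt n) t b w)) = r * Ex (P n) Z.
  by rewrite -ExZ; [exact: Ex_eq|exact: quad_bmf].
have bV : bmf (fun w => (Z w - Ex (P n) Z) ^+ 2).
  by apply: bmfX; apply: bmfB; [exact: quad_bmf|exact: bmf_cst].
rewrite -[RHS](ExZ (P n) _ bV); apply: Ex_eq => w.
by rewrite eM e -mulrBr exprMn.
Qed.

(** For each n a matrix violating the bound is selected if there is one, and the identity otherwise.
    The hypothesis on this one sequence excludes violations for all large n. *)
Lemma quad_var_uniform :
  (forall D : forall n, 'M[R]_n, (forall n, (0 < n)%N -> op_norm (D n) = 1) ->
     ereal_sup
       [set 'V_(P n)[fun w => inner (D n *m u w) (v w)]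
         | u in range (@x n) `|` range (@y n) & v in range (@x n) `|` range (@y n)]
       @[n --> \oo] --> 0%E) ->
  forall e : R, 0 < e -> \forall n \near \oo, forall D : 'M[R]_n, opb D 1 ->
    forall s t a b, quad_var D s t a b <= e.
Proof.
move=> hvar e e0.
pose bad n (D : 'M[R]_n) := opb D 1 /\ exists s t a b, e < quad_var D s t a b.
have : forall n, exists D : 'M[R]_n, (0 < n)%N -> op_norm D = 1 /\
    ((exists D', bad n D') -> exists s t a b, e < quad_var D s t a b).
  move=> n; have [[D [hD [s [t [a [b hs]]]]]]|nbad] := pselect (exists D', bad n D').
    have D1 : op_norm D <= 1 by apply: op_norm_le.
    (* A violating matrix is not 0, since its variance exceeds e. *)
    have D0 : 0 < op_norm D.
      rewrite lt_def op_norm_ge0 andbT; apply/eqP => D0.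
      have Dz : D = 0 *: D.
        rewrite scale0r; apply/matrixP => i j; rewrite mxE.
        have := opb_op_norm D (delta_mx j 0); rewrite D0 expr0n mul0r => h.
        have h2 : inner (D *m delta_mx j 0) (D *m delta_mx j 0) = 0.
          by apply/eqP; rewrite eq_le h inner_ge0.
        move/eqP: h2; rewrite /inner psumr_eq0 => [/allP/(_ i)|k _]; last by rewrite -expr2 sqr_ge0.
        rewrite mem_index_enum => /(_ isT); rewrite -colE mxE.
        by rewrite mulf_eq0 orbb => /eqP.
      by move: hs; rewrite Dz quad_varZ expr0n mul0r ltNge (ltW e0).
    exists ((op_norm D)^-1 *: D) => n0; split; first exact: op_norm_normalized.
    (* The hypothesis demands norm exactly 1. The norm being at most 1, normalization only increases
       the variance. *)
    move=> _; exists s, t, a, b; apply: lt_le_trans hs _; rewrite quad_varZ.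
    rewrite ler_peMl//; last by rewrite exprVn invf_ge1 ?exprn_gt0// expr_le1 ?op_norm_ge0.
    by apply: Ex_ge0 => w; exact: sqr_ge0.
  by exists 1%:M => n0; split; [exact: op_norm1|move=> /nbad].
move=> hD; pose D n := sval (cid (hD n)); have DP n := svalP (cid (hD n)).
have D1 n : (0 < n)%N -> op_norm (D n) = 1 by move=> /(DP n)[].
have e2 : (0 < e%:E)%E by rewrite lte_fin.
have hnear : \forall n \near \oo, (ereal_sup
    [set 'V_(P n)[fun w => inner (D n *m u w) (v w)]
      | u in range (@x n) `|` range (@y n) & v in range (@x n) `|` range (@y n)] < e%:E)%E.
  have /(_ [set u | (u < e%:E)%E]) := hvar D D1; apply.
  by apply: open_nbhs_nbhs; split; [exact: open_ereal_lt_ereal|].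
near=> n; move=> D' hD' s t a b; rewrite leNgt; apply/negP => hlt.
have n0 : (0 < n)%N by near: n; exact: nbhs_infty_gt.
have [_ []] := DP n n0; first by exists D'; split => //; exists s, t, a, b.
move=> s' [t' [a' [b' h]]].
have hs : (ereal_sup [set 'V_(P n)[fun w => inner (D n *m u w) (v w)]
      | u in range (@x n) `|` range (@y n) & v in range (@x n) `|` range (@y n)] < e%:E)%E.
  by near: n.
have ra r (c : 'I_(m n)) : (range (@x n) `|` range (@y n)) (arm (@x n) (@y n) r c).
  by case: r; [left|right]; exists c.
have : ((quad_var (D n) s' t' a' b')%:E < e%:E)%E.
  apply: le_lt_trans hs; rewrite -quad_varE; apply: ereal_sup_ubound.
  exists (arm (@x n) (@y n) s' a'); first exact: ra.
  by exists (arm (@x n) (@y n) t' b'); first exact: ra.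
by rewrite lte_fin ltNge (ltW h).
Unshelve. all: by end_near. Qed.

End RandomMatrices.

Theorem theorem4p1 (R : realType)
  (m : nat -> nat) (hm : m n @[n --> \oo] --> \oo)
  (d : nat -> measure_display) (T : forall n, measurableType (d n))
  (P : forall n, probability (T n) R)
  (xi : forall n, 'I_(m n) -> {RV P n >-> bool})
  (x y : forall n, 'I_(m n) -> T n -> 'cV[R]_n)
  (hx : forall n a, random_vector (x n a))
  (hy : forall n a, random_vector (y n a))
  (p : nat -> R) (c1 C0 : R)
  (* (i) *)
  (hxi_law : forall n a, P n [set w | xi n a w = true] = (p n)%:E)
  (hxi_indep : forall n,
     mutually_independent (P n) (fun a => sigma_of (fun _ : unit => xi n a)))
  (hxi_xy : forall n,
     independent2 (P n) (sigma_of (fun a => xi n a))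
       (sigma_of (fun ak : 'I_(m n) * ('I_n + 'I_n) =>
                    pair_coord (x n ak.1) (y n ak.1) ak.2)))
  (* (ii) *)
  (hc1 : 0 < c1)
  (hp : (m n)%:R / n%:R * p n @[n --> \oo] --> c1)
  (* (iii) *)
  (hxy_indep : forall n,
     mutually_independent (P n) (fun a => sigma_of (pair_coord (x n a) (y n a))))
  (hC0 : 0 < C0)
  (hx_bd : forall n a, {ae P n, forall w, norm2 (x n a w) ^+ 2 <= C0})
  (hy_bd : forall n a, {ae P n, forall w, norm2 (y n a w) ^+ 2 <= C0})
  (hvar : forall D : forall n, 'M[R]_n,
     (forall n, (0 < n)%N -> op_norm (D n) = 1) ->
     ereal_sup
       [set 'V_(P n)[fun w => inner (D n *m u w) (v w)]
         | u in range (x n) `|` range (y n) & v in range (x n) `|` range (y n)]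
       @[n --> \oo] --> 0%E)
  (* (iv) *)
  (Qx := fun n a => mean_mx (P n) (fun w => x n a w *m (x n a w)^T))
  (Qy := fun n a => mean_mx (P n) (fun w => y n a w *m (y n a w)^T))
  (Qxy := fun n a => mean_mx (P n) (fun w => x n a w *m (y n a w)^T))
  (hQ_op : exists C : R, \forall n \near \oo, forall a : 'I_(m n),
     [/\ op_norm (Qx n a) <= C / n%:R,
         op_norm (Qy n a) <= C / n%:R
       & op_norm (Qxy n a) <= C / n%:R])
  (hQ_tr : ereal_sup [set (`|\tr Q - 1|)%:E | Q in range (Qx n) `|` range (Qy n)]
     @[n --> \oo] --> 0%E)
  (* (v) *)
  (hQ_avg : forall n (K1 K2 : 'M[R]_n),
     (m n)%:R^-1 * (\sum_(a < m n) \tr (Qx n a *m K1) * \tr (Qy n a *m K2)) =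
     (n%:R^-1 * \tr K1) * (n%:R^-1 * \tr K2))
  (* (vi) *)
  (Qxy_avg := fun n =>
     \matrix_(i < n, j < n) ((m n)%:R^-1 * \sum_(a < m n) `|Qxy n a i j|))
  (hQxy_hs : (fun n => hs_norm (Qxy_avg n)) =o_\oo
             (fun n => (Num.sqrt n%:R)^-1 : R))
  (A := fun n (w : T n) =>
     \sum_(a < m n) (xi n a w)%:R *:
       (x n a w *m (y n a w)^T + y n a w *m (x n a w)^T)) :
  exists N : probability R R,
    [/\ cvg_in_prob_weakly P (fun n w => esd (A n w)) N,
        solves_cubic c1 (stieltjes N)
      & forall N' : {measure set R -> \bar R},
          has_stieltjes N' -> solves_cubic c1 (stieltjes N') ->
          forall z : R[i], complex.Im z != 0 -> stieltjes N' z = stieltjes N z].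
Proof.
pose b n a (w : T n) : bool := xi n a w.
pose xt n a (w : T n) := truncate C0 (x n a w).
pose yt n a (w : T n) := truncate C0 (y n a w).
have b_meas n a : measurable_fun setT (b n a) by exact: measurable_funPT.
(* The maximum with 1 gives the lower bound demanded by [loop_k], whatever the size or sign of
   [C]. *)
have [C hC] := hQ_op; pose k := Num.max 1 C.
have eQx n a : Qx n a = second_moment (P n) (xt n) (yt n) true true a.
  exact: (mean_mx_arm hC0 hx hy hx_bd hy_bd true true a).
have eQy n a : Qy n a = second_moment (P n) (xt n) (yt n) false false a.
  exact: (mean_mx_arm hC0 hx hy hx_bd hy_bd false false a).
have eQxy n a : Qxy n a = second_moment (P n) (xt n) (yt n) true false a.
  exact: (mean_mx_arm hC0 hx hy hx_bd hy_bd true false a).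
have hyps (e : R) : 0 < e <= 1 -> \forall n \near \oo,
    loop_hyps (P n) (b n) (xt n) (yt n) C0 k c1 e (p n).
  move=> e01; have /andP[e0 _] := e01; have e20 : 0 < e ^+ 2 by rewrite exprn_gt0.
  have hvar' := quad_var_uniform hC0 hx hy hx_bd hy_bd hvar e20.
  have htr : \forall n \near \oo,
      (ereal_sup [set (`|\tr Q - 1|)%:E | Q in range (Qx n) `|` range (Qy n)] < e%:E)%E.
    have /(_ [set u | (u < e%:E)%E]) := hQ_tr; apply.
    by apply: open_nbhs_nbhs; split; [exact: open_ereal_lt_ereal|rewrite /= lte_fin].
  have /cvgrPdist_le/(_ e e0) hmp := hp.
  have /eqoP/(_ e e0) hhs := hQxy_hs.
  have hm0 : \forall n \near \oo, (0 < m n)%N.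
    by have /(_ [set j | (0 < j)%N]) := hm; apply; exact: nbhs_infty_gt.
  near=> n.
  have n0 : (0 < n)%N by near: n; exact: nbhs_infty_gt.
  have nR : 0 < n%:R :> R by rewrite ltr0n.
  have hCn : forall a : 'I_(m n), [/\ op_norm (Qx n a) <= C / n%:R,
         op_norm (Qy n a) <= C / n%:R & op_norm (Qxy n a) <= C / n%:R] by near: n.
  have Ck : C / n%:R <= k / n%:R.
    by rewrite ler_pM2r ?invr_gt0// /k le_max lexx orbT.
  have k1 : 1 <= k by rewrite /k le_max lexx.
  have kn0 : 0 <= k / n%:R by rewrite divr_ge0// (le_trans _ k1).
  have opk (M : 'M[R]_n) : op_norm M <= C / n%:R -> opb M (k / n%:R).
    move=> h; apply: (opb_le (op_norm_ge0 M) (le_trans h Ck)); exact: opb_op_norm.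
  split.
  - exact: n0.
  - by near: n.
  - exact: e01.
  - have h : e ^- 2 <= n%:R by near: n; apply: nbhs_infty_ger; rewrite num_real.
    by rewrite -[leRHS]invrK lef_pV2 ?posrE// invr_gt0.
  - exact: ltW.
  - exact: k1.
  - exact: ltW.
  - exact: b_meas.
  - exact: (arm_truncate_meas C0 hx hy).
  - exact: arm_truncate_le.
  - exact: coord_system_indep.
  - exact: hxi_law.
  - move=> D hD s t a.
    have h : forall D : 'M[R]_n, opb D 1 -> forall s t a b,
      quad_var P x y C0 D s t a b <= e ^+ 2 by near: n.
    exact: (h D hD s t a a).
  - move=> s t a; have [q1 q2 q3] := hCn a.
    have o3 : opb (second_moment (P n) (xt n) (yt n) true false a) (k / n%:R).
      by rewrite -eQxy; exact: opk.
    case: s; case: t.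
    + by rewrite -eQx; exact: opk.
    + exact: o3.
    (* The moment in the order y, x is the transpose of the one in the order x, y, and transposition
       preserves the norm bound. *)
    + rewrite (_ : second_moment _ _ _ _ _ _ = (second_moment (P n) (xt n) (yt n) true false a)^T).
        exact: opb_tr_mx.
      by apply/matrixP => i j; rewrite !mxE; apply: Ex_eq => w; rewrite mulrC.
    + by rewrite -eQy; exact: opk.
  - move=> s a.
    have h : (ereal_sup [set (`|\tr Q - 1|)%:E | Q in range (Qx n) `|` range (Qy n)] < e%:E)%E
      by near: n.
    rewrite -lee_fin; apply: le_trans (ltW h); apply: ereal_sup_ubound.
    by case: s; [exists (Qx n a); [left; exists a|rewrite eQx]
                |exists (Qy n a); [right; exists a|rewrite eQy]].
  - move=> K1 K2; rewrite -hQ_avg; congr (_ * _); apply: eq_bigr => a _.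
    by rewrite -eQx -eQy.
  - have h : `|hs_norm (Qxy_avg n)| <= e * `|(Num.sqrt n%:R)^-1| by near: n.
    have hs0 : 0 <= hs_norm (Qxy_avg n) by exact: sqrtr_ge0.
    have s0 : 0 <= (Num.sqrt n%:R : R)^-1 by rewrite invr_ge0 sqrtr_ge0.
    rewrite !ger0_norm// in h.
    have := lerXn2r 2 hs0 (mulr_ge0 (ltW e0) s0) h.
    rewrite {1}/hs_norm sqr_sqrtr; last first.
      by apply: sumr_ge0 => i _; apply: sumr_ge0 => j _; exact: sqr_ge0.
    rewrite exprMn exprVn sqr_sqrtr; last exact: ltW.
    rewrite pair_big/=; apply: le_trans; rewrite le_eqVlt; apply/orP; left; apply/eqP.
    apply: eq_bigr => s _; rewrite mxE; congr (_ ^+ 2); congr (_ * _).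
    by apply: eq_bigr => a _; rewrite eQxy.
  - by rewrite distrC; near: n.
have A_sym n w : (A n w)^T = A n w by exact: (sum_mx_sym (b n) (x n) (y n) w).
(* For each n only finitely many exceptional null sets are involved. *)
have A_ae n : {ae P n, forall w, A n w = sum_mx (b n) (xt n) (yt n) w}.
  have h : {ae P n, forall w, forall a, x n a w = xt n a w /\ y n a w = yt n a w}.
    apply: filter_forall => a.
    apply: filterS2 (arm_truncate_ae hx_bd hy_bd true a) (arm_truncate_ae hx_bd hy_bd false a).
    by [].
  by apply: filterS h => w h; apply: eq_bigr => a _; have [-> ->] := h a.
have A_meas n i j : measurable_fun setT (fun w => A n w i j).
  under eq_fun do rewrite /A summxE; apply: measurable_sum => a.
  under eq_fun do rewrite !mxE !big_ord1 !mxE.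
  apply: measurable_funM.
    rewrite (_ : (fun w => _) = fun w => if b n a w then 1 else 0).
      by apply: measurable_fun_ifT => //; exact: measurable_cst.
    by apply/funext => w; rewrite -/(b n a w); case: (b n a w).
  by apply: measurable_funD; apply: measurable_funM; (exact: hx || exact: hy).
have [N [hN sN]] := limit_law hc1 hyps A_sym A_ae A_meas.
exists N; split => //; first exact: limit_law_in_prob.
move=> N' hN' sN' z z0.
apply: (stieltjes_cubic_unique hc1 hN' _ sN' sN z0).
exact: has_stieltjes_probability.
Unshelve. all: by end_near. Qed.
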